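(* For $y_1,y_2\notin\mathbb Zv$ we have $$f_2(\boldsymbol z;\tau)=-i\,\eta^3(3\tau)\,\frac{\vartheta(3z_1+3z_2;3\tau)}{\vartheta(3z_1;3\tau)\,\vartheta(3z_2;3\tau)}.$$ The function $f_2$ (i.e. the meromorphic function given by the right-hand side) is a meromorphic Jacobi form of weight one and index $\frac12\begin{pmatrix}0&3\\3&0\end{pmatrix}$ on $\Gamma_0(3)$. To be more precise, for $\boldsymbol\ell,\boldsymbol m\in\mathbb Z^2$ we have $$f_2(\boldsymbol z+\boldsymbol\ell\tau+\boldsymbol m)=q^{-3\ell_1\ell_2}\zeta_1^{-3\ell_2}\zeta_2^{-3\ell_1}f_2(\boldsymbol z),$$ and for $\begin{pmatrix}a&b\\c&d\end{pmatrix}\in\Gamma_0(3)$ we have $$f_2\left(\tfrac{z_1}{c\tau+d},\tfrac{z_2}{c\tau+d};\tfrac{a\tau+b}{c\tau+d}\right)=(c\tau+d)\,e^{\frac{6\pi i c z_1z_2}{c\tau+d}}f_2(z_1,z_2;\tau).$$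
   Context: Notation: $\tau=u+iv\in\mathbb H$, $\boldsymbol z=\boldsymbol x+i\boldsymbol y\in\mathbb C^2$, $q:=e^{2\pi i\tau}$, $\zeta_j:=e^{2\pi i z_j}$; $\tau$ is suppressed in the notation when fixed. $\operatorname{sgn}(x):=x/|x|$ for $x\neq0$, $\operatorname{sgn}(0):=0$; $H(x):=1$ for $x>0$ and $H(x):=0$ for $x\le0$. $\eta(\tau):=q^{1/24}\prod_{n\ge1}(1-q^n)$ and $\vartheta(z;\tau):=\sum_{n\in\frac12+\mathbb Z}q^{n^2/2}e^{2\pi i n(z+\frac12)}$. With $\chi_2(\boldsymbol x):=\operatorname{sgn}(x_1)H(x_1x_2)$, the generating function for parallelograms is $$f_2(\boldsymbol z;\tau):=\sum_{\boldsymbol n\in\mathbb Z^2}\chi_2\left(\boldsymbol n+\tfrac{\boldsymbol y}{v}\right)q^{3n_1n_2}\zeta_1^{3n_2}\zeta_2^{3n_1}.$$ A meromorphic function $f:\mathbb C^r\times\mathbb H\to\mathbb C$ with possible poles in $\boldsymbol z$ is a meromorphic Jacobi form of weight $k$ and index $M\in\frac12\mathbb Z^{r\times r}$ for $\Gamma\subset\mathrm{SL}_2(\mathbb Z)$ if for some $a>0$ one has the growth condition $f(\boldsymbol z;\tau)e^{-\frac{4\pi}{v}\boldsymbol y^TM\boldsymbol y}\in O(e^{av})$ as $v\to\infty$, and $f(\boldsymbol z+\boldsymbol\ell\tau+\boldsymbol m)=e^{-4\pi i\boldsymbol z^TM\boldsymbol\ell}q^{-\boldsymbol\ell^TM\boldsymbol\ell}f(\boldsymbol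 z)$ for $\boldsymbol\ell,\boldsymbol m\in\mathbb Z^r$, and $f\left(\frac{\boldsymbol z}{c\tau+d};\frac{a\tau+b}{c\tau+d}\right)=(c\tau+d)^ke^{\frac{2\pi i c}{c\tau+d}\boldsymbol z^TM\boldsymbol z}f(\boldsymbol z;\tau)$ for $\begin{pmatrix}a&b\\c&d\end{pmatrix}\in\Gamma$. *)

(* Defs.v *)
From HB Require Import structures.
From mathcomp Require Import all_boot all_order all_algebra.
From mathcomp Require Import all_classical all_reals all_analysis.
From mathcomp Require Import complex.
From mathcomp Require Export summability.

Set Implicit Arguments.
Unset Strict Implicit.
Unset Printing Implicit Defensive.

Import Order.TTheory GRing.Theory Num.Theory.
Import numFieldNormedType.Exports.

Local Open Scope classical_set_scope.
Local Open Scope ring_scope.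
Local Open Scope complex_scope.

(* The topology and norm that R[i]^o has as a numFieldType, put on R[i]. *)
HB.instance Definition _ (R : rcfType) := NormedModule.copy R[i] R[i]^o.

Section ComplexFunctions.
Variable R : realType.
Local Notation C := R[i].

Definition cexp (z : C) : C :=
  (expR (complex.Re z))%:C * (cos (complex.Im z) +i* sin (complex.Im z)).

(* e2pi z = exp (2 pi i z); hence zeta_j = e2pi z_j, q = e2pi tau, and a
   fractional power q^x always means e2pi (x * tau). *)
Definition e2pi (z : C) : C := cexp (2 * pi%:C * 'i * z).

Definition eta (tau : C) : C :=
  e2pi (tau / 24) *
  lim ((\prod_(1 <= k < n.+1) (1 - e2pi tau ^+ k) : C) @[n --> \oo]).

(* Sums over infinite index sets are limits of the net of finite partial
   sums (unconditional convergence). *)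
Definition theta (z tau : C) : C :=
  sum (fun n : int =>
    let h : C := n%:~R + 2^-1 in
    e2pi (h ^+ 2 / 2 * tau) * e2pi (h * (z + 2^-1)) : C).

Definition chi2 (x1 x2 : R) : R := Num.sg x1 * (0 < x1 * x2)%R%:R.

Definition f2_term (z : 'cV[C]_2) (tau : C) (n : int * int) : C :=
  let z1 := z 0 0 in let z2 := z 1 0 in
  (chi2 (n.1%:~R + complex.Im z1 / complex.Im tau)
        (n.2%:~R + complex.Im z2 / complex.Im tau))%:C
  * e2pi tau ^ (3 * n.1 * n.2) * e2pi z1 ^ (3 * n.2) * e2pi z2 ^ (3 * n.1).

Definition f2 (z : 'cV[C]_2) (tau : C) : C := sum (f2_term z tau).

(* The meromorphic continuation of f2. At a zero of the denominator the
   value is 0, because x / 0 = 0. *)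
Definition f2_mero (z : 'cV[C]_2) (tau : C) : C :=
  let z1 := z 0 0 in let z2 := z 1 0 in
  - 'i * eta (3 * tau) ^+ 3
  * (theta (3 * z1 + 3 * z2) (3 * tau)
     / (theta (3 * z1) (3 * tau) * theta (3 * z2) (3 * tau))).

End ComplexFunctions.

Section JacobiForms.
Variable R : realType.
Local Notation C := R[i].

Definition SL2Z : set 'M[int]_2 := [set g | \det g = 1].
Definition Gamma0 (N : int) : set 'M[int]_2 :=
  [set g | SL2Z g /\ (N %| g 1%R 0%R)%Z].

Definition autfactor (g : 'M[int]_2) (tau : C) : C :=
  (g 1 0)%:~R * tau + (g 1 1)%:~R.
Definition moebius (g : 'M[int]_2) (tau : C) : C :=
  ((g 0 0)%:~R * tau + (g 0 1)%:~R) / autfactor g tau.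

Variable r : nat.

Definition holomorphic_at (f : 'cV[C]_r -> C -> C) (z : 'cV[C]_r) (tau : C) :=
  \forall p \near ((z, tau) : 'cV[C]_r * C),
    differentiable (fun x : 'cV[C]_r * C => f x.1 x.2 : C) p.

(* Meromorphic on C^r x H, with poles in z only: f is locally a quotient g / h
   of holomorphic functions, where for each fixed tau the function h(., tau)
   vanishes identically on no nonempty open set. A total function f represents
   the meromorphic function, and its values on {h = 0} carry no information. *)
Definition meromorphic (f : 'cV[C]_r -> C -> C) :=
  forall (z0 : 'cV[C]_r) (tau0 : C), 0 < complex.Im tau0 ->
  exists (U : set ('cV[C]_r * C)) (g h : 'cV[C]_r * C -> C),
  [/\ open U, U (z0, tau0),
      forall p, U p -> differentiable g p /\ differentiable h p,
      forall z tau, U (z, tau) ->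
        closure [set z' | U (z', tau) /\ h (z', tau) != 0] z
    & forall z tau, U (z, tau) -> h (z, tau) != 0 ->
        f z tau = g (z, tau) / h (z, tau)].

Definition bilin (M : 'M[rat]_r) (u w : 'cV[C]_r) : C :=
  (u^T *m map_mx ratr M *m w) 0 0.

(* In the growth condition z is fixed; the bound is uniform in Re tau.
   The conditions are imposed where f is holomorphic, i.e. off the poles. *)
Definition meromorphic_jacobi_form
    (k : int) (M : 'M[rat]_r) (Gamma : set 'M[int]_2)
    (f : 'cV[C]_r -> C -> C) : Prop :=
  [/\ Gamma `<=` SL2Z /\ (forall i j, 2 * M i j \is a Num.int),
      meromorphic f,
      exists2 a : R, 0 < a & forall z : 'cV[C]_r,
        exists K V : R, forall tau : C,
          0 < complex.Im tau -> V <= complex.Im tau ->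
          holomorphic_at f z tau ->
          let y := map_mx (fun w : C => (complex.Im w)%:C) z in
          `| f z tau * cexp (- (4 * pi%:C / (complex.Im tau)%:C) * bilin M y y) |
            <= (K * expR (a * complex.Im tau))%:C,
      forall (tau : C) (z : 'cV[C]_r) (l m : 'cV[int]_r), 0 < complex.Im tau ->
        let lC : 'cV[C]_r := map_mx intr l in
        let mC : 'cV[C]_r := map_mx intr m in
        holomorphic_at f z tau ->
        holomorphic_at f (z + tau *: lC + mC) tau ->
        f (z + tau *: lC + mC) tau
        = cexp (- (4 * pi%:C * 'i * bilin M z lC))
          * e2pi (- bilin M lC lC * tau) * f z tau
    & forall (g : 'M[int]_2) (tau : C) (z : 'cV[C]_r),
        Gamma g -> 0 < complex.Im tau ->
        let w := (autfactor g tau)^-1 *: z in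
        holomorphic_at f z tau ->
        holomorphic_at f w (moebius g tau) ->
        f w (moebius g tau)
        = autfactor g tau ^ k
          * cexp (2 * pi%:C * 'i * (g 1 0)%:~R / autfactor g tau * bilin M z z)
          * f z tau].

End JacobiForms.

Definition f2_index : 'M[rat]_2 := 2^-1 *: \matrix_(i, j) (if i == j then 0 else 3).

(* Main.v *)
From HB Require Import structures.
Require Import Defs.
From mathcomp Require Import all_boot all_order all_algebra finmap.
From mathcomp Require Import all_classical all_reals all_analysis.
From mathcomp Require Import complex ring lra zify.

Set Implicit Arguments.
Unset Strict Implicit.
Unset Printing Implicit Defensive.

Import Order.TTheory GRing.Theory Num.Theory.
Import numFieldNormedType.Exports.

Local Open Scope classical_set_scope.
Local Open Scope ring_scope.
Local Open Scope complex_scope.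

(** The right-hand side is a value of the Kronecker function
      K(z1, z2; tau) = - i eta(tau)^3 theta(z1 + z2) / (theta(z1) theta(z2)),
    taken at (3 z1, 3 z2; 3 tau). Everything follows from four properties of K.

    Expansion. With q = e(tau), a = e(z1), b = e(z2), the triple product turns
    K into
      (q)^2 (ab) (q/ab) / ((a) (q/a) (b) (q/b)),
    where (x) is the infinite product of the 1 - x q^j. For fixed N, Lagrange
    interpolation in a at the points q^-n, |n| <= N, expands the analogous
    quotient of finite products in partial fractions ([finite_kronecker]), and
    Tannery's theorem lets N tend to infinity. The result is Kronecker's
    Lambert series, the sum of b^n / (1 - a q^n) over the integers
    ([kronecker_lambert]). Each of its terms is a geometric series in a q^n,
    over m >= 0 if n >= 0 and over m < 0 if n < 0, because q < |a| < 1; so the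
    sum is the double series of sgn q^(nm) a^m b^n over the first and the third
    quadrant ([kronecker_double]). This is f_2 when both z_j lie in the open
    strip between the real line and R + tau; all other base points outside the
    lines Im z_j in Z v are translates of these ([f2_hsum]). The triple product
    is obtained in the same way from the q-binomial theorem.

    Elliptic law. Shifting the summation index of theta gives its
    quasi-periods, and those of K follow ([kron_quasi]).

    Modular law. For a matrix with lower row (c, d) and j = c tau + d, the
    function e(- c z^2 / (2 j)) theta(z / j; (a tau + b) / j) has the
    quasi-periods of theta(z; tau), and such an entire function is unique up to
    a constant k ([theta_unique]). Uniqueness is a statement about Fourier
    coefficients: the quasi-period tau is a first order recursion for them. The
    coefficients are approximated by averages over equispaced points, for which
    independence of the height of the line ([avg_shift]), quadratic decay
    ([dft_decay]) and inversion ([dft_inversion]) are elementary. The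
    constant k cancels: by Jacobi's derivative formula
    theta'(0) = - 2 pi eta^3 ([theta_deriv0_eta]), eta^3 contributes j k, the
    three theta functions contribute k / k^2, and K has weight one
    ([kron_modular]). The group Gamma_0(3) acts on 3 tau through
    (a, 3 b; c / 3, d).

    Analytic conditions. A Taylor bound for theta series in (z, tau) jointly
    ([wtheta_taylor]) shows that theta'(0), theta(3 z1 + 3 z2) and
    theta(3 z1) theta(3 z2) are holomorphic, so that K is meromorphic; and for
    fixed z the product expansion keeps K bounded as q tends to 0
    ([f2_mero_bounded]), which is stronger than the growth condition. *)

(** * The modulus of a complex number *)

Section Modulus.
Variable R : realType.
Local Notation C := R[i].

(** The norm of a complex number is itself a complex number. Reading it as a
    real number lets all estimates take place in a total order. *)
Definition cabs (z : C) : R := complex.Re `|z|.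

Lemma cabsE (z : C) : `|z| = (cabs z)%:C.
Proof. by rewrite /cabs RRe_real// normr_real. Qed.

Lemma cabs_ge0 (z : C) : 0 <= cabs z.
Proof. by rewrite -lecR -cabsE normr_ge0. Qed.
Hint Resolve cabs_ge0 : core.

Lemma cabsM (x y : C) : cabs (x * y) = cabs x * cabs y.
Proof. by apply: complexI; rewrite rmorphM -!cabsE normrM. Qed.

Lemma cabs0 : cabs 0 = 0.
Proof. by apply: complexI; rewrite -cabsE normr0. Qed.

Lemma cabs1 : cabs 1 = 1.
Proof. by apply: complexI; rewrite -cabsE normr1. Qed.

Lemma cabsN (x : C) : cabs (- x) = cabs x.
Proof. by apply: complexI; rewrite -!cabsE normrN. Qed.

Lemma cabsC (x y : C) : cabs (x - y) = cabs (y - x).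
Proof. by rewrite -cabsN opprB. Qed.

Lemma cabsV (x : C) : cabs x^-1 = (cabs x)^-1.
Proof. by apply: complexI; rewrite -cabsE normfV cabsE fmorphV. Qed.

Lemma cabsX (x : C) n : cabs (x ^+ n) = cabs x ^+ n.
Proof. by elim: n => [|n IH]; rewrite ?expr0 ?cabs1// !exprS cabsM IH. Qed.

Lemma cabs_eq0 (x : C) : (cabs x == 0) = (x == 0).
Proof. by rewrite -(inj_eq (@complexI R)) -cabsE normr_eq0. Qed.

Lemma cabs_gt0 (x : C) : (0 < cabs x) = (x != 0).
Proof. by rewrite lt_def cabs_eq0 cabs_ge0 andbT. Qed.

Lemma cabsD (x y : C) : cabs (x + y) <= cabs x + cabs y.
Proof. by rewrite -lecR rmorphD -!cabsE ler_normD. Qed.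

Lemma cabsB (x y : C) : cabs (x - y) <= cabs x + cabs y.
Proof. by rewrite -(cabsN y) cabsD. Qed.

Lemma cabs_ge_sub (x y : C) : cabs x - cabs y <= cabs (x - y).
Proof. by rewrite lerBlDr -{1}(subrK y x) cabsD. Qed.

Lemma cabs_real (x : R) : cabs x%:C = `|x|.
Proof.
apply: complexI; rewrite -cabsE normc_def /= expr0n addr0 sqrtr_sqr//.
Qed.

Lemma cabs_nat n : cabs n%:R = n%:R.
Proof. by rewrite -(rmorph_nat (real_complex R)) cabs_real ger0_norm. Qed.

Lemma cabs_i : cabs 'i = 1.
Proof. by apply: complexI; rewrite -cabsE normc_def /= expr0n expr1n add0r sqrtr1. Qed.

Lemma i_neq0 : 'i != 0 :> C.
Proof. by rewrite -cabs_gt0 cabs_i. Qed.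

Lemma cabs_sum I (r : seq I) (P : pred I) (F : I -> C) :
  cabs (\sum_(i <- r | P i) F i) <= \sum_(i <- r | P i) cabs (F i).
Proof.
elim/big_rec2: _ => [|i y x _ h]; first by rewrite cabs0.
by apply: le_trans (cabsD _ _) _; rewrite lerD2l.
Qed.

Lemma cabs_prod I (r : seq I) (P : pred I) (F : I -> C) :
  cabs (\prod_(i <- r | P i) F i) = \prod_(i <- r | P i) cabs (F i).
Proof.
by elim/big_rec2: _ => [|i y x _ h]; rewrite ?cabs1// cabsM h.
Qed.

Lemma Re_le_cabs (z : C) : `|complex.Re z| <= cabs z.
Proof. by rewrite -lecR -cabsE normc_ge_Re. Qed.

Lemma Im_le_cabs (z : C) : `|complex.Im z| <= cabs z.
Proof.
have -> : cabs z = cabs (z * 'i) by rewrite cabsM cabs_i mulr1.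
have -> : complex.Im z = - complex.Re (z * 'i) by rewrite ReiNIm opprK.
by rewrite normrN Re_le_cabs.
Qed.

Lemma cabs_le_ReIm (z : C) : cabs z <= `|complex.Re z| + `|complex.Im z|.
Proof.
rewrite {1}(complexE z); apply: le_trans (cabsD _ _) _.
by rewrite cabsM cabs_i mul1r !cabs_real.
Qed.

(** Convergence in the complex numbers is reduced to real inequalities. *)
Lemma ccvgP {T : Type} {F : set_system T} {FF : Filter F} (u : T -> C) (l : C) :
  (u @ F --> l) <->
  (forall e : R, 0 < e -> \forall x \near F, cabs (u x - l) < e).
Proof.
split.
  move/cvgrPdist_lt => h e e0.
  have /h : 0 < e%:C by rewrite (ltcR 0).
  by apply: filterS => x; rewrite cabsE ltcR cabsC.
move=> h; apply/cvgrPdist_lt => e.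
rewrite ltcE /= => /andP[/eqP Ie Re0].
have -> : e = (complex.Re e)%:C by case: e Ie {Re0} => a b /= ->.
by have := h _ Re0; apply: filterS => x; rewrite cabsE ltcR cabsC.
Qed.

Section Limits.
Context {T : Type} {F : set_system T} {FF : Filter F}.
Implicit Types (u v : T -> C) (a b : C).

Lemma ccvg_cst a : (fun _ : T => a) @ F --> a.
Proof. by apply/ccvgP => e e0; apply: nearW => x; rewrite subrr cabs0. Qed.

Lemma ccvg_ext u v a : (forall x, u x = v x) -> u @ F --> a -> v @ F --> a.
Proof. by move=> /funext ->. Qed.

Lemma ccvgD u v a b :
  u @ F --> a -> v @ F --> b -> (fun x => u x + v x) @ F --> a + b.
Proof.
move=> /ccvgP hu /ccvgP hv; apply/ccvgP => e e0.
have e2 : 0 < e / 2 by lra.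
apply: filterS2 (hu _ e2) (hv _ e2) => x h1 h2.
have -> : u x + v x - (a + b) = (u x - a) + (v x - b) by ring.
by apply: le_lt_trans (cabsD _ _) _; lra.
Qed.

Lemma ccvgM u v a b :
  u @ F --> a -> v @ F --> b -> (fun x => u x * v x) @ F --> a * b.
Proof.
move=> /ccvgP hu /ccvgP hv; apply/ccvgP => e e0.
(* from u v - a b = (u - a) (v - b) + a (v - b) + b (u - a) *)
pose d := Num.min 1 (e / (cabs a + cabs b + 2)).
have p0 : 0 < cabs a + cabs b + 2 by have := cabs_ge0 a; have := cabs_ge0 b; lra.
have d0 : 0 < d by rewrite lt_min ltr01 divr_gt0.
have d1 : d <= 1 by rewrite ge_min lexx.
have de : d * (cabs a + cabs b + 2) <= e.
  by rewrite -ler_pdivlMr// ge_min lexx orbT.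
apply: filterS2 (hu _ d0) (hv _ d0) => x h1 h2.
have -> : u x * v x - a * b = (u x - a) * (v x - b) + (a * (v x - b) + b * (u x - a)).
  by ring.
apply: le_lt_trans (cabsD _ _) _.
apply: le_lt_trans (lerD (lexx _) (cabsD _ _)) _; rewrite !cabsM.
have A0 := cabs_ge0 a; have B0 := cabs_ge0 b.
have U0 := cabs_ge0 (u x - a); have V0 := cabs_ge0 (v x - b).
by nra.
Qed.

Lemma ccvgN u a : u @ F --> a -> (fun x => - u x) @ F --> - a.
Proof.
move=> /ccvgP hu; apply/ccvgP => e /hu; apply: filterS => x.
by rewrite -opprD cabsN.
Qed.

Lemma ccvgB u v a b :
  u @ F --> a -> v @ F --> b -> (fun x => u x - v x) @ F --> a - b.
Proof. by move=> ua vb; exact: (ccvgD ua (ccvgN vb)). Qed.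

Lemma ccvgZ u a b : u @ F --> a -> (fun x => b * u x) @ F --> b * a.
Proof. by move=> ua; exact: (ccvgM (ccvg_cst (a := b)) ua). Qed.

Lemma ccvgV u a : a != 0 -> u @ F --> a -> (fun x => (u x)^-1) @ F --> a^-1.
Proof.
move=> a0 /ccvgP hu; apply/ccvgP => e e0.
have A0 : 0 < cabs a by rewrite cabs_gt0.
pose d := Num.min (cabs a / 2) (e * (cabs a / 2 * cabs a)).
have d0 : 0 < d by rewrite lt_min !(mulr_gt0, divr_gt0).
apply: filterS (hu _ d0) => x; rewrite lt_min => /andP[h1 h2].
have h3 : cabs a / 2 < cabs (u x).
  by have := cabs_ge_sub a (u x); rewrite cabsC; lra.
have u0 : u x != 0 by rewrite -cabs_gt0; lra.
have -> : (u x)^-1 - a^-1 = - (u x - a) / (u x * a) by field; rewrite a0 u0.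
rewrite cabsM cabsN cabsV cabsM ltr_pdivrMr ?mulr_gt0//; last by lra.
apply: lt_le_trans h2 _; rewrite ler_wpM2l//; first exact: ltW.
by rewrite ler_wpM2r ?ltW.
Qed.

Lemma ccvg_sum (I : Type) (r : seq I) (f : I -> T -> C) (l : I -> C) :
  (forall i, f i @ F --> l i) ->
  (fun x => \sum_(i <- r) f i x) @ F --> \sum_(i <- r) l i.
Proof.
move=> h; elim: r => [|i r IH].
  rewrite big_nil (_ : (fun _ => _) = fun=> 0); first exact: ccvg_cst.
  by apply/funext => n; rewrite big_nil.
rewrite big_cons (_ : (fun _ => _) = (fun x => f i x + \sum_(j <- r) f j x)).
  exact: (ccvgD (h i) IH).
by apply/funext => n; rewrite big_cons.
Qed.

End Limits.

Lemma ccvg_unique {T : Type} {F : set_system T} {FF : ProperFilter F}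
    (u : T -> C) (a b : C) :
  u @ F --> a -> u @ F --> b -> a = b.
Proof.
move=> /ccvgP ha /ccvgP hb; apply/eqP; rewrite -subr_eq0 -cabs_eq0 eq_le cabs_ge0 andbT.
apply/ler_addgt0Pr => e e0; rewrite add0r.
have e2 : 0 < e / 2 by lra.
have [x [h1 h2]] := filter_ex (filterI (ha _ e2) (hb _ e2)).
have -> : a - b = (u x - b) - (u x - a) by ring.
by apply: le_trans (cabsB _ _) _; lra.
Qed.

End Modulus.

#[export] Hint Extern 0 (is_true (0 <= cabs _)) => solve [apply: cabs_ge0] : core.

(** * Unconditional sums and dominated convergence *)

#[export] Existing Instance totally_filter.

Section Summation.
Variable R : realType.
Local Notation C := R[i].

Lemma partial_sumE (I : choiceType) (x : I -> C) (A : {fset I}) :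
  partial_sum x A = \sum_(i <- A) x i.
Proof. by rewrite /partial_sum big_seq_fsetE. Qed.

Lemma ler_sum_sub (I : eqType) (g : I -> R) (r s : seq I) :
  (forall i, 0 <= g i) -> uniq r -> uniq s -> {subset r <= s} ->
  \sum_(i <- r) g i <= \sum_(i <- s) g i.
Proof.
move=> g0 ur us rs; rewrite [leRHS](bigID (mem r)) /=.
have E : perm_eq [seq i <- s | i \in r] r.
  apply: uniq_perm; rewrite ?filter_uniq// => i; rewrite mem_filter.
  by case: (boolP (i \in r)) => [/rs ->|].
by rewrite -[X in _ <= X + _]big_filter (perm_big _ E) lerDl sumr_ge0.
Qed.

(** Convergence of the net of finite partial sums to a prescribed value; a
    statement about a sum then needs no separate convergence hypothesis. *)
Definition hsum (I : choiceType) (x : I -> C) (s : C) :=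
  partial_sum x @ totally --> s.

(** The dominating families. Boundedness of the finite sums is summability for
    nonnegative families, over an index set of any size. *)
Definition summ (I : choiceType) (g : I -> R) :=
  (forall i, 0 <= g i) /\
  exists M, forall r : seq I, uniq r -> \sum_(i <- r) g i <= M.

Lemma hsumP (I : choiceType) (x : I -> C) s :
  hsum x s <-> forall e : R, 0 < e -> exists A : {fset I}, forall B : {fset I},
    (A `<=` B)%fset -> cabs (\sum_(i <- B) x i - s) < e.
Proof.
split.
  move/ccvgP => h e /h [A _ hA]; exists A => B AB.
  by rewrite -partial_sumE; apply: hA.
move=> h; apply/ccvgP => e /h [A hA]; exists A => // B AB.
by rewrite partial_sumE; apply: hA.
Qed.

Lemma hsum_unique (I : choiceType) (x : I -> C) s t : hsum x s -> hsum x t -> s = t.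
Proof. by move=> hs ht; apply: ccvg_unique hs ht. Qed.

Lemma hsum_sum (I : choiceType) (x : I -> C) s : hsum x s -> sum x = s.
Proof. by move=> h; apply: cvg_lim. Qed.

Lemma hsumD (I : choiceType) (x y : I -> C) s t :
  hsum x s -> hsum y t -> hsum (fun i => x i + y i) (s + t).
Proof.
move=> hx hy.
rewrite /hsum (_ : partial_sum _ = fun A => partial_sum x A + partial_sum y A).
  exact: (ccvgD hx hy).
by apply/funext => A /=; rewrite !partial_sumE big_split.
Qed.

Lemma hsumZ (I : choiceType) (x : I -> C) s (c : C) :
  hsum x s -> hsum (fun i => c * x i) (c * s).
Proof.
move=> hx.
rewrite /hsum (_ : partial_sum _ = (fun A => c * partial_sum x A)).
  exact: (ccvgZ (b := c) hx).
by apply/funext => A /=; rewrite !partial_sumE mulr_sumr.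
Qed.

Lemma hsumN (I : choiceType) (x : I -> C) s : hsum x s -> hsum (fun i => - x i) (- s).
Proof.
move=> /(hsumZ (c := -1)); rewrite mulN1r; congr (hsum _ _).
by apply/funext => i; rewrite mulN1r.
Qed.

Lemma eq_hsum (I : choiceType) (x y : I -> C) s : x =1 y -> hsum x s -> hsum y s.
Proof. by move=> /funext ->. Qed.

Lemma hsum_reindex (I J : choiceType) (f : J -> I) (g : I -> J) (x : I -> C) s :
  cancel f g -> cancel g f -> hsum x s -> hsum (x \o f) s.
Proof.
move=> fg gf /hsumP h; apply/hsumP => e /h[A hA].
exists (g @` A)%fset => B AB.
have := hA (f @` B)%fset.
rewrite big_imfset /=; last by move=> a b _ _; apply: can_inj fg a b.
apply; apply/fsubsetP => i iA; rewrite -(gf i) in_imfset//=.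
by apply: (fsubsetP AB); rewrite in_imfset.
Qed.

Lemma hsum_fin (I : choiceType) (x : I -> C) (r : seq I) :
  uniq r -> (forall i, i \notin r -> x i = 0) -> hsum x (\sum_(i <- r) x i).
Proof.
move=> ur h; apply/hsumP => e e0; exists [fset i in r]%fset => B /fsubsetP AB.
have E : perm_eq [seq i <- B | i \in r] r.
  apply: uniq_perm; rewrite ?filter_uniq ?fset_uniq// => i; rewrite mem_filter.
  by case: (boolP (i \in r)) => //= ir; rewrite AB// in_fset.
rewrite [X in cabs (X - _)](bigID (mem r)) /= -[X in X + _ - _]big_filter (perm_big _ E).
by rewrite [X in _ + X - _]big1 ?addr0 ?subrr ?cabs0 // => i /h.
Qed.

Section Domination.
Variable I : choiceType.
Implicit Types (g : I -> R) (x y : I -> C).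

Lemma summ_le g g' : summ g -> (forall i, 0 <= g' i <= g i) -> summ g'.
Proof.
move=> [_ [M hM]] h; split=> [i|]; first by case/andP: (h i).
exists M => r ur; apply: le_trans (hM r ur); apply: ler_sum => i _.
by case/andP: (h i).
Qed.

Lemma summZ g c : 0 <= c -> summ g -> summ (fun i => c * g i).
Proof.
move=> c0 [g0 [M hM]]; split=> [i|]; first by rewrite mulr_ge0.
by exists (c * M) => r ur; rewrite -mulr_sumr ler_wpM2l// hM.
Qed.

Lemma summD g g' : summ g -> summ g' -> summ (fun i => g i + g' i).
Proof.
move=> [g0 [M hM]] [g'0 [M' hM']]; split=> [i|]; first by rewrite addr_ge0.
by exists (M + M') => r ur; rewrite big_split lerD ?hM ?hM'.
Qed.

(** A finite set whose sum nearly attains the supremum of all finite sums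
    leaves little mass outside. *)
Lemma summ_tail g : summ g -> forall e : R, 0 < e -> exists A : {fset I},
  forall r, uniq r -> (forall i, i \in r -> i \notin A) -> \sum_(i <- r) g i < e.
Proof.
move=> [g0 [M hM]] e e0.
pose E := [set \sum_(i <- enum_fset A) g i | A in [set: {fset I}]].
have supE : has_sup E.
  split; first by exists (\sum_(i <- fset0) g i); exists fset0.
  by exists M => _ [A _ <-]; apply: hM; rewrite fset_uniq.
have [_ [A _ <-] hA] := sup_adherent e0 supE.
exists A => r ur rA.
have : \sum_(i <- A) g i + \sum_(i <- r) g i <= sup E.
  rewrite -big_cat /=; apply: ub_le_sup => //; first exact: supE.2.
  exists [fset i in enum_fset A ++ r]%fset => //.
  apply: perm_big; apply: uniq_perm; rewrite ?fset_uniq//.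
    rewrite cat_uniq fset_uniq ur andbT /=; apply/hasPn => i ir.
    exact: rA.
  by move=> i; rewrite in_fset.
lra.
Qed.

Lemma hsum_tail g x s (A : {fset I}) e :
  (forall i, cabs (x i) <= g i) -> hsum x s ->
  (forall r, uniq r -> (forall i, i \in r -> i \notin A) -> \sum_(i <- r) g i <= e) ->
  cabs (\sum_(i <- A) x i - s) <= e.
Proof.
move=> xg /hsumP hs hA; apply/ler_addgt0Pr => d /hs[B hB].
have {hB} := hB (A `|` B)%fset (fsubsetUr _ _).
rewrite (big_fsetID _ (mem A)) /=.
rewrite (_ : [fset x | x in _ & _]%fset = A); last first.
  by apply/fsetP => i; rewrite !inE; case: (i \in A); rewrite ?andbF.
set D := [fset _ in _ | _]%fset => hB.
have hD : cabs (\sum_(i <- D) x i) <= e.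
  apply: le_trans (cabs_sum _ _ _) _.
  apply: (@le_trans _ _ (\sum_(i <- D) g i)); first exact: ler_sum.
  apply: hA; first exact: fset_uniq.
  by move=> i; rewrite !inE => /andP[].
have -> : \sum_(i <- A) x i - s
  = (\sum_(i <- A) x i + \sum_(i <- D) x i - s) - \sum_(i <- D) x i by ring.
apply: le_trans (cabsB _ _) _; lra.
Qed.

Lemma hsum_le g x s M :
  (forall i, cabs (x i) <= g i) -> (forall r, uniq r -> \sum_(i <- r) g i <= M) ->
  hsum x s -> cabs s <= M.
Proof.
move=> xg hM hs.
have := @hsum_tail g x s fset0 M xg hs.
by rewrite big_seq_fset0 sub0r cabsN; apply => r ur _; apply: hM.
Qed.

Lemma summ_sup g : summ g -> exists s : R, forall e, 0 < e ->
  exists A : {fset I}, forall B : {fset I}, (A `<=` B)%fset ->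
  `|\sum_(i <- B) g i - s| < e.
Proof.
move=> [g0 [M hM]].
pose E := [set \sum_(i <- enum_fset A) g i | A in [set: {fset I}]].
have supE : has_sup E.
  split; first by exists (\sum_(i <- fset0) g i); exists fset0.
  by exists M => _ [A _ <-]; apply: hM; rewrite fset_uniq.
exists (sup E) => e e0; have [_ [A _ <-] hA] := sup_adherent e0 supE.
exists A => B AB.
have h1 : \sum_(i <- B) g i <= sup E by apply: ub_le_sup; [exact: supE.2|exists B].
have h2 : \sum_(i <- A) g i <= \sum_(i <- B) g i.
  by apply: ler_sum_sub; rewrite ?fset_uniq//; exact/fsubsetP.
by rewrite ltr_norml; lra.
Qed.

(** Real and imaginary parts of [x] become nonnegative after adding the
    dominating family, and nonnegative families with bounded finite sums converge
    to their supremum. *)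
Lemma hsum_ex g x : summ g -> (forall i, cabs (x i) <= g i) -> exists s, hsum x s.
Proof.
move=> sg xg.
(* 2 g dominates the nonnegative family f x + g *)
have s2 : summ (fun i => 2 * g i) by apply: summZ.
have hp (f : C -> R) : (forall z, `|f z| <= cabs z) ->
    exists s : R, forall e, 0 < e -> exists A : {fset I}, forall B : {fset I},
    (A `<=` B)%fset -> `|\sum_(i <- B) f (x i) - s| < e.
  move=> hf.
  have /summ_sup[s hs] : summ (fun i => f (x i) + g i).
    apply: summ_le s2 _ => i; have := le_trans (hf (x i)) (xg i).
    by rewrite ler_norml => /andP[]; lra.
  have [t ht] := summ_sup sg; exists (s - t) => e e0.
  have e2 : 0 < e / 2 by lra.
  have [A hA] := hs _ e2; have [B hB] := ht _ e2.
  exists (A `|` B)%fset => D; rewrite fsubUset => /andP[/hA + /hB].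
  rewrite big_split /= !ltr_norml; lra.
have [a ha] := hp _ (@Re_le_cabs R); have [b hb] := hp _ (@Im_le_cabs R).
exists (a +i* b); apply/hsumP => e e0.
have e2 : 0 < e / 2 by lra.
have [A hA] := ha _ e2; have [B hB] := hb _ e2.
exists (A `|` B)%fset => D; rewrite fsubUset => /andP[/hA hRe /hB hIm].
apply: le_lt_trans (cabs_le_ReIm _) _.
suff E : \sum_(i <- D) x i =
  (\sum_(i <- D) complex.Re (x i)) +i* (\sum_(i <- D) complex.Im (x i)).
  by rewrite E /=; lra.
elim/big_rec3: _ => // i u v w _ ->.
by case: (x i).
Qed.

(** Tannery's theorem. Outside a finite set both sums are small uniformly in [n];
    on the finite set the convergence is termwise. *)
Lemma tannery g (x : nat -> I -> C) y (s : nat -> C) t :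
  summ g -> (forall n i, cabs (x n i) <= g i) ->
  (forall i, x ^~ i @ \oo --> y i) ->
  (forall n, hsum (x n) (s n)) -> hsum y t -> s @ \oo --> t.
Proof.
move=> sg xg xy hx hy; apply/ccvgP => e e0.
have e4 : 0 < e / 4 by lra.
have yg i : cabs (y i) <= g i.
  apply/ler_addgt0Pr => d d0.
  have /ccvgP/(_ d d0)[n _ /(_ n (leqnn n)) h] := xy i.
  have := xg n i; have := cabs_ge_sub (y i) (x n i); rewrite cabsC; lra.
have [A hA] := summ_tail sg e4.
have hA' : forall r, uniq r -> (forall i, i \in r -> i \notin A) ->
  \sum_(i <- r) g i <= e / 4 by move=> r ur h; exact/ltW/hA.
have hfin : (fun n => \sum_(i <- A) x n i) @ \oo --> \sum_(i <- A) y i.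
  exact: (ccvg_sum (r := enum_fset A) xy).
move/ccvgP: hfin => /(_ _ e4); apply: filterS => n hn.
have h1 := hsum_tail (xg n) (hx n) hA'.
have h2 := hsum_tail yg hy hA'.
have -> : s n - t = (\sum_(i <- A) x n i - \sum_(i <- A) y i)
  - (\sum_(i <- A) x n i - s n) + (\sum_(i <- A) y i - t) by ring.
apply: le_lt_trans (cabsD _ _) _.
apply: le_lt_trans (lerD (cabsB _ _) (lexx _)) _; lra.
Qed.

End Domination.

Lemma summ_comp (I J : choiceType) (f : J -> I) (g : I -> R) :
  injective f -> summ g -> summ (g \o f).
Proof.
move=> finj [g0 [M hM]]; split=> [i|]; first exact: g0.
by exists M => r ur; rewrite -(big_map f predT) /= hM// map_inj_uniq.
Qed.

Lemma summ_prod (I J : choiceType) (a : I -> R) (b : J -> R) :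
  summ a -> summ b -> summ (fun p : I * J => a p.1 * b p.2).
Proof.
move=> [a0 [M hM]] [b0 [N hN]]; split=> [p|]; first by rewrite mulr_ge0.
exists (M * N) => r ur.
pose r1 := undup (map fst r); pose r2 := undup (map snd r).
apply: (@le_trans _ _ (\sum_(p <- [seq (i, j) | i <- r1, j <- r2]) a p.1 * b p.2)).
  apply: ler_sum_sub => //; first by move=> p; rewrite mulr_ge0.
    by apply: allpairs_uniq; rewrite ?undup_uniq// => -[? ?] [? ?].
  move=> [i j] ijr; apply/allpairsP; exists (i, j) => /=.
  by rewrite !mem_undup; split => //; apply/mapP; exists (i, j).
rewrite big_allpairs /=.
under eq_bigr do rewrite -mulr_sumr.
rewrite -mulr_suml; apply: ler_pM; rewrite ?sumr_ge0 ?hM ?hN ?undup_uniq//.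
Qed.

Lemma summ_nat (g : nat -> R) M : (forall i, 0 <= g i) ->
  (forall n, \sum_(i < n) g i <= M) -> summ g.
Proof.
move=> g0 hM; split=> //; exists M => r ur.
have [n hn] : exists n, {subset r <= iota 0 n}.
  exists (\max_(i <- r) i).+1 => i ir; rewrite mem_iota /= ltnS.
  by rewrite leq_bigmax_seq.
apply: le_trans (ler_sum_sub g0 ur (iota_uniq 0 n) hn) _.
by rewrite -[n in iota _ n]subn0 -/(index_iota 0 n) big_mkord.
Qed.

Lemma summ_int (g : int -> R) (h : nat -> R) : summ h ->
  (forall n : int, 0 <= g n <= h `|n|%N) -> summ g.
Proof.
move=> [h0 [M hM]] gh; split=> [n|]; first by case/andP: (gh n).
exists (M + M) => r ur.
apply: (@le_trans _ _ (\sum_(n <- r) h `|n|%N)).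
  by apply: ler_sum => n _; case/andP: (gh n).
rewrite (bigID (fun n : int => 0 <= n)) /=; apply: lerD.
  rewrite -big_filter -(big_map absz predT h) hM// map_inj_in_uniq ?filter_uniq//.
  by move=> a b; rewrite !mem_filter; lia.
rewrite -big_filter -(big_map absz predT h) hM// map_inj_in_uniq ?filter_uniq//.
by move=> a b; rewrite !mem_filter; lia.
Qed.

Lemma geo_sum_le (r : R) n : 0 <= r < 1 -> \sum_(j < n) r ^+ j <= (1 - r)^-1.
Proof.
move=> /andP[r0 r1].
have h : (1 - r) * \sum_(i < n) r ^+ i = 1 - r ^+ n.
  by rewrite -[1 - r]opprB mulNr -subrX1 opprB.
have r1' : 0 < 1 - r by lra.
rewrite -(ler_pM2l r1') h mulfV; last by apply/eqP; lra.
by have := exprn_ge0 n r0; lra.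
Qed.

Lemma summ_geo (r : R) : 0 <= r < 1 -> summ (fun n : nat => r ^+ n).
Proof.
move=> r01; apply: (@summ_nat _ (1 - r)^-1) => [i|n]; last exact: geo_sum_le.
by rewrite exprn_ge0//; case/andP: r01.
Qed.

Lemma hsum_seq (I : choiceType) (x : I -> C) s (A : nat -> seq I) :
  hsum x s -> (forall n, uniq (A n)) ->
  (forall i, \forall n \near \oo, i \in A n) ->
  (fun n => \sum_(i <- A n) x i) @ \oo --> s.
Proof.
move=> /hsumP hx uA hA; apply/ccvgP => e /hx[B hB].
have : \forall n \near \oo, {subset enum_fset B <= A n}.
  elim: (enum_fset B) => [|i r IH]; first by apply: nearW => n j; rewrite in_nil.
  apply: filterS2 (hA i) IH => n iA rA j; rewrite inE => /orP[/eqP->//|].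
  exact: rA.
apply: filterS => n BA.
have := hB [fset i in A n]%fset; rewrite (perm_big (A n)); last first.
  by apply: uniq_perm; rewrite ?fset_uniq// => i; rewrite in_fset.
by apply; apply/fsubsetP => i /BA; rewrite in_fset.
Qed.

Lemma hsum_nat (x : nat -> C) s : hsum x s -> (fun n => \sum_(i < n) x i) @ \oo --> s.
Proof.
move=> /(@hsum_seq _ x s (iota 0)) h.
rewrite (_ : (fun n => _) = fun n => \sum_(i <- iota 0 n) x i).
  apply: h => [n|i]; first exact: iota_uniq.
  by exists i.+1 => // n /=; rewrite mem_iota.
by apply/funext => n; rewrite -(big_mkord predT) /index_iota subn0.
Qed.

(** The integers from [- a] to [b - 1], as the image of an initial segment of the
    naturals; [window N N.+1] is symmetric. *)
Definition window (a b : nat) := [seq k%:Z - a%:Z | k <- iota 0 (a + b)].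

Lemma window_uniq a b : uniq (window a b).
Proof. by rewrite map_inj_uniq ?iota_uniq// => i j; lia. Qed.

Lemma mem_window a b (n : int) : (n \in window a b) = (- a%:Z <= n < b%:Z).
Proof.
apply/mapP/idP => [[k]|h]; first by rewrite mem_iota => h ->; lia.
exists (absz (n + a%:Z)); rewrite ?mem_iota; lia.
Qed.

Lemma big_window a b (f : int -> C) :
  \sum_(n <- window a b) f n = \sum_(k < a + b) f (k%:Z - a%:Z).
Proof.
rewrite big_map -(big_mkord predT (fun k => f (k%:Z - a%:Z))).
by rewrite /index_iota subn0.
Qed.

Lemma hsum_window a b (f : int -> C) :
  hsum (fun n => if n \in window a b then f n else 0)
       (\sum_(n <- window a b) f n).
Proof.
set g := fun n => _; rewrite (_ : \sum_(n <- _) _ = \sum_(n <- window a b) g n).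
  by apply: hsum_fin; [exact: window_uniq|rewrite /g => i /negbTE ->].
by apply: eq_big_seq => n nw; rewrite /g nw.
Qed.

(** Iterated summation. Given finitely many rows, the finite set that the double
    sum asks for is enlarged to a rectangle which also exhausts these rows. *)
Lemma hsum_fubini (I J : choiceType) (x : I * J -> C) s (t : I -> C) :
  hsum x s -> (forall i, hsum (fun j => x (i, j)) (t i)) -> hsum t s.
Proof.
move=> /hsumP hx ht; apply/hsumP => e e0.
have e2 : 0 < e / 2 by lra.
have [F hF] := hx _ e2.
exists [fset p.1 | p in F]%fset => A FA.
have : exists B : {fset J}, ([fset p.2 | p in F] `<=` B)%fset /\
    cabs (\sum_(i <- A) \sum_(j <- B) x (i, j) - \sum_(i <- A) t i) < e / 2.
  have : \forall B \near @totally J,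
      cabs (\sum_(i <- A) partial_sum (fun j => x (i, j)) B - \sum_(i <- A) t i) < e / 2.
    have hs : (fun B => \sum_(i <- A) partial_sum (fun j => x (i, j)) B)
        @ totally --> \sum_(i <- A) t i by exact: (ccvg_sum (r := enum_fset A) ht).
    by move/ccvgP: hs; apply.
  move=> [B _ hB]; exists ([fset p.2 | p in F] `|` B)%fset; split.
    exact: fsubsetUl.
  have /= := hB _ (fsubsetUr [fset p.2 | p in F]%fset B).
  by under eq_bigr do rewrite partial_sumE.
move=> [B [FB hB]].
have := hF [fset p in [seq (i, j) | i <- enum_fset A, j <- enum_fset B]]%fset.
have -> : \sum_(p <- [fset p in [seq (i, j) | i <- enum_fset A, j <- enum_fset B]]%fset) x p
  = \sum_(i <- A) \sum_(j <- B) x (i, j).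
  rewrite (perm_big [seq (i, j) | i <- enum_fset A, j <- enum_fset B]) ?big_allpairs//.
  apply: uniq_perm; rewrite ?fset_uniq//; last by move=> p; rewrite in_fset.
  by apply: allpairs_uniq; rewrite ?fset_uniq// => -[? ?] [? ?].
have FAB : (F `<=` [fset p in [seq (i, j) | i <- enum_fset A, j <- enum_fset B]])%fset.
  apply/fsubsetP => -[i j] ijF; rewrite in_fset; apply/allpairsP; exists (i, j).
  split=> //=.
    by apply: (fsubsetP FA); apply/imfsetP; exists (i, j).
  by apply: (fsubsetP FB); apply/imfsetP; exists (i, j).
move=> /(_ FAB) h1.
set u := \sum_(i <- A) t i in hB *.
set v := \sum_(i <- A) _ in hB h1.
have -> : u - s = (v - s) - (v - u) by ring.
by apply: le_lt_trans (cabsB _ _) _; lra.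
Qed.

End Summation.

(** * The exponential function *)

Section Exponential.
Variable R : realType.
Local Notation C := R[i].

Lemma cexpD (x y : C) : cexp (x + y) = cexp x * cexp y.
Proof.
case: x => a b; case: y => c d; rewrite /cexp /= expRD cosD sinD.
apply/eqP; rewrite eq_complex /=; apply/andP; split; apply/eqP; ring.
Qed.

Lemma cexp0 : cexp 0 = 1 :> C.
Proof. by rewrite /cexp /= expR0 cos0 sin0 mul1r. Qed.

Lemma cabs_cexp (z : C) : cabs (cexp z) = expR (complex.Re z).
Proof.
rewrite cabsM cabs_real ger0_norm ?expR_ge0// [X in _ * X](_ : _ = 1) ?mulr1//.
by apply: complexI; rewrite -cabsE normc_def /= cos2Dsin2 sqrtr1.
Qed.

Lemma cexp_neq0 (z : C) : cexp z != 0.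
Proof. by rewrite -cabs_gt0 cabs_cexp expR_gt0. Qed.

Lemma cexpN (z : C) : cexp (- z) = (cexp z)^-1.
Proof.
apply: (mulIf (cexp_neq0 z)); rewrite mulVf ?cexp_neq0//.
by rewrite -cexpD addNr cexp0.
Qed.

Lemma e2piD (x y : C) : e2pi (x + y) = e2pi x * e2pi y.
Proof. by rewrite /e2pi mulrDr cexpD. Qed.

Lemma e2pi0 : e2pi 0 = 1 :> C.
Proof. by rewrite /e2pi mulr0 cexp0. Qed.

Lemma e2pi_neq0 (z : C) : e2pi z != 0.
Proof. exact: cexp_neq0. Qed.

Lemma e2piN (z : C) : e2pi (- z) = (e2pi z)^-1.
Proof. by rewrite /e2pi mulrN cexpN. Qed.

Lemma e2piMn n (z : C) : e2pi (n%:R * z) = e2pi z ^+ n.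
Proof.
elim: n => [|n IH]; first by rewrite mul0r e2pi0 expr0.
by rewrite -natr1 mulrDl mul1r e2piD IH exprSr.
Qed.

Lemma e2piMz (n : int) (z : C) : e2pi (n%:~R * z) = e2pi z ^ n.
Proof.
case: n => n; first by rewrite -pmulrn e2piMn.
by rewrite NegzE mulrNz mulNr e2piN -pmulrn e2piMn -exprnN.
Qed.

Lemma Re_2pii (z : C) : complex.Re (2 * pi%:C * 'i * z) = - (2 * pi * complex.Im z).
Proof.
have -> : 2 * pi%:C * 'i = (2 * pi) *i :> C.
  apply/eqP; rewrite eq_complex /=; apply/andP; split; apply/eqP; ring.
by case: z => a b /=; ring.
Qed.

Lemma cabs_e2pi (z : C) : cabs (e2pi z) = expR (- (2 * pi * complex.Im z)).
Proof. by rewrite cabs_cexp Re_2pii. Qed.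

Lemma e2pi_real (x : R) : e2pi x%:C = cos (2 * pi * x) +i* sin (2 * pi * x).
Proof.
rewrite /e2pi (_ : 2 * pi%:C * 'i * x%:C = (2 * pi * x) *i) /cexp /=.
  by rewrite expR0 mul1r.
apply/eqP; rewrite eq_complex /=; apply/andP; split; apply/eqP; ring.
Qed.

Lemma e2pi_half : e2pi (2^-1) = -1 :> C.
Proof.
have -> : 2^-1 = (2^-1 : R)%:C :> C by rewrite fmorphV rmorph_nat.
rewrite e2pi_real (_ : 2 * pi * 2^-1 = pi) ?cospi ?sinpi; last by field.
by apply/eqP; rewrite eq_complex /= oppr0 !eqxx.
Qed.

Lemma e2pi1 : e2pi 1 = 1 :> C.
Proof.
rewrite (_ : e2pi 1 = e2pi (2^-1 + 2^-1) :> C); last by congr e2pi; field.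
by rewrite e2piD e2pi_half mulrNN mulr1.
Qed.

Lemma e2pi_int (n : int) : e2pi n%:~R = 1 :> C.
Proof. by rewrite -[n%:~R]mulr1 e2piMz e2pi1 exp1rz. Qed.

Lemma e2pi_quarter : e2pi (4^-1) = 'i :> C.
Proof.
have -> : 4^-1 = (4^-1 : R)%:C :> C by rewrite fmorphV rmorph_nat.
by rewrite e2pi_real (_ : 2 * pi * 4^-1 = pi / 2) ?cos_pihalf ?sin_pihalf; last by field.
Qed.

(** The trigonometric estimates below all come from this one application of the
    mean value theorem. *)
Lemma sin_mvt (t : R) : 0 < t -> exists2 c, 0 < c < t & sin t = t * cos c.
Proof.
move=> t0.
have [|c] := @MVT R sin cos 0 t t0.
  by apply: continuous_subspaceT => x; exact: continuous_sin.
by rewrite in_itv /= => ct; rewrite sin0 !subr0 mulrC => ->; exists c.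
Qed.

Lemma abs_sin_le (t : R) : `|sin t| <= `|t|.
Proof.
wlog t0 : t / 0 < t.
  move=> h; have [t0|t0|->] := ltgtP t 0; last by rewrite sin0.
    by rewrite -normrN -sinN -[leRHS]normrN h//; lra.
  exact: h.
have [c _ ->] := sin_mvt t0.
by rewrite normrM ler_piMr ?cos_max.
Qed.

Lemma one_sub_cos (t : R) : 1 - cos t = 2 * sin (t / 2) ^+ 2.
Proof.
have -> : cos t = cos ((t / 2) *+ 2) by congr cos; rewrite -mulr_natr; field.
rewrite cos_mulr2n sin2cos2 -mulr_natr; ring.
Qed.

Lemma one_sub_cos_ge0 (t : R) : 0 <= 1 - cos t.
Proof. by rewrite subr_ge0 cos_le1. Qed.

Lemma one_sub_cos_le2 (t : R) : 1 - cos t <= t ^+ 2.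
Proof.
rewrite one_sub_cos -(real_normK (num_real (sin _))) -(real_normK (num_real t)).
have := abs_sin_le (t / 2); rewrite (normrM t) (@ger0_norm _ 2^-1) ?invr_ge0//.
have := normr_ge0 (sin (t / 2)); have := normr_ge0 t.
move: `|t| `|sin _| => x y; nra.
Qed.

Lemma one_sub_cos_le1 (t : R) : 1 - cos t <= `|t|.
Proof.
rewrite one_sub_cos -(real_normK (num_real (sin _))).
have := abs_sin_le (t / 2); rewrite (normrM t) (@ger0_norm _ 2^-1) ?invr_ge0//.
have := sin_max (t / 2); have := normr_ge0 (sin (t / 2)); have := normr_ge0 t.
move: `|t| `|sin _| => x y; nra.
Qed.

Lemma sin_sub_le (t : R) : `|sin t - t| <= t ^+ 2.
Proof.
wlog t0 : t / 0 < t.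
  move=> h; have [t0|t0|->] := ltgtP t 0; last by rewrite sin0 subrr normr0 expr0n.
    by have := h (- t); rewrite sinN sqrrN -normrN opprB opprK addrC; apply; lra.
  exact: h.
have [c /andP[c0 ct] ->] := sin_mvt t0.
rewrite -normrN (_ : - (t * cos c - t) = t * (1 - cos c)); last by ring.
rewrite normrM (gtr0_norm t0) (ger0_norm (one_sub_cos_ge0 c)) expr2 ler_pM2l//.
by apply: le_trans (one_sub_cos_le1 c) _; rewrite gtr0_norm// ltW.
Qed.

Lemma expR_taylor (x : R) : `|expR x - 1 - x| <= x ^+ 2 * expR `|x|.
Proof.
have h1 := expR_ge1Dx x; have h2 := expR_ge1Dx (- x).
have e0 := expR_gt0 x.
have h3 : expR x - 1 <= x * expR x.
  have : expR x * (1 - x) <= expR x * expR (- x) by rewrite ler_pM2l.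
  by rewrite expRxMexpNx_1; lra.
rewrite ger0_norm; last by lra.
have [x0|x0] := leP 0 x.
  by rewrite ger0_norm//; nra.
have h4 : 1 <= expR `|x| by have := expR_ge1Dx `|x|; have := normr_ge0 x; lra.
have : x ^+ 2 <= x ^+ 2 * expR `|x| by rewrite ler_peMr// sqr_ge0.
nra.
Qed.

(** Modulus and phase are expanded separately. The real exponential contributes
    an error of second order; in the remaining two summands of the identity [E]
    below, either the factor [x] meets a quantity of first order, or both
    coordinates are of second order. *)
Lemma cexp_taylor (w : C) : cabs (cexp w - 1 - w) <= 5 * cabs w ^+ 2 * expR (cabs w).
Proof.
have hx := Re_le_cabs w; have hy := Im_le_cabs w; have w0 := cabs_ge0 w.
case: w hx hy w0 => x y /= hx hy w0.
set w := cabs _ in hx hy w0 *.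
pose e := cos y +i* sin y.
have E : cexp (x +i* y) - 1 - (x +i* y) =
  e * (expR x - 1 - x)%:C + (x%:C * ((cos y - 1) +i* sin y)
    + ((cos y - 1) +i* (sin y - y))).
  apply/eqP; rewrite eq_complex /=; apply/andP; split; apply/eqP; ring.
rewrite E; apply: le_trans (cabsD _ _) _.
apply: le_trans (lerD (lexx _) (cabsD _ _)) _; rewrite !cabsM !cabs_real.
have -> : cabs e = 1.
  by apply: complexI; rewrite -cabsE normc_def /= cos2Dsin2 sqrtr1.
rewrite mul1r.
have E1 : 1 <= expR w by rewrite -expR0 ler_expR.
have B1 : `|expR x - 1 - x| <= w ^+ 2 * expR w.
  apply: le_trans (expR_taylor x) _; apply: ler_pM; rewrite ?sqr_ge0 ?expR_ge0//.
    by rewrite -(real_normK (num_real x)) lerXn2r ?nnegrE.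
  by rewrite ler_expR.
have hy2 : y ^+ 2 <= w ^+ 2 by rewrite -(real_normK (num_real y)) lerXn2r ?nnegrE.
have B2 : cabs ((cos y - 1) +i* sin y) <= 2 * w.
  apply: le_trans (cabs_le_ReIm _) _ => /=.
  rewrite -normrN opprB (ger0_norm (one_sub_cos_ge0 y)).
  by have := one_sub_cos_le1 y; have := abs_sin_le y; lra.
have B3 : cabs ((cos y - 1) +i* (sin y - y)) <= 2 * w ^+ 2.
  apply: le_trans (cabs_le_ReIm _) _ => /=.
  rewrite -normrN opprB (ger0_norm (one_sub_cos_ge0 y)).
  by have := one_sub_cos_le2 y; have := sin_sub_le y; lra.
have B4 : `|x| * cabs ((cos y - 1) +i* sin y) <= w * (2 * w).
  by apply: ler_pM; rewrite ?normr_ge0 ?cabs_ge0.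
have w2 : 0 <= w ^+ 2 by apply: sqr_ge0.
have B5 : w ^+ 2 <= w ^+ 2 * expR w by rewrite ler_peMr.
lra.
Qed.

(** Since [sin t = 2 cos (t / 2) sin (t / 2)] and [sin (t / 2) = (t / 2) cos c] with
    [c <= t / 2 <= pi / 4], the claim is that a product of two cosines, each at
    least [cos (pi / 4)], is at least [1 / 2]. *)
Lemma sin_ge_half (t : R) : 0 <= t <= pi / 2 -> t / 2 <= sin t.
Proof.
move=> /andP[t0 tpi].
have [->|tn0] := eqVneq t 0; first by rewrite sin0; lra.
have t2 : 0 < t / 2 by rewrite divr_gt0// lt_def tn0.
have [c /andP[c0 ct] Ec] := sin_mvt t2.
have Et : sin t = 2 * (cos (t / 2) * sin (t / 2)).
  by rewrite mulr_natl -sin_mulr2n; congr sin; rewrite -mulr_natr; field.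
have hp : 0 <= cos (pi / 2 / 2 : R).
  by apply: cos_ge0_pihalf; have := @pi_gt0 R; lra.
have hp2 : cos (pi / 2 / 2 : R) ^+ 2 = 2^-1.
  have : cos (pi / 2 : R) = cos ((pi / 2 / 2) *+ 2) by congr cos; rewrite -mulr_natr; field.
  rewrite cos_pihalf cos_mulr2n -mulr_natr; lra.
have mon (s : R) : 0 <= s -> s <= pi / 2 / 2 -> cos (pi / 2 / 2 : R) <= cos s.
  move=> s0 s1; rewrite le_eqVlt; case: (eqVneq s (pi / 2 / 2)) => [->|ne]; rewrite ?eqxx//.
  rewrite ltr_cos ?in_itv /= ?lt_neqAle ?ne ?s1 ?orbT//; have := @pi_gt0 R; lra.
have h1 := mon (t / 2) (ltW t2); have h2 := mon c (ltW c0).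
have {h1} h1 : cos (pi / 2 / 2 : R) <= cos (t / 2) by apply: h1; lra.
have {h2} h2 : cos (pi / 2 / 2 : R) <= cos c by apply: h2; lra.
rewrite Et Ec.
have h3 : cos (pi / 2 / 2) ^+ 2 <= cos (t / 2) * cos c.
  by rewrite expr2; apply: ler_pM.
rewrite hp2 in h3.
have -> : 2 * (cos (t / 2) * (t / 2 * cos c)) = (cos (t / 2) * cos c) * t by field.
nra.
Qed.

(** The chord [|e(x) - 1|] equals [2 |sin (pi x)|]. Summation by parts divides by
    such chords. *)
Lemma e2pi_sub1_lb (x : R) : `|x| <= 2^-1 -> 2 * `|x| <= cabs (e2pi x%:C - 1).
Proof.
move=> hx.
have E : e2pi x%:C - 1 = e2pi (x / 2)%:C * ((2 * sin (pi * x)) *i).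
  have -> : x%:C = (x / 2)%:C + (x / 2)%:C by rewrite -rmorphD; congr (_%:C); field.
  rewrite e2piD e2pi_real.
  have -> : 2 * pi * (x / 2) = pi * x by field.
  have := cos2Dsin2 (pi * x); set c := cos _; set s := sin _ => h.
  rewrite [X in _ - X](_ : 1 = (c ^+ 2 + s ^+ 2)%:C); last by rewrite h.
  apply/eqP; rewrite eq_complex /=; apply/andP; split; apply/eqP; ring.
rewrite E cabsM cabs_e2pi /= mulr0 oppr0 expR0 mul1r.
apply: le_trans (Im_le_cabs _); rewrite /= normrM ger0_norm// ler_pM2l//.
have pi2 := @pi_ge2 R.
wlog x0 : x hx {E} / 0 <= x.
  move=> h; have [|x0] := leP 0 x; first exact: h.
  rewrite -normrN -[in leRHS]normrN -sinN -mulrN; apply: h; rewrite ?normrN//; lra.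
rewrite (ger0_norm x0) in hx *.
apply: le_trans (ler_norm _).
apply: le_trans (sin_ge_half _); nra.
Qed.

End Exponential.

#[global] Opaque cexp.

(** * Finite q-identities *)

Section QSeries.
Variable F : fieldType.
Implicit Types (q x a b : F).

Definition poch x q n := \prod_(j < n) (1 - x * q ^+ j).

Lemma poch0 x q : poch x q 0 = 1.
Proof. by rewrite /poch big_ord0. Qed.

Lemma pochS x q n : poch x q n.+1 = poch x q n * (1 - x * q ^+ n).
Proof. by rewrite /poch big_ord_recr. Qed.

Lemma pochSl x q n : poch x q n.+1 = (1 - x) * poch (x * q) q n.
Proof.
rewrite /poch big_ord_recl expr0 mulr1; congr (_ * _).
by apply: eq_bigr => i _; rewrite lift0 exprS mulrA.
Qed.

Lemma pochD x q m n : poch x q (m + n) = poch x q m * poch (x * q ^+ m) q n.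
Proof.
rewrite /poch big_split_ord /=; congr (_ * _).
by apply: eq_bigr => i _; rewrite exprD mulrA.
Qed.

Lemma poch_neq0 x q n : (forall j, 1 - x * q ^+ j != 0) -> poch x q n != 0.
Proof. by move=> h; apply/prodf_neq0 => j _. Qed.

(** The factor left over when each [1 - x / q ^ l], with [1 <= l <= n], is
    replaced by [1 - q ^ l / x]; see [poch_reflect]. *)
Definition kap x q n := \prod_(l < n) (- (x / q ^+ l.+1)).

Lemma kap0 x q : kap x q 0 = 1.
Proof. by rewrite /kap big_ord0. Qed.

Lemma kapS x q n : kap x q n.+1 = kap x q n * - (x / q ^+ n.+1).
Proof. by rewrite /kap big_ord_recr. Qed.

Lemma kapE x q n : kap x q n = x ^+ n * kap 1 q n.
Proof.
elim: n => [|n IH]; first by rewrite !kap0 mulr1.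
by rewrite !kapS IH [x ^+ _.+1]exprS; ring.
Qed.

Lemma kap_neq0 x q n : q != 0 -> x != 0 -> kap x q n != 0.
Proof.
move=> q0 x0; apply/prodf_neq0 => l _.
by rewrite oppr_eq0 mulf_neq0// invr_eq0 expf_neq0.
Qed.

Lemma poch_reflect x q n : q != 0 -> x != 0 ->
  poch (x / q ^+ n) q n = kap x q n * poch (q / x) q n.
Proof.
move=> q0 x0; elim: n => [|n IH]; first by rewrite !poch0 kap0 mulr1.
rewrite pochSl (_ : x / q ^+ n.+1 * q = x / q ^+ n); last first.
  by rewrite exprSr; field; rewrite q0 expf_neq0.
rewrite IH pochS kapS.
have := expf_neq0 n q0; rewrite exprS; move: (q ^+ n) => Q Q0.
by field; rewrite q0 Q0 x0.
Qed.

Lemma poch_shift x q m n : q != 0 -> x != 0 ->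
  poch (x / q ^+ n) q (n + m) = kap x q n * poch (q / x) q n * poch x q m.
Proof. by move=> q0 x0; rewrite pochD divfK ?expf_neq0// poch_reflect. Qed.

(** Gaussian binomial coefficients. The Pascal recursion makes sense for every
    [q], including roots of unity. *)
Fixpoint qbin q (m k : nat) : F :=
  match m, k with
  | _, 0 => 1
  | 0, _.+1 => 0
  | m'.+1, k'.+1 => qbin q m' k'.+1 + q ^+ (m' - k') * qbin q m' k'
  end.

Lemma qbin_gt q m k : (m < k)%N -> qbin q m k = 0.
Proof.
by elim: m k => [|m IH] [|k]//= mk; rewrite !IH ?mulr0 ?addr0//; lia.
Qed.

Lemma qbin0 q m : qbin q m 0 = 1.
Proof. by case: m. Qed.

Lemma qbin_poch q m k : (k <= m)%N ->
  qbin q m k * (poch q q k * poch q q (m - k)) = poch q q m.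
Proof.
elim: m k => [|m IH] [|k]//= km; rewrite ?subn0 ?poch0 ?mul1r//.
rewrite subSS mulrDl.
have h2 := IH k km.
have [mk|mk] := eqVneq k m.
  rewrite mk qbin_gt// mul0r add0r subnn !poch0 mul1r pochS.
  by rewrite mk subnn poch0 in h2; rewrite -[in RHS]h2; ring.
have km' : (k < m)%N by rewrite ltn_neqAle mk.
have h1 := IH k.+1 km'.
have E : (m - k = (m - k.+1).+1)%N by lia.
have Em : (m = k + (m - k.+1).+1)%N by lia.
set n := (m - k.+1)%N in h1 E Em.
have Eq : q ^+ m = q ^+ k * (q * q ^+ n) by rewrite -exprS -exprD -Em.
rewrite E in h2 *; rewrite !pochS in h1 h2 *.
rewrite Eq [q ^+ n.+1]exprS -h2.
have -> : qbin q m k.+1 * (poch q q k * (1 - q * q ^+ k) * (poch q q n * (1 - q * q ^+ n)))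
  = qbin q m k.+1 * (poch q q k * (1 - q * q ^+ k) * poch q q n) * (1 - q * q ^+ n) by ring.
by rewrite h1 -h2; ring.
Qed.

(** In the induction, [q ^ m = q ^ k * q ^ (m - k)] splits the last factor of the
    product so that the Pascal rule applies. *)
Lemma qbinomial q x m :
  poch (- x) q m = \sum_(k < m.+1) q ^+ 'C(k, 2) * qbin q m k * x ^+ k.
Proof.
elim: m => [|m IH]; first by rewrite poch0 big_ord1 /= !expr0 !mulr1.
rewrite pochS IH mulNr opprK mulrDr mulr1 mulr_suml.
pose t k := q ^+ 'C(k, 2) * qbin q m k * x ^+ k.
have -> : \sum_(k < m.+1) t k = t 0 + \sum_(k < m.+1) t k.+1.
  have <- : \sum_(k < m.+2) t k = t 0 + \sum_(k < m.+1) t k.+1 by rewrite big_ord_recl.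
  by rewrite [RHS]big_ord_recr /= {3}/t qbin_gt ?ltnSn// mulr0 mul0r addr0.
rewrite [in RHS]big_ord_recl -addrA -big_split /t /= !qbin0; congr (_ + _).
apply: eq_bigr => i _.
have im : (i <= m)%N by rewrite -ltnS.
rewrite binS bin1 exprD [x ^+ i.+1]exprS add0n.
have -> : q ^+ m = q ^+ i * q ^+ (m - i) by rewrite -exprD subnKC.
by ring.
Qed.

Lemma exprz_opp_nat q (n : nat) : q ^ (- n%:Z) = (q ^+ n)^-1.
Proof. by case: n => [|n]; rewrite ?oppr0 ?expr0z ?expr0 ?invr1// -exprnN. Qed.

(** The bilateral form of the q-binomial theorem, a polynomial version of the
    triple product. The coefficients [c] enter through their recursion, so that
    the terms of a theta series can be used as they stand. *)
Lemma finite_triple_product q a (c : int -> F) N : q != 0 -> a != 0 ->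
  (forall n : int, c (n + 1) = - a * q ^ n * c n) ->
  c 0 * poch a q N * poch (q / a) q N =
  \sum_(k < (N + N).+1) c (k%:Z - N%:Z) * qbin q (N + N) k.
Proof.
move=> q0 a0 hc.
have hk (k : nat) : c (k%:Z - N%:Z) =
    c (- N%:Z) * (q ^+ 'C(k, 2) * (- (a / q ^+ N)) ^+ k).
  elim: k => [|k IH]; first by rewrite bin0n !expr0 !mulr1 add0r.
  rewrite -addn1 PoszD addrAC hc IH addn1 binS bin1 exprD exprS.
  by rewrite expfzDr// exprz_opp_nat -exprnP; ring.
have h0 : c 0 = c (- N%:Z) * kap a q N.
  elim: N {hk} => [|n IH]; first by rewrite kap0 mulr1 oppr0.
  rewrite kapS IH.
  have -> : c (- n%:Z) = c (- n.+1%:Z + 1) by congr c; lia.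
  by rewrite hc exprz_opp_nat; ring.
under eq_bigr => k _ do rewrite hk.
have := poch_shift N N q0 a0; rewrite -[X in poch X _ _]opprK qbinomial.
rewrite h0 => h; transitivity (c (- N%:Z) * (kap a q N * poch (q / a) q N * poch a q N)).
  ring.
rewrite -h mulr_sumr; apply: eq_bigr => k _; ring.
Qed.

Lemma prod_neq_ord (f : nat -> F) M (i : nat) : (i <= M)%N ->
  \prod_(m < M.+1 | m != i :> nat) f m =
  (\prod_(m < i) f m) * \prod_(m < M - i) f (i.+1 + m)%N.
Proof.
move=> iM; rewrite -(big_mkord (fun m => m != i) f).
rewrite (big_cat_nat (n := i)) //=; last by lia.
rewrite (big_ltn_cond (m := i))// ?ltnS// eqxx /=; congr (_ * _).
  rewrite big_mkord; apply: eq_bigl => m.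
  by rewrite neq_ltn ltn_ord.
rewrite -{1}[i.+1]add0n big_addn big_mkord subSS; apply: eq_big.
  by move=> m; apply/eqP; lia.
by move=> m _; rewrite addnC.
Qed.

(** Lagrange interpolation at the nodes [(y i)^-1]. The interpolating polynomials
    are products of [1 - y m X], which match the factors of q-products. *)
Lemma lagrange_at n (y : 'I_n -> F) (p : {poly F}) a :
  injective y -> (forall i, y i != 0) -> (size p <= n)%N ->
  p.[a] = \sum_i p.[(y i)^-1] *
     \prod_(m | m != i) ((1 - a * y m) / (1 - y m / y i)).
Proof.
move=> yinj y0 sp.
pose L i : {poly F} := \prod_(m | m != i) ((1 - y m / y i)^-1 *: (1 - y m *: 'X)).
have LE i x : (L i).[x] = \prod_(m | m != i) ((1 - x * y m) / (1 - y m / y i)).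
  rewrite horner_prod; apply: eq_bigr => m _.
  by rewrite !hornerE mulrC [x * _]mulrC.
pose r := \sum_i p.[(y i)^-1] *: L i.
suff E : p = r by rewrite {1}E horner_sum; apply: eq_bigr => i _; rewrite hornerZ LE.
apply/eqP; rewrite -subr_eq0; apply/eqP.
apply: (@roots_geq_poly_eq0 _ _ [seq (y i)^-1 | i <- enum 'I_n]).
- apply/allP => _ /mapP[i _ ->]; rewrite rootE hornerD hornerN horner_sum.
  rewrite (bigD1 i)//= hornerZ LE big1 ?mulr1 ?addr0; last first.
    move=> m mi; rewrite [(y i)^-1 * _]mulrC divff// subr_eq0 eq_sym.
    by apply/eqP => /(congr1 ( *%R^~ (y i))); rewrite divfK// mul1r => /yinj /eqP; rewrite (negbTE mi).
  rewrite [X in _ - (_ + X)]big1 ?addr0 ?subrr// => j ji.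
  rewrite hornerZ LE (bigD1 i) 1?eq_sym//= mulVf//.
  by rewrite subrr !mul0r mulr0.
- rewrite map_inj_uniq ?enum_uniq//.
  by move=> i j /invr_inj /yinj.
- rewrite size_map size_enum_ord.
  apply: leq_trans (size_polyD _ _) _; rewrite geq_max sp size_polyN.
  apply: leq_trans (size_sum _ _ _) _; apply/bigmax_leqP => i _.
  apply: leq_trans (size_scale_leq _ _) _.
  apply: leq_trans (size_prod_leq _ _) _.
  have ->: #|[pred m | m != i]| = n.-1.
    by rewrite (eq_card (B := predC1 i)) ?cardC1 ?card_ord.
  have n0 : (0 < n)%N by case: (n) i => [[]|].
  rewrite leq_subLR; apply: (@leq_trans (\sum_(m | m != i) 2).+1).
    rewrite ltnS; apply: leq_sum => m _.
    apply: leq_trans (size_scale_leq _ _) _.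
    apply: leq_trans (size_polyD _ _) _; rewrite geq_max size_poly1 size_polyN.
    by rewrite (leq_trans (size_scale_leq _ _))// size_polyX.
  rewrite sum_nat_const (eq_card (B := predC1 i)) ?cardC1 ?card_ord//.
  by lia.
Qed.

(** The denominator vanishes at [a = q ^ - n] for [|n| <= N], and after reflection
    of half of its factors the numerator is a polynomial in [a] of degree [2 N]:
    Lagrange interpolation at these [2 N + 1] points, divided by the denominator,
    is a partial fraction decomposition. It is a finite form of Kronecker's
    formula. *)
Lemma finite_kronecker q a b N : q != 0 -> a != 0 -> b != 0 ->
  (forall j, q * q ^+ j != 1) -> (forall n : int, a * q ^ n != 1) ->
  poch (a * b) q N * poch (q / (a * b)) q N / (poch a q N.+1 * poch (q / a) q N) =
  \sum_(i < (N + N).+1) b ^ (i%:Z - N%:Z) / (1 - a * q ^ (i%:Z - N%:Z)) *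
    (poch b q (N + N - i) * poch (q / b) q i / (poch q q (N + N - i) * poch q q i)).
Proof.
move=> q0 a0 b0 q1 aq1; set M := (N + N)%N.
(* the powers q ^ n for |n| <= N, with the index shifted by N *)
pose y (i : 'I_M.+1) := q ^+ i / q ^+ N.
have qn n : q ^+ n != 0 by apply: expf_neq0.
have y0 i : y i != 0 by rewrite mulf_neq0// invr_eq0.
have q1' j : 1 - q * q ^+ j != 0 by rewrite subr_eq0 eq_sym.
have aq1' n : 1 - a * q ^ n != 0 by rewrite subr_eq0 eq_sym.
have yinj : injective y.
  have lt_inj (i j : 'I_M.+1) : (i < j)%N -> y i != y j.
    move=> ij; have -> : y j = y i * (q * q ^+ (j - i.+1)).
      by rewrite /y mulrAC -exprS -exprD -subSn// subSS subnKC// ltnW.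
    by apply/eqP => /esym/eqP; rewrite -subr_eq0 -{2}[y i]mulr1 -mulrBr mulf_eq0
      (negbTE (y0 i)) subr_eq0 (negbTE (q1 _)).
  move=> i j /eqP yij; apply/val_inj/eqP => /=.
  by case: ltngtP => // /lt_inj; rewrite ?yij// eq_sym yij.
pose p : {poly F} := \prod_(j < M) (1 - (b / q ^+ N * q ^+ j) *: 'X).
have pE x : p.[x] = poch (x * b / q ^+ N) q M.
  by rewrite horner_prod; apply: eq_bigr => m _; rewrite !hornerE; ring.
have sp : (size p <= M.+1)%N.
  apply: leq_trans (size_prod_leq _ _) _; rewrite card_ord leq_subLR addnS ltnS.
  apply: (@leq_trans (\sum_(i < M) 2)); last by rewrite sum_nat_const card_ord; lia.
  apply: leq_sum => m _.
  apply: leq_trans (size_polyD _ _) _; rewrite geq_max size_poly1 size_polyN.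
  by rewrite (leq_trans (size_scale_leq _ _))// size_polyX.
have := lagrange_at a yinj y0 sp.
have yE i : y i = q ^ (i%:Z - N%:Z) by rewrite expfzDr// exprz_opp_nat.
have an0 n : poch a q n != 0.
  by apply: poch_neq0 => j; have := aq1' j%:Z; rewrite -exprnP.
have qan0 n : poch (q / a) q n != 0.
  apply: poch_neq0 => j; rewrite subr_eq0; have := aq1 (- (j.+1)%:Z).
  rewrite exprz_opp_nat; apply: contra_neq => /eqP; rewrite mulrAC -exprS => /eqP E.
  by rewrite -[RHS]invr1 E invfM invrK mulrC.
have K0 := kap_neq0 N q0 a0.
have kab : kap (a * b) q N = kap a q N * b ^+ N.
  by rewrite kapE [kap a q N]kapE exprMn; ring.
rewrite pE poch_shift ?mulf_neq0// kab => E.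
have D : \prod_(m < M.+1) (1 - a * y m) = kap a q N * poch (q / a) q N * poch a q N.+1.
  rewrite -poch_shift// addnS; apply: eq_bigr => m _.
  by rewrite /y; ring.
have {}E : kap a q N * b ^+ N * (poch (a * b) q N * poch (q / (a * b)) q N) =
  \sum_(i < M.+1) kap a q N * b ^+ N * (poch a q N.+1 * poch (q / a) q N) *
    (b ^ (i%:Z - N%:Z) / (1 - a * q ^ (i%:Z - N%:Z)) *
    (poch b q (M - i) * poch (q / b) q i / (poch q q (M - i) * poch q q i))).
  transitivity (kap a q N * b ^+ N * poch (q / (a * b)) q N * poch (a * b) q N).
    ring.
  rewrite {}E; apply: eq_bigr => i _; have iM : (i <= M)%N by rewrite -ltnS.
  rewrite prodf_div.
  have -> : \prod_(m < M.+1 | m != i) (1 - a * y m) =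
    kap a q N * poch (q / a) q N * poch a q N.+1 / (1 - a * y i).
    by rewrite -D [in RHS](bigD1 i)//= mulrAC divff ?mul1r// yE.
  have -> : \prod_(m < M.+1 | m != i) (1 - y m / y i) =
    kap 1 q i * poch q q i * poch q q (M - i).
    transitivity (\prod_(m < M.+1 | m != i :> nat) (1 - q ^+ m / q ^+ i)).
      apply: eq_bigr => m _; rewrite /y invfM invrK; congr (1 - _).
      by field; rewrite !qn.
    rewrite (prod_neq_ord (fun m => 1 - q ^+ m / q ^+ i) iM); congr (_ * _).
      have := poch_reflect i q0 (oner_neq0 F); rewrite divr1 => <-.
      by apply: eq_bigr => m _; rewrite mulrC mul1r.
    apply: eq_bigr => m _; congr (1 - _).
    by rewrite addSn exprS exprD; field.
  rewrite pE.
  have -> : (y i)^-1 * b / q ^+ N = b / q ^+ i by rewrite /y; field; rewrite !qn.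
  have -> : poch (b / q ^+ i) q M = kap b q i * poch (q / b) q i * poch b q (M - i).
    by rewrite -poch_shift// subnKC.
  rewrite [kap b q i]kapE -yE.
  rewrite expfzDr// exprz_opp_nat -exprnP.
  have k1 : kap 1 q i != 0 by apply: kap_neq0; rewrite ?oner_neq0.
  have := aq1' (i%:Z - N%:Z); rewrite -yE => ay.
  have := poch_neq0 i q1'; have := poch_neq0 (M - i) q1'.
  move=> p1 p2; have bN := expf_neq0 N b0.
  by field; rewrite k1 ay p1 p2 bN.
have KN : kap a q N * b ^+ N != 0 by rewrite mulf_neq0// expf_neq0.
move: E; rewrite -mulr_sumr -[X in _ = X]mulrA => E; rewrite (mulfI KN E).
by rewrite mulrC mulrA mulVf ?mul1r// mulf_neq0.
Qed.

End QSeries.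

(** * The triple product and Kronecker's Lambert series *)

Section InfiniteProducts.
Variable R : realType.
Local Notation C := R[i].
Implicit Types (q x y a b : C).

Lemma cabs_limit_le (u : nat -> C) (l : C) M :
  u @ \oo --> l -> (forall n, cabs (u n) <= M) -> cabs l <= M.
Proof.
move=> /ccvgP h hM; apply/ler_addgt0Pr => e /h[n _ /(_ n (leqnn n)) hn].
by have := hM n; have := cabs_ge_sub l (u n); rewrite cabsC; lra.
Qed.

Lemma cabs_limit_ge (u : nat -> C) (l : C) M :
  u @ \oo --> l -> (forall n, M <= cabs (u n)) -> M <= cabs l.
Proof.
move=> /ccvgP h hM; apply/ler_addgt0Pr => e /h[n _ /(_ n (leqnn n)) hn].
by have := hM n; have := cabs_ge_sub (u n) l; lra.
Qed.

Lemma poch_ub x q n : cabs q < 1 -> cabs (poch x q n) <= expR (cabs x / (1 - cabs q)).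
Proof.
move=> q1; rewrite /poch cabs_prod.
apply: (@le_trans _ _ (\prod_(j < n) expR (cabs x * cabs q ^+ j))).
  apply: ler_prod => j _; rewrite cabs_ge0 /=.
  apply: le_trans (cabsB _ _) _; rewrite cabs1 cabsM cabsX.
  exact: expR_ge1Dx.
rewrite -expR_sum ler_expR -mulr_sumr ler_wpM2l// geo_sum_le//.
by rewrite cabs_ge0.
Qed.

Lemma poch_lb x q n : cabs q < 1 -> cabs x < 1 ->
  expR (- (cabs x / (1 - cabs x) / (1 - cabs q))) <= cabs (poch x q n).
Proof.
move=> q1 x1; rewrite /poch cabs_prod.
have q0 := cabs_ge0 q; have x0 := cabs_ge0 x.
apply: (@le_trans _ _ (\prod_(j < n) expR (- (cabs x / (1 - cabs x) * cabs q ^+ j)))).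
  rewrite -expR_sum ler_expR sumrN lerN2 -mulr_sumr ler_wpM2l//.
    by rewrite divr_ge0//; lra.
  by rewrite geo_sum_le// q0.
apply: ler_prod => j _; rewrite expR_ge0 /=.
have h1 := cabs_ge_sub 1 (x * q ^+ j).
apply: le_trans h1; rewrite cabs1 cabsM cabsX.
have hj : 0 <= cabs q ^+ j <= 1 by rewrite exprn_ge0//= exprn_ile1// ltW.
set r := cabs x * cabs q ^+ j.
have r0 : 0 <= r by rewrite mulr_ge0//; case/andP: hj.
have rx : r <= cabs x by rewrite ler_piMr//; case/andP: hj.
have hpos : 0 < 1 - r by lra.
have hxp : 0 < 1 - cabs x by lra.
apply: (@le_trans _ _ (expR (- (r / (1 - r))))).
  have -> : cabs x / (1 - cabs x) * cabs q ^+ j = r / (1 - cabs x) by rewrite /r; ring.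
  rewrite ler_expR lerN2 ler_wpM2l//.
  by rewrite lef_pV2 ?posrE//; lra.
rewrite expRN -[leRHS]invrK lef_pV2 ?posrE ?expR_gt0 ?invr_gt0//.
apply: le_trans (expR_ge1Dx _).
by rewrite le_eqVlt; apply/orP; left; apply/eqP; field; lra.
Qed.

Definition pochoo x q : C := lim (poch x q n @[n --> \oo]).

(** The partial products are written as a series of their differences, which are
    dominated by a geometric series. *)
Lemma poch_cvg x q : cabs q < 1 -> poch x q @ \oo --> pochoo x q.
Proof.
move=> q1.
have q0 := cabs_ge0 q.
pose B := expR (cabs x / (1 - cabs q)).
(* the difference of two successive partial products *)
pose t k := - (x * q ^+ k) * poch x q k.
have E n : poch x q n = 1 + \sum_(k < n) t k.
  elim: n => [|n IH]; first by rewrite poch0 big_ord0 addr0.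
  by rewrite pochS big_ord_recr /= addrA -IH /t; ring.
have [|k|s hs] := @hsum_ex _ _ (fun k => cabs x * B * cabs q ^+ k) t.
- apply: summZ; first by rewrite mulr_ge0// expR_ge0.
  by apply: summ_geo; rewrite q0.
- rewrite /t cabsM cabsN cabsM cabsX mulrAC ler_wpM2r ?exprn_ge0//.
  by rewrite ler_wpM2l// poch_ub.
have h := hsum_nat hs.
have : poch x q @ \oo --> 1 + s.
  rewrite (_ : poch x q = fun n => 1 + \sum_(k < n) t k); last exact/funext.
  exact: (ccvgD (ccvg_cst (a := 1)) h).
by move=> hl; rewrite /pochoo (cvg_lim _ hl).
Qed.

Arguments poch_cvg x {q} q1.

Lemma pochoo_eq x q l : poch x q @ \oo --> l -> pochoo x q = l.
Proof. by move=> h; apply: cvg_lim. Qed.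

Lemma pochoo_ub x q : cabs q < 1 -> cabs (pochoo x q) <= expR (cabs x / (1 - cabs q)).
Proof. by move=> q1; apply: (cabs_limit_le (poch_cvg x q1)) => n; apply: poch_ub. Qed.

Lemma pochoo_lb x q : cabs q < 1 -> cabs x < 1 ->
  expR (- (cabs x / (1 - cabs x) / (1 - cabs q))) <= cabs (pochoo x q).
Proof. by move=> q1 x1; apply: (cabs_limit_ge (poch_cvg x q1)) => n; apply: poch_lb. Qed.

Lemma pochoo_neq0 x q : cabs q < 1 -> cabs x < 1 -> pochoo x q != 0.
Proof.
move=> q1 x1; rewrite -cabs_gt0; apply: lt_le_trans (pochoo_lb q1 x1).
exact: expR_gt0.
Qed.

Lemma ccvg_shift (u : nat -> C) (l : C) : u @ \oo --> l -> (fun n => u n.+1) @ \oo --> l.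
Proof.
move=> /ccvgP h; apply/ccvgP => e /h[N _ hN]; exists N => // n /= Nn.
by apply: hN; rewrite /= leqW.
Qed.

Lemma pochooSl x q : cabs q < 1 -> pochoo x q = (1 - x) * pochoo (x * q) q.
Proof.
move=> q1; apply: pochoo_eq.
have h : (fun n => poch x q n.+1) @ \oo --> (1 - x) * pochoo (x * q) q.
  rewrite (_ : (fun n => _) = fun n => (1 - x) * poch (x * q) q n).
    exact: (ccvgZ (b := 1 - x) (poch_cvg (x * q) q1)).
  by apply/funext => n; rewrite pochSl.
move/ccvgP: h => h; apply/ccvgP => e /h[N _ hN]; exists N.+1 => // -[|n] //= Nn.
exact: hN.
Qed.

(** The infinite product is locally Lipschitz in [x]. Finite products are compared
    factor by factor, with a constant that does not depend on their length. *)
Lemma pochoo_lip x y q : cabs q < 1 ->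
  cabs (pochoo x q - pochoo y q) <=
  cabs (x - y) * (expR (cabs y / (1 - cabs q)) * expR (cabs x / (1 - cabs q)) / (1 - cabs q)).
Proof.
move=> q1; have q0 := cabs_ge0 q.
apply: (cabs_limit_le (ccvgB (poch_cvg x q1) (poch_cvg y q1))) => n.
set B := expR (cabs y / _).
pose E n := \prod_(j < n) (1 + cabs x * cabs q ^+ j).
have E1 m : 1 <= E m.
  rewrite /E; elim: m => [|m IH]; rewrite ?big_ord0// big_ord_recr /= mulr_ege1//.
  by rewrite lerDl mulr_ge0// exprn_ge0.
apply: (@le_trans _ _ (cabs (x - y) * (B * E n * \sum_(k < n) cabs q ^+ k))).
  elim: n => [|n IH]; first by rewrite !poch0 subrr cabs0 big_ord0 !mulr0.
  have -> : poch x q n.+1 - poch y q n.+1 = (poch x q n - poch y q n) * (1 - x * q ^+ n)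
    - poch y q n * ((x - y) * q ^+ n) by rewrite !pochS; ring.
  apply: le_trans (cabsB _ _) _; rewrite !cabsM cabsX.
  rewrite /E !big_ord_recr /= -/(E n).
  set S := \sum_(k < n) _ in IH *; set p := cabs q ^+ n; set d := cabs (x - y) in IH *.
  have p0 : 0 <= p by rewrite exprn_ge0.
  have d0 : 0 <= d by exact: cabs_ge0.
  have h1 : cabs (1 - x * q ^+ n) <= 1 + cabs x * p.
    by apply: le_trans (cabsB _ _) _; rewrite cabs1 cabsM cabsX.
  have h2 : cabs (poch y q n) <= B by exact: poch_ub.
  have B0 : 0 <= B by exact: expR_ge0.
  have a1 := ler_pM (cabs_ge0 _) (cabs_ge0 _) IH h1.
  have dp0 : 0 <= d * p by rewrite mulr_ge0.
  have a2 := ler_wpM2r dp0 h2.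
  have x0 := cabs_ge0 x.
  have a3 : B * (d * p) <= B * (d * p) * (E n * (1 + cabs x * p)).
    apply: ler_peMr; first by rewrite mulr_ge0.
    by apply: mulr_ege1 => //; rewrite lerDl mulr_ge0.
  apply: le_trans (lerD a1 (le_trans a2 a3)) _.
  by rewrite le_eqVlt; apply/orP; left; apply/eqP; ring.
have hE : E n <= expR (cabs x / (1 - cabs q)).
  apply: (@le_trans _ _ (\prod_(j < n) expR (cabs x * cabs q ^+ j))).
    apply: ler_prod => j _; rewrite expR_ge1Dx andbT addr_ge0// mulr_ge0// exprn_ge0//.
  rewrite -expR_sum ler_expR -mulr_sumr ler_wpM2l// geo_sum_le//.
  by rewrite q0.
apply: ler_wpM2l => //; apply: ler_pM.
- by rewrite mulr_ge0 ?expR_ge0//; apply: le_trans (E1 n).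
- by apply: sumr_ge0 => k _; rewrite exprn_ge0.
- by rewrite ler_wpM2l ?expR_ge0.
- by rewrite geo_sum_le// q0.
Qed.

Lemma cvg_addr_nat (u : nat -> C) (l : C) (f : nat -> nat) :
  u @ \oo --> l -> (forall n, (n <= f n)%N) -> (fun n => u (f n)) @ \oo --> l.
Proof.
move=> /ccvgP h hf; apply/ccvgP => e /h[N _ hN]; exists N => // n /= Nn.
by apply: hN; apply: leq_trans (hf n).
Qed.

Lemma cvg_absz_sub (u : nat -> C) (l : C) (m : int) (s : bool) :
  u @ \oo --> l ->
  (fun N => u (absz (N%:Z + (-1) ^+ s * m))) @ \oo --> l.
Proof.
move=> /ccvgP h; apply/ccvgP => e /h[N _ hN].
exists (N + `|m|)%N => // n /= Nn.
by apply: hN; rewrite /=; case: s; rewrite ?expr1 ?expr0; lia.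
Qed.

(** Jacobi's triple product is the limit of its finite form: the quotients
    [(q)_2N / ((q)_(N - n) (q)_(N + n))] are bounded, and tend to [1 / (q)_oo]. *)
Lemma triple_product q a (c : int -> C) s :
  q != 0 -> cabs q < 1 -> a != 0 ->
  (forall n : int, c (n + 1) = - a * q ^ n * c n) ->
  summ (fun n => cabs (c n)) -> hsum c s ->
  s = c 0 * pochoo a q * pochoo (q / a) q * pochoo q q.
Proof.
move=> q0 q1 a0 hc sc hs.
have qq0 : pochoo q q != 0 by apply: pochoo_neq0.
have pq0 n : poch q q n != 0.
  by rewrite -cabs_gt0; apply: lt_le_trans (poch_lb n q1 q1); exact: expR_gt0.
(* the finite identity, as a series over the integers extended by zero *)
pose x N (n : int) := if n \in window N N.+1
  then c n * qbin q (N + N) (absz (n + N%:Z)%R) else 0.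
have xE N (n : int) : n \in window N N.+1 -> x N n = c n *
  (poch q q (N + N) / (poch q q (absz (N%:Z + (-1) ^+ false * n)%R) *
     poch q q (absz (N%:Z + (-1) ^+ true * n)%R))).
  move=> h; rewrite /x h; congr (_ * _).
  apply: (mulIf (mulf_neq0 (pq0 (absz (N%:Z + n)%R)) (pq0 (absz (N%:Z - n)%R)))).
  rewrite expr0 expr1 mul1r mulN1r divfK ?mulf_neq0// addrC.
  move: h; rewrite mem_window => h.
  have -> : (absz (N%:Z - n)%R) = (N + N - (absz (N%:Z + n)%R))%N :> nat by lia.
  by rewrite qbin_poch//; lia.
pose B := expR (cabs q / (1 - cabs q)).
pose d := expR (- (cabs q / (1 - cabs q) / (1 - cabs q))).
have d0 : 0 < d by exact: expR_gt0.
have K : 0 <= B / (d * d) by rewrite divr_ge0 ?mulr_ge0 ?expR_ge0.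
have dom N n : cabs (x N n) <= B / (d * d) * cabs (c n).
  case: (boolP (n \in window N N.+1)) => h; last first.
    by rewrite /x (negbTE h) cabs0 mulr_ge0.
  rewrite xE// mulrC cabsM ler_wpM2r// cabsM cabsV cabsM.
  apply: ler_pM; rewrite ?invr_ge0 ?mulr_ge0 ?poch_ub//.
  rewrite lef_pV2 ?posrE ?mulr_gt0 ?cabs_gt0 ?pq0//.
  by apply: ler_pM; rewrite ?poch_lb ?expR_ge0.
have lim n : x ^~ n @ \oo --> c n / pochoo q q.
  have p1 : (fun N => c n * (poch q q (N + N) / (poch q q (absz (N%:Z + (-1) ^+ false * n)%R) *
     poch q q (absz (N%:Z + (-1) ^+ true * n)%R)))) @ \oo --> c n / pochoo q q.
    have -> : c n / pochoo q q = c n * (pochoo q q / (pochoo q q * pochoo q q)) by field.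
    have h := poch_cvg q q1.
    have h1 := cvg_addr_nat h (fun N => leq_addr N N).
    have h2 := cvg_absz_sub n false h; have h3 := cvg_absz_sub n true h.
    exact: (ccvgZ (b := c n) (ccvgM h1 (ccvgV (mulf_neq0 qq0 qq0) (ccvgM h2 h3)))).
  move/ccvgP: p1 => p1; apply/ccvgP => e /p1[N1 _ h1].
  exists (N1 + (absz n).+1)%N => // N /= hN.
  rewrite xE; first by apply: h1; rewrite /=; lia.
  by rewrite mem_window; lia.
have hx N : hsum (x N) (c 0 * poch a q N * poch (q / a) q N).
  rewrite (finite_triple_product N q0 a0 hc).
  rewrite (_ : \sum_(k < (N + N).+1) _ =
     \sum_(n <- window N N.+1) c n * qbin q (N + N) (absz (n + N%:Z)%R)).
    exact: hsum_window.
  rewrite big_window -addnS; apply: eq_bigr => k _; rewrite subrK//.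
have hy : hsum (fun n => c n / pochoo q q) (s / pochoo q q).
  rewrite mulrC; apply: eq_hsum (hsumZ (c := (pochoo q q)^-1) hs) => n /=.
  by rewrite mulrC.
have := tannery (summZ K sc) dom lim hx hy.
have h2 : (fun N => c 0 * poch a q N * poch (q / a) q N) @ \oo -->
   c 0 * pochoo a q * pochoo (q / a) q.
  exact: (ccvgM (ccvgZ (b := c 0) (poch_cvg a q1)) (poch_cvg (q / a) q1)).
by move=> /(ccvg_unique h2) ->; rewrite divfK.
Qed.

Lemma summ_geo_int (K r : R) : 0 <= K -> 0 <= r < 1 ->
  summ (fun n : int => K * r ^+ `|n|%N).
Proof.
move=> K0 r01; apply: (summ_int (h := fun n => K * r ^+ n)).
  exact: summZ K0 (summ_geo r01).
move=> n; rewrite lexx andbT mulr_ge0// exprn_ge0//; by case/andP: r01.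
Qed.

(** If [a] and [b] lie in the annulus between the circles through [q] and [1],
    then the terms of the Lambert series decay geometrically in both directions:
    as [b ^ n] for [n >= 0], and as [(q / b) ^ |n|] for [n < 0], where the
    denominator grows as [q ^ n]. *)
Lemma lambert_bound q a b (n : int) :
  q != 0 -> cabs q < cabs a < 1 -> cabs q < cabs b < 1 ->
  a * q ^ n != 1 /\
  cabs (b ^ n / (1 - a * q ^ n)) <=
    ((1 - cabs a)^-1 + (cabs a - cabs q)^-1) *
    Num.max (cabs b) (cabs q / cabs b) ^+ `|n|%N.
Proof.
move=> q0 /andP[qa a1] /andP[qb b1].
have Q0 : 0 < cabs q by rewrite cabs_gt0.
have q1 : cabs q < 1 by exact: lt_trans qa a1.
have B0 : 0 < cabs b by exact: lt_trans qb.
have a1' : 0 < 1 - cabs a by lra.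
have aq' : 0 < cabs a - cabs q by lra.
have ia := ltW (_ : 0 < (1 - cabs a)^-1); have iq := ltW (_ : 0 < (cabs a - cabs q)^-1).
rewrite !invr_gt0 in ia iq; have {}ia := ia a1'; have {}iq := iq aq'.
have b0 : b != 0 by rewrite -cabs_gt0.
set r := Num.max _ _.
have r0 : 0 <= r by rewrite le_max cabs_ge0.
case: n => m.
  have h : cabs (a * q ^+ m) <= cabs a.
    by rewrite cabsM cabsX ler_piMr// exprn_ile1// ltW.
  have h2 : 1 - cabs a <= cabs (1 - a * q ^+ m).
    by have := cabs_ge_sub 1 (a * q ^+ m); rewrite cabs1; lra.
  split; first by rewrite eq_sym -subr_eq0 -cabs_gt0; apply: lt_le_trans h2.
  rewrite absz_nat cabsM cabsV -!exprnP cabsX mulrC; apply: ler_pM; rewrite ?invr_ge0 ?exprn_ge0//.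
    apply: (@le_trans _ _ (1 - cabs a)^-1); last by lra.
    by rewrite lef_pV2 ?posrE//; exact: lt_le_trans h2.
  by rewrite lerXn2r ?nnegrE// le_max lexx.
set k := m.+1.
have -> : Negz m = - k%:Z by [].
rewrite !exprz_opp_nat abszN absz_nat.
have qk0 : q ^+ k != 0 by rewrite expf_neq0.
have bk0 : b ^+ k != 0 by rewrite expf_neq0.
have h : cabs (q ^+ k) <= cabs q by rewrite cabsX exprS ler_piMr// exprn_ile1// ltW.
have h2 : cabs a - cabs q <= cabs (q ^+ k - a).
  by have := cabs_ge_sub a (q ^+ k); rewrite cabsC; lra.
have n0 : q ^+ k - a != 0 by rewrite -cabs_gt0; apply: lt_le_trans h2.
have E : 1 - a / q ^+ k = (q ^+ k - a) / q ^+ k by field.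
split; first by rewrite eq_sym -subr_eq0 E mulf_neq0// invr_eq0.
have -> : (b ^+ k)^-1 / (1 - a / q ^+ k) = (q ^+ k - a)^-1 * (q / b) ^+ k.
  by rewrite E expr_div_n; field; rewrite bk0 qk0 n0.
rewrite cabsM cabsV cabsX cabsM cabsV; apply: ler_pM; rewrite ?invr_ge0 ?exprn_ge0 ?divr_ge0//.
  apply: (@le_trans _ _ (cabs a - cabs q)^-1); last by lra.
  by rewrite lef_pV2 ?posrE//; exact: lt_le_trans h2.
by rewrite lerXn2r ?nnegrE ?divr_ge0// le_max lexx orbT.
Qed.

(** The limit of [finite_kronecker]: the weights of its terms are bounded, and tend
    to one and the same constant. *)
Lemma kronecker_lambert q a b s :
  q != 0 -> cabs q < cabs a < 1 -> cabs q < cabs b < 1 ->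
  hsum (fun n : int => b ^ n / (1 - a * q ^ n)) s ->
  s = pochoo q q ^+ 2 * (pochoo (a * b) q * pochoo (q / (a * b)) q) /
      (pochoo a q * pochoo (q / a) q * (pochoo b q * pochoo (q / b) q)).
Proof.
move=> q0 ha hb hs.
have aq1 n : a * q ^ n != 1 by have [] := lambert_bound n q0 ha hb.
have bound n := (lambert_bound n q0 ha hb).2.
case/andP: ha => qa a1; case/andP: hb => qb b1.
have Q0 : 0 < cabs q by rewrite cabs_gt0.
have q1 : cabs q < 1 by exact: lt_trans qa a1.
have A0 : 0 < cabs a by exact: lt_trans qa.
have B0 : 0 < cabs b by exact: lt_trans qb.
have a0 : a != 0 by rewrite -cabs_gt0.
have b0 : b != 0 by rewrite -cabs_gt0.
set r := Num.max _ _ in bound; set K := _ + _ in bound.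
have r01 : 0 <= r < 1 by rewrite le_max cabs_ge0/= gt_max b1 ltr_pdivrMr// mul1r.
have K0 : 0 <= K by rewrite addr_ge0// invr_ge0; lra.
have qq0 : pochoo q q != 0 by apply: pochoo_neq0.
have pq0 n : poch q q n != 0.
  by rewrite -cabs_gt0; apply: lt_le_trans (poch_lb n q1 q1); exact: expR_gt0.
have qqn j : q * q ^+ j != 1.
  apply/eqP => /(congr1 (@cabs R)); rewrite cabsM cabsX cabs1 => E.
  have : cabs q * cabs q ^+ j <= cabs q by rewrite ler_piMr// exprn_ile1// ltW.
  by lra.
have qdiv x : x != 0 -> cabs q < cabs x -> cabs (q / x) < 1.
  by move=> x0 qx; rewrite cabsM cabsV ltr_pdivrMr ?cabs_gt0// mul1r.
have oa := pochoo_neq0 q1 a1; have oqa := pochoo_neq0 q1 (qdiv _ a0 qa).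
have ob := pochoo_neq0 q1 b1; have oqb := pochoo_neq0 q1 (qdiv _ b0 qb).
pose w (i j : nat) := poch b q i * poch (q / b) q j / (poch q q i * poch q q j).
(* the finite identity, as a series over the integers extended by zero *)
pose x N (n : int) := if n \in window N N.+1
  then b ^ n / (1 - a * q ^ n) * w (absz (N%:Z + (-1) ^+ true * n)) (absz (N%:Z + (-1) ^+ false * n))
  else 0.
pose L := expR (cabs b / (1 - cabs q)) * expR (cabs (q / b) / (1 - cabs q)).
pose d := expR (- (cabs q / (1 - cabs q) / (1 - cabs q))).
have d0 : 0 < d by exact: expR_gt0.
have L0 : 0 <= L / (d * d) by rewrite divr_ge0 ?mulr_ge0 ?expR_ge0.
have dom N n : cabs (x N n) <= L / (d * d) * (K * r ^+ `|n|%N).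
  have kr : 0 <= K * r ^+ `|n|%N by rewrite mulr_ge0 ?exprn_ge0//; case/andP: r01.
  rewrite /x; case: ifP => h; last by rewrite cabs0 mulr_ge0.
  rewrite mulrC cabsM; apply: ler_pM => //.
  rewrite /w cabsM cabsV !cabsM.
  apply: ler_pM; rewrite ?invr_ge0 ?mulr_ge0//.
    by apply: ler_pM; rewrite ?poch_ub.
  rewrite lef_pV2 ?posrE ?mulr_gt0 ?cabs_gt0 ?pq0//.
  by apply: ler_pM; rewrite ?poch_lb ?expR_ge0.
pose W := pochoo b q * pochoo (q / b) q / (pochoo q q * pochoo q q).
have lim n : x ^~ n @ \oo --> b ^ n / (1 - a * q ^ n) * W.
  have p1 : (fun N => b ^ n / (1 - a * q ^ n) *
      w (absz (N%:Z + (-1) ^+ true * n)) (absz (N%:Z + (-1) ^+ false * n)))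
    @ \oo --> b ^ n / (1 - a * q ^ n) * W.
    have h := poch_cvg q q1; have hh := poch_cvg b q1; have hhh := poch_cvg (q / b) q1.
    have h1 := cvg_absz_sub n true h; have h2 := cvg_absz_sub n false h.
    have h3 := cvg_absz_sub n true hh; have h4 := cvg_absz_sub n false hhh.
    exact: (ccvgZ (b := _ / _) (ccvgM (ccvgM h3 h4) (ccvgV (mulf_neq0 qq0 qq0) (ccvgM h1 h2)))).
  move/ccvgP: p1 => p1; apply/ccvgP => e /p1[N1 _ h1].
  exists (N1 + (absz n).+1)%N => // N /= hN.
  have hw : n \in window N N.+1 by rewrite mem_window; move: hN => /=; clear; lia.
  have hN1 : (N1 <= N)%N by move: hN => /=; clear; lia.
  by rewrite /x hw; exact: h1.
have hx N : hsum (x N)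
   (poch (a * b) q N * poch (q / (a * b)) q N / (poch a q N.+1 * poch (q / a) q N)).
  rewrite (finite_kronecker N q0 a0 b0 qqn aq1).
  rewrite (_ : \sum_(k < (N + N).+1) _ =
     \sum_(n <- window N N.+1) b ^ n / (1 - a * q ^ n) *
       w (absz (N%:Z + (-1) ^+ true * n)) (absz (N%:Z + (-1) ^+ false * n))).
    exact: hsum_window.
  rewrite big_window -addnS; apply: eq_bigr => k _; congr (_ * _).
  have h1 : absz (N%:Z + (-1) ^+ true * (k%:Z - N%:Z)) = (N + N - k)%N.
    by have := ltn_ord k; rewrite expr1; clear; lia.
  have h2 : absz (N%:Z + (-1) ^+ false * (k%:Z - N%:Z)) = k.
    by rewrite expr0; clear; lia.
  by rewrite h1 h2.
have hy : hsum (fun n => b ^ n / (1 - a * q ^ n) * W) (s * W).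
  rewrite mulrC; apply: eq_hsum (hsumZ (c := W) hs) => n /=.
  by rewrite mulrC.
have := tannery (summZ L0 (summ_geo_int K0 r01)) dom lim hx hy.
have h2 : (fun N => poch (a * b) q N * poch (q / (a * b)) q N / (poch a q N.+1 * poch (q / a) q N)) @ \oo -->
   pochoo (a * b) q * pochoo (q / (a * b)) q / (pochoo a q * pochoo (q / a) q).
  exact: (ccvgM (ccvgM (poch_cvg _ q1) (poch_cvg _ q1))
    (ccvgV (mulf_neq0 oa oqa) (ccvgM (ccvg_shift (poch_cvg _ q1)) (poch_cvg _ q1)))).
move=> /(ccvg_unique h2) E.
have W0 : W != 0 by rewrite !mulf_neq0// invr_eq0 mulf_neq0.
apply: (mulIf W0); rewrite -E /W.
move: (pochoo (a * b) q) (pochoo (q / (a * b)) q) (pochoo q q) (pochoo a q)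
  (pochoo (q / a) q) (pochoo b q) (pochoo (q / b) q) qq0 oa oqa ob oqb.
clear => u v w0 u1 v1 u2 v2 w0n u1n v1n u2n v2n.
by field; rewrite w0n u1n v1n u2n v2n.
Qed.
End InfiniteProducts.
Arguments poch_cvg {R} x {q} q1.

(** * Theta series *)

Section Theta.
Variable R : realType.
Local Notation C := R[i].

Definition half (n : int) : C := n%:~R + 2^-1.
Definition rhalf (n : int) : R := n%:~R + 2^-1.

Lemma halfE n : half n = (rhalf n)%:C.
Proof. by rewrite rmorphD rmorph_int fmorphV rmorph_nat. Qed.

Lemma cabs_half n : cabs (half n) = `|rhalf n|.
Proof. by rewrite halfE cabs_real. Qed.

Definition thterm (z tau : C) (n : int) : C :=
  e2pi (half n ^+ 2 / 2 * tau + half n * (z + 2^-1)).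

Lemma thetaE z tau : theta z tau = sum (thterm z tau).
Proof. by congr sum; apply/funext => n; rewrite /thterm e2piD. Qed.

(** Completing the square compares the Gaussian with a geometric series. *)
Lemma gaussian_summ (al be : R) : 0 < al ->
  summ (fun n => expR (- al * rhalf n ^+ 2 + be * `|rhalf n|)).
Proof.
move=> al0.
pose K := expR ((be + 1) ^+ 2 / (4 * al) + 2^-1).
apply: (summ_le (g := fun n : int => K * expR (- 1) ^+ `|n|%N)).
  apply: summ_geo_int; first exact: expR_ge0.
  by rewrite expR_ge0 /= expR_lt1; lra.
move=> n; rewrite expR_ge0 /= -expRM_natr -expRD ler_expR.
set h := rhalf n.
have hn : (`|n|%N)%:R <= `|h| + 2^-1 :> R.
  rewrite pmulrn abszE intr_norm.
  have -> : n%:~R = h - 2^-1 :> R by rewrite /h /rhalf addrK.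
  apply: le_trans (ler_normB _ _) _.
  by rewrite [X in _ + X]ger0_norm ?invr_ge0.
rewrite -(real_normK (num_real h)); set x := `|h| in hn *.
suff : (be + 1) * x <= al * x ^+ 2 + (be + 1) ^+ 2 / (4 * al) by nra.
rewrite -subr_ge0.
have -> : al * x ^+ 2 + (be + 1) ^+ 2 / (4 * al) - (be + 1) * x
  = (2 * al * x - (be + 1)) ^+ 2 / (4 * al).
  by field; lra.
by rewrite divr_ge0 ?sqr_ge0//; lra.
Qed.

(** Weights of at most exponential growth, which the Gaussian decay absorbs. They
    are closed under products and contain the factors that differentiation brings
    down. *)
Definition weight (w : int -> C) :=
  exists c : R, forall n, cabs (w n) <= expR (c * (1 + `|rhalf n|)).

Lemma weight_cst a : weight (fun=> a).
Proof.
exists (cabs a) => n; apply: le_trans (expR_ge1Dx _).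
have := normr_ge0 (rhalf n); have := cabs_ge0 a; nra.
Qed.

Lemma weight_half : weight half.
Proof.
exists 1 => n; rewrite cabs_half mul1r.
by apply: le_trans (expR_ge1Dx _); have := normr_ge0 (rhalf n); lra.
Qed.

Lemma weightM w w' : weight w -> weight w' -> weight (fun n => w n * w' n).
Proof.
move=> [c hc] [c' hc']; exists (c + c') => n.
by rewrite cabsM mulrDl expRD ler_pM.
Qed.

Lemma cabs_thterm z tau n : cabs (thterm z tau n) =
  expR (- (pi * rhalf n ^+ 2 * complex.Im tau) - 2 * pi * rhalf n * complex.Im z).
Proof.
rewrite cabs_e2pi halfE; congr expR.
have -> : complex.Im ((rhalf n)%:C ^+ 2 / 2 * tau + (rhalf n)%:C * (z + 2^-1)) =
  rhalf n ^+ 2 / 2 * complex.Im tau + rhalf n * complex.Im z.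
  have -> : 2^-1 = (2^-1 : R)%:C :> C by rewrite fmorphV rmorph_nat.
  by case: z => a b; case: tau => c d; rewrite /= ; ring.
by field.
Qed.

Lemma thterm_dom w (v0 B : R) : weight w -> 0 < v0 ->
  exists2 g : int -> R, summ g & forall z tau n,
    `|complex.Im z| <= B -> v0 <= complex.Im tau ->
    cabs (w n * thterm z tau n) <= g n.
Proof.
move=> [c hc] v00.
exists (fun n => expR c * expR (- (pi * v0) * rhalf n ^+ 2 + (c + 2 * pi * B) * `|rhalf n|)).
  apply: summZ; first exact: expR_ge0.
  by apply: gaussian_summ; rewrite mulr_gt0// pi_gt0.
move=> z tau n hz ht; rewrite cabsM cabs_thterm.
apply: le_trans (ler_wpM2r (expR_ge0 _) (hc n)) _.
rewrite -!expRD ler_expR.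
have pi0 := @pi_gt0 R.
have h1 : v0 * rhalf n ^+ 2 <= complex.Im tau * rhalf n ^+ 2.
  by rewrite ler_wpM2r// sqr_ge0.
have h2 : - (rhalf n * complex.Im z) <= B * `|rhalf n|.
  apply: le_trans (ler_norm _) _; rewrite normrN normrM mulrC.
  by rewrite ler_wpM2r.
nra.
Qed.

Definition wtheta (w : int -> C) z tau := sum (fun n => w n * thterm z tau n).

Lemma wtheta_hsum w z tau : weight w -> 0 < complex.Im tau ->
  hsum (fun n => w n * thterm z tau n) (wtheta w z tau).
Proof.
move=> ww t0; have [g sg hg] := thterm_dom `|complex.Im z| ww t0.
have [|s hs] := @hsum_ex _ _ g (fun n => w n * thterm z tau n) sg.
  by move=> n; apply: hg.
by rewrite /wtheta (hsum_sum hs).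
Qed.

Arguments wtheta_hsum {w} z {tau} ww t0.

Lemma theta_wtheta z tau : theta z tau = wtheta (fun=> 1) z tau.
Proof. by rewrite thetaE; congr sum; apply/funext => n; rewrite mul1r. Qed.

Lemma theta_hsum z tau : 0 < complex.Im tau -> hsum (thterm z tau) (theta z tau).
Proof.
move=> t0; rewrite theta_wtheta; apply: eq_hsum (wtheta_hsum z (weight_cst 1) t0) => n.
by rewrite mul1r.
Qed.

Arguments theta_hsum z {tau} t0.

Lemma wtheta_bound w (v0 B : R) : weight w -> 0 < v0 -> exists M : R, 0 <= M /\
  forall z tau, cabs z <= B -> v0 <= complex.Im tau -> cabs (wtheta w z tau) <= M.
Proof.
move=> ww v00; have [g sg hg] := thterm_dom B ww v00.
have [g0 [M hM]] := sg; exists M; split; first by have := hM [::] isT; rewrite big_nil.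
move=> z tau zB tv; apply: (hsum_le _ hM (wtheta_hsum z ww (lt_le_trans v00 tv))) => n.
by apply: hg => //; apply: le_trans (Im_le_cabs z) zB.
Qed.

(** The weight of the termwise derivative in [z]; [dtw] below is the one in [tau]. *)
Definition dzw (w : int -> C) n := w n * (2 * pi%:C * 'i * half n).
Definition dtw (w : int -> C) n := w n * (pi%:C * 'i * half n * half n).

Lemma weight_dz w : weight w -> weight (dzw w).
Proof.
by move=> ww; apply: weightM => //; apply: weightM; [exact: weight_cst|exact: weight_half].
Qed.

Lemma weight_dt w : weight w -> weight (dtw w).
Proof.
move=> ww; apply: weightM => //; apply: weightM; last exact: weight_half.
by apply: weightM; [exact: weight_cst|exact: weight_half].
Qed.

Lemma thtermD z tau dz dt n : thterm (z + dz) (tau + dt) n =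
  thterm z tau n * cexp (2 * pi%:C * 'i * half n * dz + pi%:C * 'i * half n * half n * dt).
Proof.
rewrite /thterm.
have -> : half n ^+ 2 / 2 * (tau + dt) + half n * (z + dz + 2^-1) =
  (half n ^+ 2 / 2 * tau + half n * (z + 2^-1)) + (half n ^+ 2 / 2 * dt + half n * dz).
  by ring.
rewrite e2piD; congr (_ * _); by rewrite /e2pi; congr cexp; field.
Qed.

(** Termwise, a shift of [(z, tau)] multiplies by [cexp d] with [d] linear in the
    shift and quadratic in the index, so that the Taylor bound for the exponential
    applies. The factor [cexp d] costs at most a quarter of the Gaussian decay as
    long as [cabs dt <= v0 / 4]; the remaining three quarters dominate the sum. *)
Lemma wtheta_taylor w (v0 B : R) : weight w -> 0 < v0 -> exists M : R, 0 <= M /\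
  forall z tau dz dt, cabs z <= B -> cabs dz <= B -> v0 <= complex.Im tau ->
    cabs dt <= v0 / 4 ->
    cabs (wtheta w (z + dz) (tau + dt) - wtheta w z tau
      - (dz * wtheta (dzw w) z tau + dt * wtheta (dtw w) z tau))
    <= M * (cabs dz + cabs dt) ^+ 2.
Proof.
move=> ww v00; have [c hc] := ww.
have pi0 := @pi_gt0 R.
pose g n := 80 * pi ^+ 2 * expR c *
  expR (- (3 / 4 * pi * v0) * rhalf n ^+ 2 + (c + 4 + 4 * pi * B) * `|rhalf n|).
have sg : summ g.
  apply: summZ; first by rewrite mulr_ge0 ?expR_ge0// mulr_ge0 ?sqr_ge0.
  by apply: gaussian_summ; rewrite !mulr_gt0//; lra.
have [g0 [M hM]] := sg.
exists M; split; first by have := hM [::] isT; rewrite big_nil.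
move=> z tau dz dt hz hdz ht hdt.
have t0 : 0 < complex.Im tau by exact: lt_le_trans ht.
have t1 : 0 < complex.Im (tau + dt).
  have -> : complex.Im (tau + dt) = complex.Im tau + complex.Im dt.
    by case: (tau) (dt) => ? ? [].
  have := Im_le_cabs dt; rewrite ler_norml => /andP[+ _]; lra.
set e := cabs dz + cabs dt.
have hs := hsumD (hsumD (wtheta_hsum (z + dz) ww t1) (hsumN (wtheta_hsum z ww t0)))
  (hsumN (hsumD (hsumZ (c := dz) (wtheta_hsum z (weight_dz ww) t0))
                (hsumZ (c := dt) (wtheta_hsum z (weight_dt ww) t0)))).
have e0 : 0 <= e by rewrite addr_ge0.
rewrite [leRHS]mulrC; apply: (hsum_le (g := fun n => e ^+ 2 * g n) _ _ hs); last first.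
  by move=> r ur; rewrite -mulr_sumr ler_wpM2l ?sqr_ge0// hM.
move=> n; rewrite thtermD /dzw /dtw.
set d := (2 * pi%:C * 'i * half n * dz + _).
rewrite (_ : _ - _ = w n * thterm z tau n * (cexp d - 1 - d)); last by rewrite /d; ring.
set x := `|rhalf n|.
have x0 : 0 <= x by exact: normr_ge0.
have dE : cabs d <= 2 * pi * x * cabs dz + pi * x ^+ 2 * cabs dt.
  apply: le_trans (cabsD _ _) _.
  rewrite !cabsM cabs_i !cabs_real cabs_half cabs_nat (ger0_norm (ltW pi0)) -/x.
  by rewrite le_eqVlt; apply/orP; left; apply/eqP; ring.
have dz0 := cabs_ge0 dz; have dt0 := cabs_ge0 dt.
have d1 : cabs d <= 2 * pi * B * x + pi * v0 / 4 * x ^+ 2.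
  have p1 : 0 <= pi * x * (B - cabs dz).
    by apply: mulr_ge0; rewrite ?mulr_ge0 ?subr_ge0// ltW.
  have p2 : 0 <= pi * x ^+ 2 * (v0 / 4 - cabs dt).
    by apply: mulr_ge0; rewrite ?mulr_ge0 ?subr_ge0 ?sqr_ge0// ltW.
  by apply: le_trans dE _; lra.
have ex : x <= expR x by apply: le_trans (expR_ge1Dx x); lra.
have ex1 : 1 <= expR x by apply: le_trans (expR_ge1Dx x); lra.
have d2 : cabs d <= 4 * pi * expR x ^+ 2 * e.
  apply: le_trans dE _.
  have xx : x <= expR x ^+ 2.
    by apply: le_trans ex _; rewrite expr2 ler_peMr// (le_trans _ ex1).
  have xx2 : x ^+ 2 <= expR x ^+ 2 by rewrite lerXn2r ?nnegrE// ?expR_ge0.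
  have a1 : pi * x * cabs dz <= pi * expR x ^+ 2 * cabs dz.
    by rewrite ler_wpM2r// ler_wpM2l// ltW.
  have a2 : pi * x ^+ 2 * cabs dt <= pi * expR x ^+ 2 * cabs dt.
    by rewrite ler_wpM2r// ler_wpM2l// ltW.
  have a3 : 0 <= pi * expR x ^+ 2 * cabs dt.
    by rewrite !mulr_ge0 ?sqr_ge0// ltW.
  have a4 : 0 <= pi * expR x ^+ 2 * cabs dz.
    by rewrite !mulr_ge0 ?sqr_ge0// ltW.
  by rewrite /e; lra.
have d3 : cabs d ^+ 2 <= 16 * pi ^+ 2 * expR (4 * x) * e ^+ 2.
  have -> : 16 * pi ^+ 2 * expR (4 * x) * e ^+ 2 = (4 * pi * expR x ^+ 2 * e) ^+ 2.
    by rewrite expRM_natl; ring.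
  by rewrite lerXn2r ?nnegrE// (le_trans _ d2).
rewrite cabsM [X in X * _]cabsM cabs_thterm.
have T1 : expR (- (pi * rhalf n ^+ 2 * complex.Im tau) - 2 * pi * rhalf n * complex.Im z)
   <= expR (- (pi * v0 * x ^+ 2) + 2 * pi * B * x).
  rewrite ler_expR -(real_normK (num_real (rhalf n))) -/x.
  have h1 : pi * x ^+ 2 * v0 <= pi * x ^+ 2 * complex.Im tau.
    by rewrite ler_wpM2l// mulr_ge0 ?sqr_ge0// ltW.
  have h2 : - (rhalf n * complex.Im z) <= x * B.
    apply: le_trans (ler_norm _) _; rewrite normrN normrM ler_wpM2l//.
    exact: le_trans (Im_le_cabs z) hz.
  have h3 : pi * - (rhalf n * complex.Im z) <= pi * (x * B) by rewrite ler_wpM2l// ltW.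
  lra.
have T2 := cexp_taylor d.
have T3 : expR (cabs d) <= expR (2 * pi * B * x + pi * v0 / 4 * x ^+ 2) by rewrite ler_expR.
apply: (@le_trans _ _ (expR (c * (1 + x)) * expR (- (pi * v0 * x ^+ 2) + 2 * pi * B * x) *
   (5 * (16 * pi ^+ 2 * expR (4 * x) * e ^+ 2) * expR (2 * pi * B * x + pi * v0 / 4 * x ^+ 2)))).
  apply: ler_pM; rewrite ?mulr_ge0 ?expR_ge0//.
    by apply: ler_pM; rewrite ?expR_ge0//; exact: hc.
  apply: le_trans T2 _; apply: ler_pM; rewrite ?expR_ge0//.
    by rewrite mulr_ge0// sqr_ge0.
  by rewrite ler_pM2l.
rewrite /g -(real_normK (num_real (rhalf n))) -/x.
have -> : expR (c * (1 + x)) * expR (- (pi * v0 * x ^+ 2) + 2 * pi * B * x) *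
   (5 * (16 * pi ^+ 2 * expR (4 * x) * e ^+ 2) * expR (2 * pi * B * x + pi * v0 / 4 * x ^+ 2))
  = 80 * pi ^+ 2 * e ^+ 2 * (expR (c * (1 + x)) * expR (- (pi * v0 * x ^+ 2) + 2 * pi * B * x)
     * expR (4 * x) * expR (2 * pi * B * x + pi * v0 / 4 * x ^+ 2)) by ring.
rewrite -!expRD.
have -> : e ^+ 2 * (80 * pi ^+ 2 * expR c *
  expR (- (3 / 4 * pi * v0) * x ^+ 2 + (c + 4 + 4 * pi * B) * x)) =
  80 * pi ^+ 2 * e ^+ 2 * (expR c *
  expR (- (3 / 4 * pi * v0) * x ^+ 2 + (c + 4 + 4 * pi * B) * x)) by ring.
rewrite -expRD; apply: ler_wpM2l.
  by rewrite mulr_ge0 ?sqr_ge0// mulr_ge0 ?sqr_ge0.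
rewrite ler_expR.
by rewrite le_eqVlt; apply/orP; left; apply/eqP; field.
Qed.

End Theta.
Arguments theta_hsum {R} z {tau} t0.
Arguments wtheta_hsum {R w} z {tau} ww t0.

(** * Quasi-periods, product and derivative of theta *)

Section ThetaProperties.
Variable R : realType.
Local Notation C := R[i].

Lemma Im_add (x y : C) : complex.Im (x + y) = complex.Im x + complex.Im y.
Proof. by case: x y => ? ? []. Qed.

Lemma Im_opp (x : C) : complex.Im (- x) = - complex.Im x.
Proof. by case: x. Qed.

Lemma Im_realM (r : R) (x : C) : complex.Im (r%:C * x) = r * complex.Im x.
Proof. by case: x => a b /=; ring. Qed.

Lemma Im_intM (n : int) (x : C) : complex.Im (n%:~R * x) = n%:~R * complex.Im x.
Proof. by rewrite -(rmorph_int (real_complex R)) Im_realM. Qed.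

Lemma Im3M (x : C) : complex.Im (3 * x) = 3 * complex.Im x.
Proof. by rewrite -[3]/(3%:~R : C) Im_intM. Qed.

Lemma Im_int (n : int) : complex.Im (n%:~R : C) = 0.
Proof. by rewrite -(rmorph_int (real_complex R)). Qed.

Lemma cabs_q_lt1 (tau : C) : 0 < complex.Im tau -> cabs (e2pi tau) < 1.
Proof. by move=> t0; rewrite cabs_e2pi expR_lt1 oppr_lt0 !mulr_gt0// pi_gt0. Qed.

Lemma half_add n l : half R (n + l) = half R n + l%:~R.
Proof. by rewrite /half intrD; ring. Qed.

(** The factor arises from the shift of the summation index by [l]. *)
Lemma theta_quasi (l m : int) (z tau : C) : 0 < complex.Im tau ->
  theta (z + l%:~R * tau + m%:~R) tau =
  (-1) ^ (l + m) * e2pi (- (l%:~R ^+ 2 / 2 * tau) - l%:~R * z) * theta z tau.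
Proof.
move=> t0.
have h := hsum_reindex (f := fun n => n + l) (g := fun n => n - l)
  (addrK l) (subrK l) (theta_hsum z t0).
have := hsumZ (c := (-1) ^ (l + m) * e2pi (- (l%:~R ^+ 2 / 2 * tau) - l%:~R * z)) h.
apply: hsum_unique; apply: eq_hsum (theta_hsum _ t0) => n /=.
rewrite /thterm half_add -e2pi_half -e2piMz -!e2piD.
have -> : half R n ^+ 2 / 2 * tau + half R n * (z + l%:~R * tau + m%:~R + 2^-1) =
  (n * m - l)%:~R + ((l + m)%:~R * 2^-1 + (- (l%:~R ^+ 2 / 2 * tau) - l%:~R * z) +
  ((half R n + l%:~R) ^+ 2 / 2 * tau + (half R n + l%:~R) * (z + 2^-1))).
  by rewrite intrB intrM intrD /half; field.
by rewrite [in LHS]e2piD e2pi_int mul1r.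
Qed.

(** The terms satisfy the recursion of the triple product for [a = e(z)] and
    [q = e(tau)]; the index is shifted so that [c 0] is the term at [- 1 / 2]. *)
Lemma theta_prod (z tau : C) : 0 < complex.Im tau ->
  theta z tau = - 'i * e2pi (tau / 8) * e2pi (- (z / 2)) *
   (pochoo (e2pi z) (e2pi tau) * pochoo (e2pi tau / e2pi z) (e2pi tau)
    * pochoo (e2pi tau) (e2pi tau)).
Proof.
move=> t0.
pose c n := thterm z tau (n - 1).
have hs : hsum c (theta z tau).
  by apply: (hsum_reindex (f := fun n : int => n - 1) (g := fun n : int => n + 1)
    (subrK 1) (addrK 1) (theta_hsum z t0)).
have sc : summ (fun n => cabs (c n)).
  have [g sg hg] := thterm_dom `|complex.Im z| (weight_cst 1) t0.
  have inj : injective (fun n : int => n - 1) by move=> i j /addIr.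
  apply: (summ_le (summ_comp inj sg)) => n /=.
  by rewrite cabs_ge0/= /c; have := hg z tau (n - 1) (lexx _) (lexx _); rewrite mul1r.
have hc n : c (n + 1) = - e2pi z * e2pi tau ^ n * c n.
  rewrite /c /thterm addrK -e2piMz -[- e2pi z]mulN1r -e2pi_half -!e2piD.
  have -> : half R n = half R (n - 1) + 1 by rewrite half_add mulrN1z subrK.
  congr e2pi; have -> : n%:~R = half R (n - 1) + 2^-1 :> C.
    by rewrite half_add mulrN1z /half; field.
  by field.
rewrite (triple_product (e2pi_neq0 tau) (cabs_q_lt1 t0) (e2pi_neq0 z) hc sc hs).
have -> : c 0 = - 'i * e2pi (tau / 8) * e2pi (- (z / 2)).
  have -> : - 'i = e2pi (- 4^-1) :> C.
    rewrite e2piN e2pi_quarter; apply: (mulIf (i_neq0 R)).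
    by rewrite mulVf ?i_neq0// mulNr -expr2 sqr_i opprK.
  rewrite /c sub0r /thterm -!e2piD; congr e2pi.
  by rewrite /half mulrN1z; field.
by rewrite !mulrA.
Qed.

Lemma eta_pochoo (tau : C) : 0 < complex.Im tau ->
  eta tau = e2pi (tau / 24) * pochoo (e2pi tau) (e2pi tau).
Proof.
move=> t0; rewrite /eta; set F := (F in lim (F @ _)).
suff -> : F = poch (e2pi tau) (e2pi tau) by [].
rewrite /F; apply/funext => n; rewrite /poch -(big_mkord predT (fun j => 1 - e2pi tau * e2pi tau ^+ j)).
by rewrite big_add1 /=; apply: eq_bigr => i _; rewrite exprS.
Qed.

Lemma theta0 (tau : C) : 0 < complex.Im tau -> theta 0 tau = 0.
Proof.
move=> t0; rewrite theta_prod// e2pi0 (pochooSl 1 (cabs_q_lt1 t0)) subrr.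
by rewrite !(mul0r, mulr0).
Qed.

(** In this strip, all arguments of the infinite products lie in the open unit
    disc. *)
Lemma theta_neq0_strip (z tau : C) : 0 < complex.Im z < complex.Im tau -> theta z tau != 0.
Proof.
move=> /andP[z0 zt]; have t0 := lt_trans z0 zt; have q1 := cabs_q_lt1 t0.
have i0 : - 'i != 0 :> C by rewrite oppr_eq0 i_neq0.
have p0 : pochoo (e2pi z) (e2pi tau) != 0 by rewrite pochoo_neq0 ?cabs_q_lt1.
have p1 : pochoo (e2pi tau / e2pi z) (e2pi tau) != 0.
  rewrite pochoo_neq0// -e2piN -e2piD; apply: cabs_q_lt1; rewrite Im_add Im_opp; lra.
have p2 : pochoo (e2pi tau) (e2pi tau) != 0 by rewrite pochoo_neq0.
rewrite theta_prod//; apply: mulf_neq0 (mulf_neq0 (mulf_neq0 p0 p1) p2).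
exact: (mulf_neq0 (mulf_neq0 i0 (e2pi_neq0 _)) (e2pi_neq0 _)).
Qed.

Lemma floor_strip (v y : R) : 0 < v -> (forall n : int, y <> n%:~R * v) ->
  exists n : int, 0 < y - n%:~R * v < v.
Proof.
move=> v0 hy; exists (Num.floor (y / v)).
have := floor_itv (y / v) => /andP[].
rewrite ler_pdivlMr// ltr_pdivrMr// intrD mulrDl mul1r => h1 h2.
apply/andP; split; last by lra.
rewrite lt_def subr_ge0 h1 andbT subr_eq0.
by apply/eqP; apply: hy.
Qed.

Lemma theta_neq0 (z tau : C) : 0 < complex.Im tau ->
  (forall n : int, complex.Im z <> n%:~R * complex.Im tau) -> theta z tau != 0.
Proof.
move=> t0 /(floor_strip t0)[n hn].
have -> : z = (z - n%:~R * tau) + n%:~R * tau + (0 : int)%:~R.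
  by rewrite mulr0z addr0 subrK.
rewrite theta_quasi//; apply: mulf_neq0.
  by apply: mulf_neq0 (e2pi_neq0 _); rewrite expfz_neq0// oppr_eq0 oner_eq0.
by apply: theta_neq0_strip; rewrite Im_add Im_opp Im_intM.
Qed.

Lemma cvg_of_bound (u : nat -> C) (l : C) (M : R) :
  (forall n, cabs (u n - l) <= M / n.+1%:R) -> u @ \oo --> l.
Proof.
move=> h; apply/ccvgP => e e0.
have [N hN] : exists N : nat, M / e < N%:R.
  exists (Num.bound (M / e)); have [M0|M0] := leP 0 (M / e).
    exact: archi_boundP.
  by apply: lt_le_trans M0 _.
exists N => // n /= Nn; apply: le_lt_trans (h n) _.
rewrite ltr_pdivrMr// mulrC -ltr_pdivrMr//.
by apply: lt_le_trans hN _; rewrite ler_nat leqW.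
Qed.

Definition theta_deriv0 (tau : C) : C := wtheta (dzw (fun=> 1)) 0 tau.

Definition recip (N : nat) : C := ((N.+1%:R)^-1 : R)%:C.

Lemma cabs_recip N : cabs (recip N) = (N.+1%:R)^-1.
Proof. by rewrite cabs_real ger0_norm ?invr_ge0. Qed.

Lemma recip_le1 N : cabs (recip N) <= 1.
Proof. by rewrite cabs_recip invf_le1 ?ltr0n// ler1n. Qed.

Lemma recip_neq0 N : recip N != 0.
Proof. by rewrite -cabs_gt0 cabs_recip invr_gt0. Qed.

(** A derivative along a single sequence; this suffices to compare the derivatives
    of two expressions for the same function. *)
Lemma theta_deriv0_cvg (a tau : C) : 0 < complex.Im tau ->
  (fun N => theta (a * recip N) tau / recip N) @ \oo --> a * theta_deriv0 tau.
Proof.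
move=> t0.
have [M [M0 hM]] := wtheta_taylor (cabs a) (weight_cst (1 : C)) t0.
apply: (cvg_of_bound (M := M * cabs a ^+ 2)) => N.
have aN : cabs (a * recip N) <= cabs a by rewrite cabsM ler_piMr// recip_le1.
have := hM 0 tau (a * recip N) 0; rewrite cabs0 addr0 -!theta_wtheta theta0// subr0 add0r.
rewrite mul0r !addr0.
have v4 : 0 <= complex.Im tau / 4 by rewrite divr_ge0// ltW.
move=> /(_ (cabs_ge0 a) aN (lexx _) v4) h.
have x0 := recip_neq0 N.
have -> : theta (a * recip N) tau / recip N - a * theta_deriv0 tau =
  (theta (a * recip N) tau - a * recip N * theta_deriv0 tau) / recip N by field.
rewrite cabsM cabsV ler_pdivrMr ?cabs_gt0//; apply: le_trans h _.
by rewrite cabsM -cabs_recip le_eqVlt; apply/orP; left; apply/eqP; ring.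
Qed.

(** Jacobi's derivative formula. In the product for [theta x], divided by [x], the
    factor [1 - e(x)] gives [- 2 pi i], and what remains of the infinite products
    tends to [(q)_oo ^ 3]. *)
Lemma theta_deriv0_eta (tau : C) : 0 < complex.Im tau ->
  theta_deriv0 tau = - (2 * pi%:C) * eta tau ^+ 3.
Proof.
move=> t0; have q1 := cabs_q_lt1 t0; set q := e2pi tau in q1 *.
have pi0 := @pi_gt0 R.
pose x := recip.
have cx N : cabs (x N) = (N.+1%:R)^-1 by exact: cabs_recip.
have x1 N : cabs (x N) <= 1 by exact: recip_le1.
have x0 N : x N != 0 by exact: recip_neq0.
have lim1 : (fun N => theta (x N) tau / x N) @ \oo --> theta_deriv0 tau.
  pose proof (theta_deriv0_cvg (a := 1 : C) t0) as h; rewrite mul1r in h.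
  by apply: (ccvg_ext _ h) => N; rewrite mul1r.
(* the factors e(- x / 2) and 1 - e(x) of the product, divided by x *)
pose s (N : nat) := (e2pi (- (x N / 2)) - e2pi (x N / 2)) / x N.
have lim2 : s @ \oo --> - (2 * pi%:C * 'i).
  apply: (cvg_of_bound (M := 10 * pi ^+ 2 * expR pi)) => N.
  set w := pi%:C * 'i * x N.
  have -> : s N - - (2 * pi%:C * 'i) =
     ((cexp (- w) - 1 - - w) - (cexp w - 1 - w)) / x N.
    rewrite /s /e2pi.
    have -> : 2 * pi%:C * 'i * (x N / 2) = w by rewrite /w; field.
    have -> : 2 * pi%:C * 'i * - (x N / 2) = - w by rewrite /w; field.
    by rewrite /w; field.
  have cw : cabs w = pi * cabs (x N).
    by rewrite !cabsM cabs_i cabs_real mulr1 ger0_norm// ltW.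
  rewrite cabsM cabsV -cx ler_pdivrMr ?cabs_gt0//.
  apply: le_trans (cabsB _ _) _.
  have h1 := cexp_taylor w; have h2 := cexp_taylor (- w); rewrite cabsN in h2.
  have h3 : expR (cabs w) <= expR pi.
    by rewrite ler_expR cw ler_piMr// ltW.
  have h4 : 5 * cabs w ^+ 2 * expR (cabs w) <= 5 * cabs w ^+ 2 * expR pi.
    by rewrite ler_wpM2l// mulr_ge0// sqr_ge0.
  have h5 : 5 * cabs w ^+ 2 * expR pi = 5 * pi ^+ 2 * expR pi * cabs (x N) * cabs (x N).
    by rewrite cw; ring.
  by lra.
have limz : (fun N => e2pi (x N)) @ \oo --> (1 : C).
  apply: (cvg_of_bound (M := 2 * pi + 20 * pi ^+ 2 * expR (2 * pi))) => N.
  set w := 2 * pi%:C * 'i * x N.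
  have -> : e2pi (x N) - 1 = w + (cexp w - 1 - w) by rewrite /e2pi; ring.
  have cw : cabs w = 2 * pi * cabs (x N).
    by rewrite !cabsM cabs_i cabs_real cabs_nat mulr1 ger0_norm// ltW.
  apply: le_trans (cabsD _ _) _; rewrite -cx.
  have h1 := cexp_taylor w.
  have h3 : expR (cabs w) <= expR (2 * pi).
    by rewrite ler_expR cw ler_piMr// mulr_ge0// ltW.
  have h4 : 5 * cabs w ^+ 2 * expR (cabs w) <= 5 * cabs w ^+ 2 * expR (2 * pi).
    by rewrite ler_wpM2l// mulr_ge0// sqr_ge0.
  have h5 : 5 * cabs w ^+ 2 * expR (2 * pi) = 20 * pi ^+ 2 * expR (2 * pi) * cabs (x N) * cabs (x N).
    by rewrite cw; ring.
  have h6 : 20 * pi ^+ 2 * expR (2 * pi) * cabs (x N) * cabs (x N) <=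
            20 * pi ^+ 2 * expR (2 * pi) * cabs (x N).
    by rewrite ler_piMr// mulr_ge0// mulr_ge0 ?expR_ge0// mulr_ge0 ?sqr_ge0.
  lra.
have cz N : cabs (e2pi (x N)) = 1 by rewrite cabs_e2pi /x /= mulr0 oppr0 expR0.
have limp (y : nat -> C) : (forall N, cabs (y N) = cabs q) -> y @ \oo --> q ->
  (fun N => pochoo (y N) q) @ \oo --> pochoo q q.
  move=> hy /ccvgP yq; apply/ccvgP => e e0.
  set K := expR (cabs q / (1 - cabs q)) * expR (cabs q / (1 - cabs q)) / (1 - cabs q).
  have K0 : 0 < K by rewrite divr_gt0 ?mulr_gt0 ?expR_gt0//; lra.
  have /yq : 0 < e / K by rewrite divr_gt0.
  apply: filterS => N hN.
  apply: le_lt_trans (pochoo_lip (y N) q q1) _; rewrite hy -/K.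
  by rewrite -ltr_pdivlMr.
have limA : (fun N => pochoo (e2pi (x N) * q) q) @ \oo --> pochoo q q.
  apply: limp => [N|]; first by rewrite cabsM cz mul1r.
  by rewrite -{2}[q]mul1r; exact: (ccvgM limz (ccvg_cst (a := q))).
have limB : (fun N => pochoo (q / e2pi (x N)) q) @ \oo --> pochoo q q.
  apply: limp => [N|]; first by rewrite cabsM cabsV cz invr1 mulr1.
  by rewrite -{2}[q]divr1; exact: (ccvgM (ccvg_cst (a := q)) (ccvgV (oner_neq0 _) limz)).
have lim3 := ccvgZ (b := - 'i * e2pi (tau / 8) * pochoo q q) (ccvgM lim2 (ccvgM limA limB)).
apply: (ccvg_unique lim1).
rewrite (_ : - (2 * pi%:C) * _ = - 'i * e2pi (tau / 8) * pochoo q q *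
   (- (2 * pi%:C * 'i) * (pochoo q q * pochoo q q))); last first.
  rewrite eta_pochoo// -/q exprMn -e2piMn.
  have -> : 3%:R * (tau / 24) = tau / 8 by field.
  have -> : - 'i * e2pi (tau / 8) * pochoo q q * (- (2 * pi%:C * 'i) * (pochoo q q * pochoo q q))
    = 'i ^+ 2 * (2 * pi%:C * e2pi (tau / 8) * pochoo q q ^+ 3) by ring.
  by rewrite sqr_i; ring.
rewrite (_ : (fun N => _) = fun N => - 'i * e2pi (tau / 8) * pochoo q q *
   (s N * (pochoo (e2pi (x N) * q) q * pochoo (q / e2pi (x N)) q))); first exact: lim3.
apply/funext => N; rewrite theta_prod// -/q pochooSl//.
have E : e2pi (- (x N / 2)) * (1 - e2pi (x N)) = e2pi (- (x N / 2)) - e2pi (x N / 2).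
  by rewrite mulrBr mulr1 -e2piD; congr (_ - e2pi _); field.
by rewrite /s -E; ring.
Qed.

End ThetaProperties.
Arguments theta_deriv0_cvg {R} a {tau} t0.

(** * Entire functions *)

Section EntireFunctions.
Variable R : realType.
Local Notation C := R[i].
Implicit Types (f g : C -> C).

(** Entire functions, in the form of a complex first order Taylor expansion with an
    error that is quadratic uniformly on discs. This is all that the discrete
    Fourier analysis below needs of holomorphy. *)
Definition tame f := exists f' : C -> C, forall B : R, exists2 M : R, 0 <= M &
  forall z h, cabs z <= B -> cabs h <= B ->
    [/\ cabs (f z) <= M, cabs (f' z) <= M &
      cabs (f (z + h) - f z - h * f' z) <= M * cabs h ^+ 2].

Lemma tame_cst (a : C) : tame (fun=> a).
Proof.
exists (fun=> 0) => B; exists (cabs a) => // z h _ _.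
by split; rewrite ?cabs0// mulr0 subrr subr0 cabs0 mulr_ge0// sqr_ge0.
Qed.

Lemma tame_id : tame id.
Proof.
exists (fun=> 1) => B; exists (`|B| + 1); first by rewrite addr_ge0.
move=> z h zB hB; split.
- by apply: le_trans zB _; rewrite (le_trans (ler_norm _))// lerDl.
- by rewrite cabs1 lerDr.
by rewrite mulr1 [z + h]addrC addrK subrr cabs0 mulr_ge0 ?sqr_ge0// addr_ge0.
Qed.

Lemma tameM f g : tame f -> tame g -> tame (fun z => f z * g z).
Proof.
move=> [f' hf] [g' hg]; exists (fun z => f' z * g z + f z * g' z) => B.
have [M M0 hM] := hf (`|B| + `|B|); have [N N0 hN] := hg (`|B| + `|B|).
exists (M * N * (4 + `|B|)); first by rewrite !mulr_ge0// addr_ge0.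
move=> z h zB hB.
have BB := ler_norm B; have B0 := normr_ge0 B.
have zB2 : cabs z <= `|B| + `|B| by lra.
have hB2 : cabs h <= `|B| + `|B| by lra.
have zhB2 : cabs (z + h) <= `|B| + `|B| by apply: le_trans (cabsD _ _) _; lra.
have [f1 f2 f3] := hM z h zB2 hB2; have [g1 g2 g3] := hN z h zB2 hB2.
have [f4 _ _] := hM (z + h) h zhB2 hB2.
have MN : 0 <= M * N by rewrite mulr_ge0.
have MNB : 0 <= M * N * `|B| by rewrite mulr_ge0.
have h1 : cabs (f z * g z) <= M * N by rewrite cabsM ler_pM.
have h2 : cabs (f' z * g z) <= M * N by rewrite cabsM ler_pM.
have h3 : cabs (f z * g' z) <= M * N by rewrite cabsM ler_pM.
split; first by lra.
  by apply: le_trans (cabsD _ _) _; lra.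
set r := f (z + h) - f z - h * f' z in f3.
set s := g (z + h) - g z - h * g' z in g3.
have -> : f (z + h) * g (z + h) - f z * g z - h * (f' z * g z + f z * g' z) =
  h ^+ 2 * (f' z * g' z) + (s * f (z + h) + r * (g z + h * g' z)) by rewrite /r /s; ring.
have H0 : 0 <= cabs h ^+ 2 by apply: sqr_ge0.
have h4 : cabs (h ^+ 2 * (f' z * g' z)) <= cabs h ^+ 2 * (M * N).
  by rewrite cabsM cabsX ler_wpM2l// cabsM ler_pM.
have h5 : cabs (s * f (z + h)) <= N * cabs h ^+ 2 * M by rewrite cabsM ler_pM.
have h6 : cabs (g z + h * g' z) <= N + `|B| * N.
  apply: le_trans (cabsD _ _) _; apply: lerD => //.
  by rewrite cabsM ler_pM//; lra.
have h7 : cabs (r * (g z + h * g' z)) <= M * cabs h ^+ 2 * (N + `|B| * N).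
  by rewrite cabsM ler_pM.
have h8 : 0 <= M * N * cabs h ^+ 2 by rewrite mulr_ge0.
apply: le_trans (cabsD _ _) _.
apply: le_trans (lerD (lexx _) (cabsD _ _)) _; lra.
Qed.

Lemma tameZ (a : C) f : tame f -> tame (fun z => a * f z).
Proof. by move=> hf; apply: tameM => //; exact: tame_cst. Qed.

Lemma tame_scale (a : C) f : tame f -> tame (fun z => f (a * z)).
Proof.
move=> [f' hf]; exists (fun z => a * f' (a * z)) => B.
have [M M0 hM] := hf (cabs a * B).
have A0 := cabs_ge0 a.
exists (M * (1 + cabs a + cabs a ^+ 2)).
  by rewrite mulr_ge0// !addr_ge0// sqr_ge0.
move=> z h zB hB.
have az : cabs (a * z) <= cabs a * B by rewrite cabsM ler_wpM2l.
have ah : cabs (a * h) <= cabs a * B by rewrite cabsM ler_wpM2l.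
have [h1 h2 h3] := hM _ _ az ah.
have a1 : 0 <= M * cabs a by rewrite mulr_ge0.
have a2 : 0 <= M * cabs a ^+ 2 by rewrite mulr_ge0// sqr_ge0.
split; first by lra.
  rewrite cabsM; apply: le_trans (ler_wpM2l A0 h2) _; lra.
have -> : f (a * (z + h)) - f (a * z) - h * (a * f' (a * z)) =
  f (a * z + a * h) - f (a * z) - (a * h) * f' (a * z) by rewrite -mulrDr; ring.
apply: le_trans h3 _; rewrite cabsM exprMn mulrA ler_wpM2r ?sqr_ge0//; lra.
Qed.

Lemma cabs_cexp_le (z : C) : cabs (cexp z) <= expR (cabs z).
Proof. by rewrite cabs_cexp ler_expR; apply: le_trans (ler_norm _) (Re_le_cabs z). Qed.

Lemma tame_cexp f : tame f -> tame (fun z => cexp (f z)).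
Proof.
move=> [f' hf]; exists (fun z => f' z * cexp (f z)) => B.
have [M M0 hM] := hf (`|B| + `|B|).
have BB := ler_norm B; have B0 := normr_ge0 B.
pose K := expR M * (5 * (M * (1 + `|B|)) ^+ 2 * expR (M + M) + M).
have K0 : 0 <= K by rewrite mulr_ge0 ?expR_ge0// addr_ge0// mulr_ge0 ?expR_ge0// mulr_ge0// sqr_ge0.
exists (expR M + M * expR M + K).
  by apply: addr_ge0 => //; rewrite addr_ge0 ?mulr_ge0 ?expR_ge0.
move=> z h zB hB.
have zB2 : cabs z <= `|B| + `|B| by lra.
have hB2 : cabs h <= `|B| + `|B| by lra.
have zhB2 : cabs (z + h) <= `|B| + `|B| by apply: le_trans (cabsD _ _) _; lra.
have [f1 f2 f3] := hM z h zB2 hB2.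
have [f4 _ _] := hM (z + h) h zhB2 hB2.
have e0 := expR_ge0 M.
have Me0 : 0 <= M * expR M by rewrite mulr_ge0.
have E1 : cabs (cexp (f z)) <= expR M.
  by apply: le_trans (cabs_cexp_le _) _; rewrite ler_expR.
split; first by lra.
  by rewrite cabsM; have := ler_pM (cabs_ge0 _) (cabs_ge0 _) f2 E1; lra.
set d := f (z + h) - f z.
have -> : cexp (f (z + h)) - cexp (f z) - h * (f' z * cexp (f z)) =
   cexp (f z) * ((cexp d - 1 - d) + (d - h * f' z)).
  have -> : f (z + h) = f z + d by rewrite /d; ring.
  by rewrite cexpD; ring.
have d1 : cabs d <= M + M by apply: le_trans (cabsB _ _) _; lra.
have H0 := cabs_ge0 h.
have d2 : cabs d <= M * (1 + `|B|) * cabs h.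
  have -> : d = h * f' z + (d - h * f' z) by ring.
  apply: le_trans (cabsD _ _) _; rewrite cabsM.
  have a1 : cabs h * cabs (f' z) <= cabs h * M by rewrite ler_wpM2l.
  have a2 : M * cabs h * cabs h <= M * cabs h * `|B|.
    by rewrite ler_wpM2l ?mulr_ge0//; lra.
  by rewrite /d; lra.
have T := cexp_taylor d.
have T2 : 5 * cabs d ^+ 2 * expR (cabs d) <= 5 * (M * (1 + `|B|) * cabs h) ^+ 2 * expR (M + M).
  apply: ler_pM; rewrite ?expR_ge0 ?ler_expR//.
    by rewrite mulr_ge0// sqr_ge0.
  rewrite ler_pM2l// lerXn2r ?nnegrE//; by apply: le_trans d2.
rewrite cabsM.
apply: (@le_trans _ _ (expR M * (5 * (M * (1 + `|B|) * cabs h) ^+ 2 * expR (M + M) + M * cabs h ^+ 2))).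
  apply: ler_pM => //; apply: le_trans (cabsD _ _) _; rewrite -/d in f3; lra.
have H2 : 0 <= cabs h ^+ 2 by apply: sqr_ge0.
have -> : expR M * (5 * (M * (1 + `|B|) * cabs h) ^+ 2 * expR (M + M) + M * cabs h ^+ 2) =
  K * cabs h ^+ 2 by rewrite /K; ring.
by rewrite ler_wpM2r//; lra.
Qed.

Lemma tame_e2pi (a : C) : tame (fun z => e2pi (a * z)).
Proof. by apply: tame_cexp; apply: tameZ; apply: tameZ; exact: tame_id. Qed.

Lemma tame_theta (tau : C) : 0 < complex.Im tau -> tame (fun z => theta z tau).
Proof.
move=> t0; exists (fun z => wtheta (dzw (fun=> 1)) z tau) => B.
have w1 := weight_cst (1 : C).
have [M [M0 hM]] := wtheta_taylor B w1 t0.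
have [M1 [M10 hM1]] := wtheta_bound B w1 t0.
have [M2 [M20 hM2]] := wtheta_bound B (weight_dz w1) t0.
exists (M + M1 + M2); first by rewrite !addr_ge0.
move=> z h zB hB; rewrite !theta_wtheta.
have v4 : 0 <= complex.Im tau / 4 by rewrite divr_ge0// ltW.
have := hM z tau h 0 zB hB (lexx _); rewrite cabs0 !addr0 => /(_ v4).
rewrite mul0r addr0 => h1.
have h2 := hM1 z tau zB (lexx _); have h3 := hM2 z tau zB (lexx _).
split; [lra|lra|apply: le_trans h1 _].
by rewrite ler_wpM2r ?sqr_ge0//; lra.
Qed.

End EntireFunctions.

(** * Averages over a period *)

Section PeriodAverages.
Variable R : realType.
Local Notation C := R[i].

(** The number of points of a period is odd so that the same number of frequencies
    fills the symmetric interval from [- N] to [N]. *)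
Definition odd1 (N : nat) := (N + N).+1.
Definition step (N : nat) : C := ((odd1 N)%:R)^-1.
Definition avg (F : C -> C) (N : nat) (w : C) : C :=
  step N * \sum_(j < odd1 N) F (w + j%:R * step N).

Lemma odd1_neq0 N : (odd1 N)%:R != 0 :> C.
Proof. by rewrite pnatr_eq0. Qed.

Lemma odd1_step N : (odd1 N)%:R * step N = 1.
Proof. by rewrite mulfV// odd1_neq0. Qed.

Lemma cabs_step N : cabs (step N) = ((odd1 N)%:R)^-1.
Proof. by rewrite cabsV cabs_nat. Qed.

Lemma cabs_step_le N : cabs (step N) <= (N.+1%:R)^-1.
Proof. by rewrite cabs_step lef_pV2 ?posrE ?ltr0n// ler_nat ltnS leq_addr. Qed.

Lemma cabs_step_le1 N : cabs (step N) <= 1.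
Proof. by rewrite cabs_step invf_le1 ?ltr0n// ler1n. Qed.

Lemma cabs_grid N (j : nat) : (j <= odd1 N)%N -> cabs (j%:R * step N) <= 1.
Proof.
move=> jN; rewrite cabsM cabs_nat cabs_step ler_pdivrMr ?ltr0n// mul1r.
by rewrite ler_nat.
Qed.

Lemma cyclic_sum (V : zmodType) (v : nat -> V) n : v n = v 0 ->
  \sum_(j < n) v j.+1 = \sum_(j < n) v j.
Proof.
case: n => [|n] h; first by rewrite !big_ord0.
by rewrite big_ord_recr [in RHS]big_ord_recl /= h addrC.
Qed.

(** A discrete version of Cauchy's theorem for a periodic strip: the averages of a
    holomorphic periodic function do not depend on the base point in the limit.
    The grid moves from [w] to [w + v] in as many steps as it has points. In one
    step, the increment in the direction [v] is [v] times the increment along the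
    grid, up to a quadratic error, because the derivative is complex linear; and
    the increments along the grid telescope to zero by periodicity. *)
Lemma avg_shift (F : C -> C) (w v : C) : tame F -> (forall z, F (z + 1) = F z) ->
  (fun N => avg F N (w + v) - avg F N w) @ \oo --> (0 : C).
Proof.
move=> [F' hF] perF.
have [M M0 hM] := hF (cabs w + cabs v + 1).
have W0 := cabs_ge0 w; have V0 := cabs_ge0 v.
pose K := M * (cabs v ^+ 2 + cabs v).
have K0 : 0 <= K by rewrite mulr_ge0// addr_ge0// sqr_ge0.
apply: (cvg_of_bound (M := K)) => N; rewrite subr0.
set P := odd1 N; set h := step N.
have H0 := cabs_ge0 h; have H1 : cabs h <= 1 := cabs_step_le1 N.
(* the sum over the grid after i of the P steps from w to w + v *)
pose S i := \sum_(j < P) F (w + i%:R * h * v + j%:R * h).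
have PH : P%:R * cabs h = 1 by rewrite /h cabs_step mulfV// pnatr_eq0.
have stepS i : (i < P)%N -> cabs (S i.+1 - S i) <= K * cabs h.
  move=> iP.
  pose x j := w + i%:R * h * v + j%:R * h.
  have tel : \sum_(j < P) (F (x j + h) - F (x j)) = 0.
    rewrite sumrB; apply/eqP; rewrite subr_eq0; apply/eqP.
    rewrite -(cyclic_sum (v := fun j => F (x j))).
      by apply: eq_bigr => j _; congr F; rewrite /x -natr1; ring.
    by rewrite /x mul0r addr0 odd1_step perF.
  have -> : S i.+1 - S i =
     \sum_(j < P) (F (x j + v * h) - F (x j) - v * (F (x j + h) - F (x j))).
    rewrite sumrB -mulr_sumr tel mulr0 subr0 sumrB; congr (_ - _).
    by apply: eq_bigr => j _; congr F; rewrite /x -natr1; ring.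
  apply: le_trans (cabs_sum _ _ _) _.
  have -> : K * cabs h = \sum_(j < P) K * cabs h ^+ 2.
    rewrite sumr_const card_ord -mulr_natl.
    by transitivity (K * cabs h * (P%:R * cabs h)); [rewrite PH mulr1|ring].
  apply: ler_sum => j _.
  have xB : cabs (x j) <= cabs w + cabs v + 1.
    apply: le_trans (cabsD _ _) _; apply: lerD; last first.
      by apply: cabs_grid; rewrite ltnW.
    apply: le_trans (cabsD _ _) _; apply: lerD => //.
    by rewrite cabsM ler_piMl// cabs_grid// ltnW.
  have hB : cabs h <= cabs w + cabs v + 1 by lra.
  have vhB : cabs (v * h) <= cabs w + cabs v + 1.
    rewrite cabsM; have : cabs v * cabs h <= cabs v by rewrite ler_piMr.
    lra.
  have [_ _ h1] := hM _ _ xB hB; have [_ _ h2] := hM _ _ xB vhB.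
  have -> : F (x j + v * h) - F (x j) - v * (F (x j + h) - F (x j)) =
    (F (x j + v * h) - F (x j) - v * h * F' (x j)) -
    v * (F (x j + h) - F (x j) - h * F' (x j)) by ring.
  apply: le_trans (cabsB _ _) _; rewrite [X in _ + X]cabsM.
  have h3 := ler_wpM2l V0 h1; rewrite [in X in _ <= X](cabsM v) exprMn in h2.
  by rewrite /K; lra.
have tot i : (i <= P)%N -> cabs (S i - S 0) <= i%:R * (K * cabs h).
  elim: i => [|i IH] iP; first by rewrite subrr cabs0 mul0r.
  have -> : S i.+1 - S 0 = (S i.+1 - S i) + (S i - S 0) by ring.
  apply: le_trans (cabsD _ _) _; rewrite -natr1 mulrDl mul1r addrC.
  by apply: lerD; [apply: IH; exact: ltnW|exact: stepS].
have -> : avg F N (w + v) - avg F N w = h * (S P - S 0).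
  rewrite /avg mulrBr; congr (_ * _ - _ * _); apply: eq_bigr => j _; congr F.
    by rewrite odd1_step mul1r.
  by rewrite !mul0r addr0.
rewrite cabsM; apply: le_trans (ler_wpM2l H0 (tot P (leqnn P))) _.
rewrite [P%:R * _]mulrCA PH mulr1 mulrC; apply: ler_wpM2l => //.
exact: cabs_step_le.
Qed.

End PeriodAverages.

(** * Discrete Fourier coefficients *)

Section DiscreteFourierTransform.
Variable R : realType.
Local Notation C := R[i].
Local Notation step := (step R).

Lemma summ_invsq : summ (fun k : int => ((`|k|%N.+1)%:R ^- 2 : R)).
Proof.
apply: (summ_int (h := fun n => (n.+1)%:R ^- 2)); last first.
  by move=> n; rewrite lexx andbT invr_ge0 exprn_ge0.
apply: (@summ_nat _ _ 2) => [i|n]; first by rewrite invr_ge0 exprn_ge0.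
case: n => [|n]; first by rewrite big_ord0.
apply: (@le_trans _ _ (2 - (n.+1%:R)^-1)); last first.
  by rewrite lerBlDr lerDl invr_ge0.
elim: n => [|n IH]; first by rewrite big_ord1 expr1n invr1; lra.
rewrite big_ord_recr /=; apply: le_trans (lerD IH (lexx _)) _.
have n0 : 0 <= n%:R :> R by [].
rewrite -(natr1 n.+1) -(natr1 n); set x := n%:R in n0 *.
rewrite -subr_ge0.
have -> : 2 - (x + 1 + 1)^-1 - (2 - (x + 1)^-1 + (x + 1 + 1) ^- 2) =
   ((x + 1) * (x + 1 + 1) ^+ 2)^-1 by field; lra.
by rewrite invr_ge0 mulr_ge0// ?sqr_ge0//; lra.
Qed.

Lemma stepE N : step N = (((odd1 N)%:R)^-1 : R)%:C.
Proof. by rewrite /step fmorphV rmorph_nat. Qed.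

Lemma grid_neq1 N j : (0 < j < odd1 N)%N -> e2pi (- (j%:R * step N)) != 1.
Proof.
move=> /andP[j0 jP].
have P0 : 0 < (odd1 N)%:R :> R by rewrite ltr0n.
have j0' : 0 < j%:R :> R by rewrite ltr0n.
have key (x : R) : x != 0 -> `|x| <= 2^-1 -> e2pi x%:C != 1.
  move=> x0 /e2pi_sub1_lb h; rewrite -subr_eq0 -cabs_gt0.
  by apply: lt_le_trans h; rewrite mulr_gt0// normr_gt0.
have E : j%:R * step N = (j%:R / (odd1 N)%:R)%:C by rewrite stepE rmorphM rmorph_nat.
have jP' : j%:R < (odd1 N)%:R :> R by rewrite ltr_nat.
have [jN|Nj] := leqP j N.
  rewrite E -rmorphN; apply: key.
    by rewrite oppr_eq0 mulf_neq0 ?invr_eq0 ?gt_eqF.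
  rewrite normrN ger0_norm ?divr_ge0// ler_pdivrMr// mulrC ler_pdivlMr//.
  by rewrite -natrM ler_nat /odd1; lia.
have -> : e2pi (- (j%:R * step N)) = e2pi (1 - j%:R / (odd1 N)%:R)%:C.
  by rewrite E rmorphB rmorph1 e2piD e2pi1 mul1r.
apply: key.
  by rewrite subr_eq0 gt_eqF// ltr_pdivrMr// mul1r.
have h1 : j%:R / (odd1 N)%:R <= 1 :> R by rewrite ler_pdivrMr// mul1r ltW.
rewrite ger0_norm ?subr_ge0// lerBlDr -lerBlDl ler_pdivlMr//.
have -> : 1 - 2^-1 = 2^-1 :> R by field.
by rewrite mulrC ler_pdivrMr// -natrM ler_nat /odd1; lia.
Qed.

Lemma window_character_sum N j : (j < odd1 N)%N ->
  \sum_(k <- window N N.+1) e2pi (- (k%:~R * (j%:R * step N))) =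
  (if j == 0%N then (odd1 N)%:R else 0 : C).
Proof.
move=> jP; rewrite big_window addnS -/(odd1 N).
case: eqP => [->|/eqP j0].
  rewrite (eq_bigr (fun=> 1)) ?sumr_const ?card_ord// => k _.
  by rewrite mul0r mulr0 oppr0 e2pi0.
set r := e2pi (- (j%:R * step N)).
have r1 : r != 1 by apply: grid_neq1; rewrite lt0n j0.
have rP : r ^+ odd1 N = 1.
  rewrite -e2piMn mulrN mulrCA odd1_step mulr1.
  by rewrite e2piN (_ : j%:R = (j%:Z)%:~R)// e2pi_int invr1.
have r0 : r != 0 by exact: e2pi_neq0.
rewrite (eq_bigr (fun k : 'I_(odd1 N) => (r ^+ N)^-1 * r ^+ k)); last first.
  move=> k _; rewrite -mulrN e2piMz -/r expfzDr// exprz_opp_nat -exprnP.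
  by rewrite mulrC.
rewrite -mulr_sumr; apply/eqP; rewrite mulf_eq0; apply/orP; right.
have := subrX1 r (odd1 N); rewrite rP subrr => /esym/eqP.
by rewrite mulf_eq0 subr_eq0 (negbTE r1).
Qed.

Section Coefficients.
Variable g : C -> C.
Hypothesis tame_g : tame g.
Hypothesis per_g : forall z, g (z + 1) = g z.

Definition dft N (w : C) (k : int) : C :=
  step N * \sum_(j < odd1 N) g (w + j%:R * step N) * e2pi (- (k%:~R * (j%:R * step N))).

Lemma dft_inversion N w : \sum_(k <- window N N.+1) dft N w k = g w.
Proof.
rewrite -mulr_sumr exchange_big /=.
under eq_bigr => j _ do rewrite -mulr_sumr window_character_sum//.
rewrite (bigD1 ord0)//= mul0r addr0 big1 ?addr0; last first.
  move=> j j0; rewrite ifF ?mulr0//; apply/negbTE; move: j0.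
  by apply: contraNneq => j0; apply/eqP/val_inj.
by rewrite mulrCA [step N * _]mulrC odd1_step mulr1.
Qed.

(** Summation by parts twice. The second differences of [g] are of size [h ^ 2],
    while the coefficient gets multiplied by [(om - 1) ^ 2 / om], whose size is
    at least [(2 |k| h) ^ 2] as long as [|k| h <= 1 / 2]. *)
Lemma dft_decay w : exists2 M : R, 0 <= M & forall N k, k \in window N N.+1 ->
  cabs (dft N w k) <= M * (`|k|%N.+1)%:R ^- 2.
Proof.
have [g' hg] := tame_g; have [M M0 hM] := hg (cabs w + 1).
have W0 := cabs_ge0 w.
exists (2 * M) => [|N k kw]; first by rewrite mulr_ge0.
set P := odd1 N; set h := step N.
have H1 : cabs h <= 1 by exact: cabs_step_le1.
have hB : cabs h <= cabs w + 1 by lra.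
have PH : P%:R * cabs h = 1 by rewrite /h cabs_step mulfV// pnatr_eq0.
have gridB (j : nat) : (j <= P)%N -> cabs (w + j%:R * h) <= cabs w + 1.
  by move=> jP; apply: le_trans (cabsD _ _) _; rewrite lerD2l cabs_grid.
have [->|k0] := eqVneq k 0.
  rewrite /dft absz0 expr1n invr1 mulr1 cabsM.
  apply: (@le_trans _ _ (cabs h * (P%:R * M))).
    rewrite ler_wpM2l//; apply: le_trans (cabs_sum _ _ _) _.
    rewrite -[P in P%:R * _]card_ord mulr_natl -sumr_const; apply: ler_sum => j _.
    rewrite mul0r oppr0 e2pi0 mulr1.
    by have [] := hM _ _ (gridB j (ltnW (ltn_ord j))) hB.
  by rewrite mulrA [cabs h * _]mulrC PH; lra.
pose om := e2pi (k%:~R * h).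
have om0 : om != 0 by exact: e2pi_neq0.
pose u (x : C) := g (w + x).
pose v (j : nat) := u (j%:R * h) * om ^- j.
have dE : dft N w k = h * \sum_(j < P) v j.
  congr (_ * _); apply: eq_bigr => j _; congr (_ * _).
  by rewrite /om e2piN mulrCA e2piMn.
have omP : om ^+ P = 1 by rewrite -e2piMn mulrCA odd1_step mulr1 e2pi_int.
have S1 : \sum_(j < P) u (j%:R * h + h) * om ^- j = om * \sum_(j < P) v j.
  rewrite -[in RHS]cyclic_sum; last first.
    by rewrite /v /u mul0r addr0 odd1_step per_g omP expr0.
  rewrite mulr_sumr; apply: eq_bigr => j _.
  rewrite /v -natr1 mulrDl mul1r exprS; field.
  by rewrite om0 expf_neq0.
have S2 : \sum_(j < P) u (j%:R * h - h) * om ^- j = om^-1 * \sum_(j < P) v j.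
  rewrite -(cyclic_sum (v := fun j : nat => u (j%:R * h - h) * om ^- j)).
    rewrite mulr_sumr; apply: eq_bigr => j _.
    rewrite /v -natr1 mulrDl mul1r addrK exprS; field.
    by rewrite om0 expf_neq0.
  rewrite odd1_step omP mul0r expr0 sub0r /u addrCA addrC.
  by rewrite [LHS](_ : _ = g ((w - h) + 1) * 1^-1) ?per_g//; congr (g _ * _); ring.
(* second differences; the first order terms in h cancel *)
pose D (j : nat) := u (j%:R * h + h) - u (j%:R * h) *+ 2 + u (j%:R * h - h).
have S3 : \sum_(j < P) D j * om ^- j = (om - 1) ^+ 2 / om * \sum_(j < P) v j.
  rewrite (_ : (om - 1) ^+ 2 / om = om - 2 + om^-1); last by field.
  rewrite mulrDl mulrBl -S1 -S2 [2 * _]mulr_sumr -sumrB -big_split /=.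
  apply: eq_bigr => j _.
  by rewrite /D /v; ring.
have D1 (j : 'I_P) : cabs (D j) <= 2 * M * cabs h ^+ 2.
  have xB := gridB j (ltnW (ltn_ord j)).
  have hNB : cabs (- h) <= cabs w + 1 by rewrite cabsN.
  have [_ _ h1] := hM _ _ xB hB; have [_ _ h2] := hM _ _ xB hNB.
  rewrite cabsN in h2.
  have -> : D j = (g (w + j%:R * h + h) - g (w + j%:R * h) - h * g' (w + j%:R * h)) +
    (g (w + j%:R * h + - h) - g (w + j%:R * h) - - h * g' (w + j%:R * h)).
    by rewrite /D /u !addrA; ring.
  by apply: le_trans (cabsD _ _) _; lra.
have cabs_om : cabs om = 1.
  rewrite cabs_e2pi /h stepE Im_intM /= mulr0 mulr0 oppr0 expR0//.
have S4 : cabs ((om - 1) ^+ 2 / om * \sum_(j < P) v j) <= 2 * M * cabs h.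
  rewrite -S3; apply: le_trans (cabs_sum _ _ _) _.
  apply: (@le_trans _ _ (\sum_(j < P) 2 * M * cabs h ^+ 2)).
    apply: ler_sum => j _.
    by rewrite cabsM cabsV cabsX cabs_om expr1n invr1 mulr1 D1.
  rewrite sumr_const card_ord -[leLHS]mulr_natl.
  have -> : P%:R * (2 * M * cabs h ^+ 2) = 2 * M * cabs h * (P%:R * cabs h) by ring.
  by rewrite PH mulr1.
have omlb : 2 * (`|k%:~R| * cabs h) <= cabs (om - 1).
  have E : k%:~R * h = (k%:~R / P%:R)%:C by rewrite /h stepE rmorphM rmorph_int.
  have -> : `|k%:~R| * cabs h = `|k%:~R / P%:R| :> R.
    by rewrite normrM /h cabs_step [X in _ = _ * X]ger0_norm// invr_ge0.
  rewrite /om E; apply: e2pi_sub1_lb.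
  rewrite normrM [X in _ * X]ger0_norm ?invr_ge0// ler_pdivrMr ?ltr0n//.
  rewrite mulrC ler_pdivlMr// -intr_norm.
  move: kw; rewrite mem_window => kw.
  have : (`|k| * 2)%:~R <= (P%:Z)%:~R :> R by rewrite ler_int /P /odd1; lia.
  by rewrite intrM.
have H0 : 0 < cabs h by rewrite cabs_step invr_gt0 ltr0n.
have K1 : 1 <= `|k%:~R| :> R.
  by rewrite -intr_norm -[1]/(1%:~R) ler_int; move: k0; clear; lia.
set T := \sum_(j < P) v j in dE S4 *.
have S5 : 4 * (`|k%:~R| ^+ 2 * cabs h ^+ 2) * cabs T <= 2 * M * cabs h.
  apply: le_trans S4; rewrite cabsM cabsM cabsX cabsV cabs_om invr1 mulr1.
  rewrite ler_wpM2r//.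
  have -> : 4 * (`|k%:~R| ^+ 2 * cabs h ^+ 2) = (2 * (`|k%:~R| * cabs h)) ^+ 2 :> R by ring.
  by rewrite lerXn2r ?nnegrE ?mulr_ge0.
have S6 : 4 * `|k%:~R| ^+ 2 * cabs (dft N w k) <= 2 * M.
  rewrite dE cabsM -(ler_pM2r H0); apply: le_trans S5.
  by rewrite le_eqVlt; apply/orP; left; apply/eqP; ring.
have -> : (`|k|%N.+1)%:R = `|k%:~R| + 1 :> R.
  by rewrite -natr1 pmulrn abszE intr_norm.
set x := `|k%:~R| in K1 S6 *.
rewrite ler_pdivlMr; last by rewrite exprn_gt0//; lra.
apply: le_trans S6; rewrite [leLHS]mulrC ler_wpM2r//.
by nra.
Qed.

End Coefficients.

End DiscreteFourierTransform.

(** * Uniqueness of theta *)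

Section ThetaUniqueness.
Variable R : realType.
Local Notation C := R[i].

Lemma half1 k : half R (k + 1) = half R k + 1.
Proof. by rewrite half_add. Qed.

(** The functions [f k z = G z * e(- z / 2) * e(- k z)] are periodic, and their
    averages approximate the Fourier coefficients of [G]. A shift by [tau] takes
    [f k] to a multiple of [f (k + 1)]; by [avg_shift] the averages satisfy, in the
    limit, the recursion of the coefficients of theta. So [G w] is asymptotic to
    [c w N * theta w tau], where [c w N] is the normalised average for [k = 0].
    These numbers converge for one [w], where theta does not vanish, hence for all
    [w] with the same limit. *)
Lemma theta_unique (tau : C) (G : C -> C) : 0 < complex.Im tau -> tame G ->
  (forall z, G (z + 1) = - G z) ->
  (forall z, G (z + tau) = - e2pi (- (tau / 2) - z) * G z) ->
  exists c : C, forall z, G z = c * theta z tau.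
Proof.
move=> t0 tG G1 Gtau.
(* theta is antiperiodic; this twist makes the function periodic *)
pose g z := G z * e2pi (- 2^-1 * z).
have tg : tame g by apply: tameM => //; exact: tame_e2pi.
have pg z : g (z + 1) = g z.
  by rewrite /g G1 mulrDr mulr1 e2piD e2piN e2pi_half invrN1; ring.
pose f (k : int) z := g z * e2pi (- k%:~R * z).
have tf k : tame (f k) by apply: tameM => //; exact: tame_e2pi.
have pf k z : f k (z + 1) = f k z.
  by rewrite /f pg mulrDr mulr1 e2piD e2piN e2pi_int invr1 mulr1.
pose mu (k : int) := - e2pi (- ((k + 1)%:~R * tau)).
have ftau k z : f k (z + tau) = mu k * f (k + 1) z.
  rewrite /f /g /mu Gtau.
  have E : e2pi (- (tau / 2) - z) * e2pi (- 2^-1 * (z + tau)) * e2pi (- k%:~R * (z + tau)) =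
    e2pi (- ((k + 1)%:~R * tau)) * (e2pi (- 2^-1 * z) * e2pi (- (k + 1)%:~R * z)).
    by rewrite -!e2piD intrD; congr e2pi; field.
  transitivity (- (e2pi (- (tau / 2) - z) * e2pi (- 2^-1 * (z + tau)) * e2pi (- k%:~R * (z + tau))) * G z).
    by ring.
  by rewrite E; ring.
pose t k := thterm 0 tau k.
have t_neq0 k : t k != 0 by exact: e2pi_neq0.
have tS k : t k = t (k + 1) * mu k.
  have -> : mu k = e2pi (2^-1 - (k + 1)%:~R * tau).
    by rewrite e2piD e2pi_half mulN1r.
  transitivity (t k * e2pi 1); first by rewrite e2pi1 mulr1.
  rewrite /t /thterm half1 -!e2piD; congr e2pi.
  by rewrite intrD /half; field.
(* t is the sequence of Fourier coefficients of theta *)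
pose c w N := avg (f 0) N w / t 0.
have avgE k N w : avg (f k) N w = e2pi (- k%:~R * w) * dft g N w k.
  rewrite /avg /dft mulrCA; congr (_ * _); rewrite mulr_sumr; apply: eq_bigr => j _.
  by rewrite /f mulrDr e2piD mulNr [- k%:~R * _]mulNr; ring.
have lim1 k w : (fun N => avg (f k) N w / t k - c w N) @ \oo --> (0 : C).
  have S (i : int) : (fun N => avg (f (i + 1)) N w / t (i + 1) - avg (f i) N w / t i) @ \oo --> (0 : C).
    pose proof (ccvgZ (b := (t i)^-1) (avg_shift w tau (tf i) (pf i))) as h.
    rewrite mulr0 in h; apply: (ccvg_ext _ h) => N /=.
    have -> : avg (f i) N (w + tau) = mu i * avg (f (i + 1)) N w.
      rewrite /avg [RHS]mulrCA; congr (_ * _); rewrite mulr_sumr; apply: eq_bigr => j _.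
      by rewrite -ftau; congr (f i); ring.
    rewrite tS; have := t_neq0 i; rewrite tS mulf_eq0 negb_or => /andP[h1 h2].
    by field; rewrite h1 h2.
  elim/int_rect: k => [|n IH|n IH].
  - by apply: (ccvg_ext _ (ccvg_cst (a := 0))) => N; rewrite /c subrr.
  - pose proof (ccvgD (S n%:Z) IH) as h; rewrite addr0 in h.
    by apply: (ccvg_ext _ h) => N /=; rewrite -addn1 PoszD addrA subrK.
  - pose proof (ccvgB IH (S (- n.+1%:Z))) as h; rewrite subr0 in h.
    apply: (ccvg_ext _ h) => N /=.
    have -> : - n.+1%:Z + 1 = - n%:Z by lia.
    by ring.
have thE w k : thterm w tau k = t k * (e2pi (2^-1 * w) * e2pi (k%:~R * w)).
  by rewrite /t /thterm -!e2piD; congr e2pi; rewrite /half; ring.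
have limG w : (fun N => G w - c w N * \sum_(k <- window N N.+1) thterm w tau k) @ \oo --> (0 : C).
  pose y N (k : int) := dft g N w k * e2pi (2^-1 * w) - c w N * thterm w tau k.
  pose x N (k : int) := if k \in window N N.+1 then y N k else 0.
  have [M M0 hM] := dft_decay tg pg w.
  have [gth sgth hgth] := thterm_dom `|complex.Im w| (weight_cst (1 : C)) t0.
  pose E := cabs (e2pi (2^-1 * w)).
  have E0 : 0 <= E by exact: cabs_ge0.
  have T0 : 0 < cabs (t 0) by rewrite cabs_gt0.
  have MT : 0 <= M / cabs (t 0) by rewrite divr_ge0.
  have sg := summD (summZ (mulr_ge0 M0 E0) (summ_invsq R)) (summZ MT sgth).
  have dom N k : cabs (x N k) <= M * E * (`|k|%N.+1)%:R ^- 2 + M / cabs (t 0) * gth k.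
    rewrite /x; case: ifP => kw; last by rewrite cabs0; exact: sg.1.
    apply: le_trans (cabsB _ _) _; apply: lerD.
      by rewrite cabsM mulrAC ler_wpM2r// hM.
    rewrite cabsM; apply: ler_pM => //; last first.
      by have := hgth w tau k (lexx _) (lexx _); rewrite mul1r.
    rewrite /c cabsM cabsV ler_wpM2r ?invr_ge0// avgE mulr0z oppr0 mul0r e2pi0 mul1r.
    apply: le_trans (hM N 0 _) _; last by rewrite absz0 expr1n invr1 mulr1.
    by rewrite mem_window; clear; lia.
  have limx k : x ^~ k @ \oo --> (0 : C).
    pose proof (ccvgZ (b := t k * (e2pi (2^-1 * w) * e2pi (k%:~R * w))) (lim1 k w)) as h0.
    move: h0; rewrite mulr0 => /ccvgP h; apply/ccvgP => e /h[N1 _ hN1].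
    exists (N1 + (absz k).+1)%N => // N /= hN.
    have kw : k \in window N N.+1 by rewrite mem_window; move: hN; clear; lia.
    have hN2 : (N1 <= N)%N by move: hN; clear; lia.
    have := hN1 N hN2; rewrite /x kw; congr (cabs (_ - _) < _).
    rewrite /y thE avgE mulNr e2piN.
    move: (t_neq0 k) (e2pi_neq0 (k%:~R * w)).
    move: (t k) (e2pi (k%:~R * w)) (dft g N w k) (e2pi (2^-1 * w)) (c w N); clear => A B D F H A0 B0.
    by field; rewrite A0 B0.
  have hx N : hsum (x N) (G w - c w N * \sum_(k <- window N N.+1) thterm w tau k).
    have -> : G w - c w N * \sum_(k <- window N N.+1) thterm w tau k =
      \sum_(k <- window N N.+1) y N k.
      rewrite /y sumrB -mulr_sumr -mulr_suml dft_inversion; congr (_ - _).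
      by rewrite /g -mulrA -e2piD mulNr addNr e2pi0 mulr1.
    exact: hsum_window.
  have h0 : hsum (fun _ : int => 0 : C) 0.
    have := @hsum_fin R int (fun=> 0) [::] isT (fun _ _ => erefl); by rewrite big_nil.
  exact: (tannery sg dom limx hx h0).
have limth w : (fun N => \sum_(k <- window N N.+1) thterm w tau k) @ \oo --> theta w tau.
  apply: (hsum_seq (theta_hsum w t0)) => [N|k]; first exact: window_uniq.
  exists (absz k).+1 => // N /= hN.
  by rewrite mem_window; move: hN; clear; lia.
have limc w : (fun N => c w N * \sum_(k <- window N N.+1) thterm w tau k) @ \oo --> G w.
  pose proof (ccvgB (ccvg_cst (F := \oo) (a := G w)) (limG w)) as h; rewrite subr0 in h.
  by apply: (ccvg_ext _ h) => N /=; ring.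
(* a point at which theta does not vanish *)
pose w0 := tau / 2.
have th0 : theta w0 tau != 0.
  apply: theta_neq0_strip; rewrite /w0.
  have -> : complex.Im (tau / 2) = complex.Im tau / 2.
    have -> : tau / 2 = (2^-1)%:C * tau by rewrite fmorphV rmorph_nat mulrC.
    by rewrite Im_realM mulrC.
  by move: t0; clear; lra.
exists (G w0 / theta w0 tau) => w.
have limc0 : c w0 @ \oo --> G w0 / theta w0 tau.
  pose proof (ccvgM (limc w0) (ccvgV th0 (limth w0))) as h0; move/ccvgP: h0 => h.
  have /ccvgP hth := limth w0.
  apply/ccvgP => e e0.
  have th0' : 0 < cabs (theta w0 tau) by rewrite cabs_gt0.
  apply: filterS2 (h _ e0) (hth _ th0') => N h1 h2.
  have sn0 : \sum_(k <- window N N.+1) thterm w0 tau k != 0.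
    apply/eqP => s0; move: h2; rewrite s0 sub0r cabsN ltxx//.
  by move: h1; rewrite mulfK.
have limcw : c w @ \oo --> G w0 / theta w0 tau.
  pose proof (ccvgM (avg_shift w0 (w - w0) (tf 0) (pf 0)) (ccvg_cst (F := \oo) (a := (t 0)^-1))) as h.
  pose proof (ccvgD h limc0) as h2; rewrite mul0r add0r in h2.
  apply: (ccvg_ext _ h2) => N; rewrite /c.
  have -> : w0 + (w - w0) = w by ring.
  by ring.
exact: (ccvg_unique (limc w) (ccvgM limcw (limth w))).
Qed.

End ThetaUniqueness.

(** * The modular law of theta *)

Section Modular.
Variable R : realType.
Local Notation C := R[i].

Lemma Im_moebius_gt0 (a b c d : int) (tau : C) :
  a * d - b * c = 1 -> 0 < complex.Im tau ->
  let j := c%:~R * tau + d%:~R in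
  j != 0 /\ 0 < complex.Im ((a%:~R * tau + b%:~R) / j).
Proof.
move=> det t0 j.
have j0 : j != 0.
  apply/eqP => j0.
  have : complex.Im j = 0 by rewrite j0.
  rewrite Im_add Im_intM Im_int addr0 => /eqP; rewrite mulf_eq0 (gt_eqF t0) orbF intr_eq0.
  move=> /eqP c0; move: j0; rewrite /j c0 mulr0z mul0r add0r => /eqP; rewrite intr_eq0.
  by move=> /eqP d0; move: det; rewrite c0 d0; lia.
split=> //; set t := _ / j.
have tj : t * j = a%:~R * tau + b%:~R by rewrite /t divfK.
have detR : a%:~R * d%:~R - b%:~R * c%:~R = 1 :> R by rewrite -!intrM -intrB det.
move: tj t0; rewrite /j -!(rmorph_int (real_complex R)).
move: t => t; case: t => p q; case: tau {j j0} => x y.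
move: (a%:~R : R) (b%:~R : R) (c%:~R : R) (d%:~R : R) detR => A B D E det'.
move=> /eqP; rewrite eq_complex /= => /andP[/eqP h1 /eqP h2] y0.
have key : q * ((D * x + E) ^+ 2 + (D * y) ^+ 2) = y.
  transitivity ((D * x + E) * (p * (D * y + 0 * x + 0) + q * (D * x - 0 * y + E))
    - D * y * (p * (D * x - 0 * y + E) - q * (D * y + 0 * x + 0))); first by ring.
  by rewrite h1 h2 -[RHS]mulr1 -det'; ring.
rewrite ltNge; apply/negP => q0.
have : 0 <= (D * x + E) ^+ 2 + (D * y) ^+ 2 by rewrite addr_ge0 ?sqr_ge0.
by nra.
Qed.

(** Coprime [a] and [b] are not both even. These parities govern the signs in the
    quasi-periods of a transformed theta function. *)
Lemma bezout_parity (a b x y : int) : a * x + b * y = 1 ->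
  exists m : int, a - b - a * b = 2 * m + 1.
Proof.
move=> h.
have := divz_eq a 2; have := modz_ge0 a (_ : (2 : int) != 0) => /(_ isT).
have := ltz_pmod a (_ : 0 < 2) => /(_ isT).
have := divz_eq b 2; have := modz_ge0 b (_ : (2 : int) != 0) => /(_ isT).
have := ltz_pmod b (_ : 0 < 2) => /(_ isT).
move: (a %/ 2)%Z (a %% 2)%Z (b %/ 2)%Z (b %% 2)%Z => a' ra b' rb.
move=> h1 h2 h3 h4 h5 h6.
have [ra0|ra1] : ra = 0 \/ ra = 1 by lia.
  have [rb0|rb1] : rb = 0 \/ rb = 1 by lia.
    exfalso; move: h; rewrite h6 h3 ra0 rb0.
    have -> : (a' * 2 + 0) * x + (b' * 2 + 0) * y = 2 * (a' * x + b' * y) by ring.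
    lia.
  exists (- b' - a * b' - 1); rewrite h3 rb1; ring.
by exists (a' - b - a' * b); rewrite h6 ra1; ring.
Qed.

Lemma sign_odd (m : int) : (-1) ^ (2 * m + 1) = -1 :> C.
Proof.
rewrite expfzDr ?oppr_eq0 ?oner_eq0// -exprz_exp -[(-1) ^ 2]exprnP.
by rewrite sqrrN expr1n exp1rz expr1z mul1r.
Qed.

Lemma tame_cvg0 (f : C -> C) : tame f -> (fun N => f (recip R N)) @ \oo --> f 0.
Proof.
move=> [f' hf]; have [M M0 hM] := hf 1.
apply: (cvg_of_bound (M := M + M)) => N.
have := hM 0 (recip R N); rewrite cabs0 => /(_ ler01 (recip_le1 R N)) [_ h2 h3].
rewrite add0r in h3.
have -> : f (recip R N) - f 0 = (f (recip R N) - f 0 - recip R N * f' 0) + recip R N * f' 0 by ring.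
have x0 := cabs_ge0 (recip R N); have x1 := recip_le1 R N.
apply: le_trans (cabsD _ _) _; rewrite [cabs (_ * f' 0)]cabsM -cabs_recip.
have h4 := ler_wpM2l x0 h2.
have h5 : M * cabs (recip R N) ^+ 2 <= M * cabs (recip R N).
  by rewrite ler_wpM2l// expr2 ler_piMl.
lra.
Qed.

(** By [theta_unique]: the function [G] in the proof is entire with the
    quasi-periods of [theta z tau]. The constant [k], a root of unity times a square
    root of [j], is not determined; comparing derivatives at [0] shows how it enters
    the derivative. *)
Lemma theta_modular (a b c d : int) (tau : C) :
  a * d - b * c = 1 -> 0 < complex.Im tau ->
  let j := c%:~R * tau + d%:~R in let tau' := (a%:~R * tau + b%:~R) / j in
  exists k : C, [/\ k != 0,
    forall z, theta (z / j) tau' = k * e2pi (c%:~R / (2 * j) * (z * z)) * theta z tau &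
    theta_deriv0 tau' = j * k * theta_deriv0 tau].
Proof.
move=> det t0 j tau'.
have [j0 t'0] := Im_moebius_gt0 det t0; rewrite -/j -/tau' in j0 t'0.
have detC : a%:~R * d%:~R - b%:~R * c%:~R = 1 :> C by rewrite -!intrM -intrB det.
pose al := - (c%:~R / (2 * j)) : C.
pose G z := e2pi (al * (z * z)) * theta (j^-1 * z) tau'.
have tq : tame (fun z => e2pi (al * (z * z))).
  by apply: tame_cexp; do 2!apply: tameZ; apply: tameM; exact: tame_id.
have tG : tame G := tameM tq (tame_scale j^-1 (tame_theta t'0)).
have tau'E : tau' * j = a%:~R * tau + b%:~R by rewrite /tau' divfK.
have a_eq : a%:~R = j^-1 + c%:~R * tau'.
  have E : a%:~R * j = 1 + c%:~R * (tau' * j).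
    transitivity (a%:~R * d%:~R - b%:~R * c%:~R + c%:~R * (a%:~R * tau + b%:~R)).
      by rewrite /j; ring.
    by rewrite detC tau'E.
  by apply: (mulIf j0); rewrite E; field.
have tau_eq : tau = j * (d%:~R * tau' - b%:~R).
  have -> : j * (d%:~R * tau' - b%:~R) = d%:~R * (tau' * j) - b%:~R * j by ring.
  transitivity (tau * (a%:~R * d%:~R - b%:~R * c%:~R)); first by rewrite detC mulr1.
  by rewrite tau'E /j; ring.
have Gs s (l m : int) z : s = j * (l%:~R * tau' + m%:~R) -> G (z + s) =
    (-1) ^ (l + m) * e2pi (al * (2 * z * s + s * s) - l%:~R ^+ 2 / 2 * tau'
       - l%:~R * (j^-1 * z)) * G z.
  move=> sE; rewrite /G.
  have -> : j^-1 * (z + s) = j^-1 * z + l%:~R * tau' + m%:~R.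
    by rewrite sE; field.
  rewrite theta_quasi//.
  have -> : al * ((z + s) * (z + s)) = al * (2 * z * s + s * s) + al * (z * z) by ring.
  by rewrite !e2piD; ring.
have G1 z : G (z + 1) = - G z.
  have [|m hm] := @bezout_parity a c d (- b); first by rewrite mulrN [c * b]mulrC.
  rewrite (@Gs 1 (- c) a z); last by rewrite a_eq mulrNz; field.
  have -> : al * (2 * z * 1 + 1 * 1) - (- c)%:~R ^+ 2 / 2 * tau' - (- c)%:~R * (j^-1 * z)
     = (- (a * c))%:~R * 2^-1.
    by rewrite /al !mulrNz intrM a_eq; field.
  rewrite e2piMz e2pi_half -expfzDr ?oppr_eq0 ?oner_eq0//.
  have -> : - c + a + - (a * c) = 2 * m + 1 by rewrite -hm; ring.
  by rewrite sign_odd mulN1r.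
have Gtau z : G (z + tau) = - e2pi (- (tau / 2) - z) * G z.
  have [|m hm] := @bezout_parity d b a (- c); first by rewrite mulrN -det; ring.
  rewrite (@Gs tau d (- b) z); last by rewrite mulrNz.
  have -> : al * (2 * z * tau + tau * tau) - d%:~R ^+ 2 / 2 * tau' - d%:~R * (j^-1 * z)
     = (- (d * b))%:~R * 2^-1 + (- (tau / 2) - z).
    rewrite /al mulrNz intrM.
    have dj : d%:~R = j - c%:~R * tau by rewrite /j; ring.
    have [u [tu tau'd]] : exists u, tau = j * u /\ d%:~R * tau' = u + b%:~R.
      by exists (d%:~R * tau' - b%:~R); split=> //; rewrite subrK.
    have -> : d%:~R ^+ 2 / 2 * tau' = d%:~R / 2 * (d%:~R * tau') by ring.
    rewrite tau'd; move: tu dj j0 {tau'd}.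
    move: (b%:~R : C) (c%:~R : C) (d%:~R : C) (j : C).
    move=> B D E J tu EJ J0; rewrite EJ {}tu.
    by field.
  rewrite e2piD e2piMz e2pi_half [_ * (_ * e2pi _)]mulrA -expfzDr ?oppr_eq0 ?oner_eq0//.
  have -> : d + - b + - (d * b) = 2 * m + 1 by rewrite -hm; ring.
  by rewrite sign_odd mulN1r.
have [k hk] := theta_unique t0 tG G1 Gtau.
have hkz z : theta (z / j) tau' = k * e2pi (c%:~R / (2 * j) * (z * z)) * theta z tau.
  have := hk z; rewrite /G /al mulNr e2piN [j^-1 * z]mulrC => h.
  by rewrite mulrAC -h; field; rewrite e2pi_neq0.
exists k; split=> //.
  apply/eqP => k0; have := hkz (j * (tau' / 2)); rewrite k0 !mul0r.
  apply/eqP; rewrite mulrAC divff// mul1r; apply: theta_neq0_strip.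
  have -> : tau' / 2 = (2^-1)%:C * tau' by rewrite fmorphV rmorph_nat mulrC.
  by rewrite Im_realM; move: t'0; clear; lra.
pose proof (theta_deriv0_cvg j^-1 t'0) as h1.
pose q (z : C) := e2pi (c%:~R / (2 * j) * (z * z)).
have tq2 : tame q by apply: tame_cexp; do 2!apply: tameZ; apply: tameM; exact: tame_id.
pose proof (ccvgZ (b := k) (ccvgM (tame_cvg0 tq2) (theta_deriv0_cvg 1 t0))) as h2.
have h3 := ccvg_unique h1 (ccvg_ext _ h2).
rewrite -[LHS](mulVKf j0) h3 /q ?mulr0 ?mulr0 ?e2pi0; first by ring.
move=> N /=; rewrite mul1r [j^-1 * _]mulrC hkz; ring.
Qed.

End Modular.

(** * The Kronecker function *)

Section Kronecker.
Variable R : realType.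
Local Notation C := R[i].

Definition kron (z1 z2 tau : C) : C :=
  - 'i * eta tau ^+ 3 * (theta (z1 + z2) tau / (theta z1 tau * theta z2 tau)).

Lemma f2_meroE (z : 'cV[C]_2) tau :
  f2_mero z tau = kron (3 * z 0 0) (3 * z 1 0) (3 * tau).
Proof. by []. Qed.

Lemma kron_quasi (l1 l2 m1 m2 : int) (z1 z2 tau : C) : 0 < complex.Im tau ->
  kron (z1 + l1%:~R * tau + m1%:~R) (z2 + l2%:~R * tau + m2%:~R) tau =
  e2pi (- ((l1 * l2)%:~R * tau) - l2%:~R * z1 - l1%:~R * z2) * kron z1 z2 tau.
Proof.
move=> t0; rewrite /kron.
have -> : z1 + l1%:~R * tau + m1%:~R + (z2 + l2%:~R * tau + m2%:~R) =
  (z1 + z2) + (l1 + l2)%:~R * tau + (m1 + m2)%:~R by rewrite !intrD; ring.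
rewrite !theta_quasi//.
have s0 (n : int) : (-1) ^ n != 0 :> C by rewrite expfz_neq0// oppr_eq0 oner_eq0.
have -> : (-1) ^ (l1 + l2 + (m1 + m2)) = (-1) ^ (l1 + m1) * (-1) ^ (l2 + m2) :> C.
  by rewrite -expfzDr ?oppr_eq0 ?oner_eq0//; congr (_ ^ _); ring.
have -> : e2pi (- ((l1 + l2)%:~R ^+ 2 / 2 * tau) - (l1 + l2)%:~R * (z1 + z2)) =
  e2pi (- ((l1 * l2)%:~R * tau) - l2%:~R * z1 - l1%:~R * z2) *
  (e2pi (- (l1%:~R ^+ 2 / 2 * tau) - l1%:~R * z1) * e2pi (- (l2%:~R ^+ 2 / 2 * tau) - l2%:~R * z2)).
  by rewrite -!e2piD; congr e2pi; rewrite intrM intrD; field.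
move: (s0 (l1 + m1)) (s0 (l2 + m2)) (e2pi_neq0 (- (l1%:~R ^+ 2 / 2 * tau) - l1%:~R * z1))
  (e2pi_neq0 (- (l2%:~R ^+ 2 / 2 * tau) - l2%:~R * z2)).
move: ((-1) ^ (l1 + m1)) ((-1) ^ (l2 + m2)) (e2pi (- (l1%:~R ^+ 2 / 2 * tau) - l1%:~R * z1))
  (e2pi (- (l2%:~R ^+ 2 / 2 * tau) - l2%:~R * z2))
  (e2pi (- ((l1 * l2)%:~R * tau) - l2%:~R * z1 - l1%:~R * z2)) (theta (z1 + z2) tau)
  (theta z1 tau) (theta z2 tau) (eta tau).
clear => A B D E S T T1 T2 H A0 B0 D0 E0.
rewrite !invfM.
transitivity ((A / A) * (B / B) * (D / D) * (E / E) *
  (S * (- 'i * H ^+ 3 * (T * (T1^-1 * T2^-1))))); first by ring.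
by rewrite !divff// !mul1r.
Qed.

Lemma eta_cubed (tau : C) : 0 < complex.Im tau ->
  eta tau ^+ 3 = e2pi (tau / 8) * pochoo (e2pi tau) (e2pi tau) ^+ 3.
Proof.
move=> t0; rewrite eta_pochoo// exprMn -e2piMn.
by have -> : 3%:R * (tau / 24) = tau / 8 by field.
Qed.

Lemma kron_prod (z1 z2 tau : C) : 0 < complex.Im tau ->
  let q := e2pi tau in let a := e2pi z1 in let b := e2pi z2 in
  kron z1 z2 tau =
    pochoo q q ^+ 2 * (pochoo (a * b) q * pochoo (q / (a * b)) q) /
      (pochoo a q * pochoo (q / a) q * (pochoo b q * pochoo (q / b) q)).
Proof.
move=> t0 q a b; rewrite /kron eta_cubed// !theta_prod// -/q -/a -/b e2piD -/a -/b.
have -> : e2pi (- ((z1 + z2) / 2)) = e2pi (- (z1 / 2)) * e2pi (- (z2 / 2)).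
  by rewrite -e2piD; congr e2pi; ring.
have qq0 : pochoo q q != 0 by apply: pochoo_neq0; exact: cabs_q_lt1.
move: (i_neq0 R) (e2pi_neq0 (tau / 8)) (e2pi_neq0 (- (z1 / 2))) (e2pi_neq0 (- (z2 / 2))) qq0.
move: (e2pi (tau / 8)) (e2pi (- (z1 / 2))) (e2pi (- (z2 / 2))) (pochoo q q)
  (pochoo (a * b) q) (pochoo (q / (a * b)) q) (pochoo a q) (pochoo (q / a) q)
  (pochoo b q) (pochoo (q / b) q).
clear => E A B Q X1 X2 Y1 Y2 Z1 Z2 I0 E0 A0 B0 Q0.
rewrite !invfM !invrN.
transitivity (('i / 'i) ^+ 2 * (E / E) ^+ 2 * (A / A) * (B / B) * (Q / Q) ^+ 2 *
   (Q ^+ 2 * (X1 * X2) * (Y1^-1 * Y2^-1 * (Z1^-1 * Z2^-1)))); first by ring.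
by rewrite !divff// !expr1n !mul1r.
Qed.

Local Opaque eta theta.

(** By Jacobi's derivative formula the cube of eta contributes [j * k], the three
    theta functions contribute [k / k ^ 2], and the exponents combine through
    [(z1 + z2) ^ 2 - z1 ^ 2 - z2 ^ 2 = 2 z1 z2]. *)
Lemma kron_modular (a b c d : int) (z1 z2 tau : C) :
  a * d - b * c = 1 -> 0 < complex.Im tau ->
  let j := c%:~R * tau + d%:~R in
  kron (z1 / j) (z2 / j) ((a%:~R * tau + b%:~R) / j) =
  j * e2pi (c%:~R * z1 * z2 / j) * kron z1 z2 tau.
Proof.
move=> det t0 j.
have [j0 t'0] := Im_moebius_gt0 det t0; rewrite -/j in j0 t'0.
have [k [k0 hk hd]] := theta_modular det t0; rewrite -/j in hk hd.
move: ((a%:~R * tau + b%:~R) / j) t'0 hk hd => tau' t'0 hk hd.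
have e3 (t : C) : 0 < complex.Im t -> eta t ^+ 3 = - (2 * pi%:C)^-1 * theta_deriv0 t.
  move=> ht; rewrite theta_deriv0_eta// mulrA mulrNN mulVf ?mul1r//.
  rewrite mulf_neq0 ?pnatr_eq0// -cabs_gt0 cabs_real normr_gt0.
  by rewrite gt_eqF// pi_gt0.
rewrite /kron (e3 _ t'0) (e3 _ t0) hd.
have -> : z1 / j + z2 / j = (z1 + z2) / j by rewrite mulrDl.
rewrite (hk (z1 + z2)) (hk z1) (hk z2).
have -> : e2pi (c%:~R / (2 * j) * ((z1 + z2) * (z1 + z2))) =
  e2pi (c%:~R * z1 * z2 / j) * (e2pi (c%:~R / (2 * j) * (z1 * z1)) * e2pi (c%:~R / (2 * j) * (z2 * z2))).
  by rewrite -!e2piD; congr e2pi; field.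
move: (e2pi_neq0 (c%:~R / (2 * j) * (z1 * z1))) (e2pi_neq0 (c%:~R / (2 * j) * (z2 * z2))).
move: (e2pi (c%:~R / (2 * j) * (z1 * z1))) (e2pi (c%:~R / (2 * j) * (z2 * z2))) (e2pi (c%:~R * z1 * z2 / j))
  (theta (z1 + z2) tau) (theta z1 tau) (theta z2 tau) (theta_deriv0 tau) (2 * pi%:C)^-1.
move=> E1 E2 S T T1 T2 D P E10 E20.
rewrite !invfM.
transitivity ((k / k) ^+ 2 * (E1 / E1) * (E2 / E2) *
  (j * S * (- 'i * (- P * D) * (T * (T1^-1 * T2^-1))))); first by ring.
by rewrite !divff// expr1n !mul1r.
Qed.

(** The two geometric series with sum [1 / (1 - x)]: over [m >= 0] for small [x], and
    over [m < 0], with a sign, for large [x]. *)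
Definition half_geo (s : bool) (x : C) (m : int) : C :=
  if s then (if 0 <= m then x ^ m else 0) else (if m < 0 then - x ^ m else 0).

(** Multiplication by [x] shifts the series by one place, and only the term of
    index [0] survives in the difference. *)
Lemma half_geo_sum (s : bool) (x t : C) : x != 0 -> x != 1 ->
  hsum (half_geo s x) t -> t = (1 - x)^-1.
Proof.
move=> x0 x1 ht.
have x1' : 1 - x != 0 by rewrite subr_eq0 eq_sym.
have h1 := hsum_reindex (f := fun n : int => n - 1) (g := fun n : int => n + 1)
    (subrK 1) (addrK 1) ht.
have h2 := hsumD ht (hsumN (hsumZ (c := x) h1)).
have h3 := @hsum_fin R int (fun m => if m == 0 then 1 else 0) [:: 0] isT.
have {}h3 : hsum (fun m : int => if m == 0 then 1 else 0 : C) 1.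
  by move: h3; rewrite big_seq1 eqxx; apply=> i; rewrite inE => /negbTE ->.
have E : t - x * t = 1.
  apply: (hsum_unique h2); apply: eq_hsum h3 => m /=.
  have xS : x * x ^ (m - 1) = x ^ m.
    by rewrite -{1}[x]expr1z -expfzDr//; congr (_ ^ _); ring.
  rewrite /half_geo; case: s {ht h1 h2}.
    have [->|m0] := eqVneq m 0; first by rewrite /= mulr0 subr0.
    have -> : (0 <= m - 1) = (0 <= m) by lia.
    by case: ifP; rewrite ?xS ?mulr0 subrr.
  have [m0|m0] := eqVneq m 0; first rewrite m0.
    by rewrite /= mulrN sub0r opprK; move: xS; rewrite m0 expr0z => ->.
  have -> : (m - 1 < 0) = (m < 0) by lia.
  by case: ifP; rewrite ?mulrN ?xS ?mulr0 subrr.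
apply: (mulIf x1'); rewrite mulVf// -[RHS]E; ring.
Qed.

(** The function [chi2] at integer points translated by a vector of the open unit
    square. *)
Definition quadrant_sign (n : int * int) : C :=
  if 0 <= n.1 then (if 0 <= n.2 then 1 else 0) else (if n.2 < 0 then -1 else 0).

Definition dbl_term (q a b : C) (n : int * int) : C :=
  quadrant_sign n * (q ^ (n.1 * n.2) * a ^ n.2 * b ^ n.1).

Lemma dbl_term_row q a b n : q != 0 -> a != 0 ->
  (fun m => dbl_term q a b (n, m)) =1
  (fun m => b ^ n * half_geo (0 <= n) (a * q ^ n) m).
Proof.
move=> q0 a0 m; rewrite /dbl_term /quadrant_sign /half_geo /=.
have E : q ^ (n * m) * a ^ m = (a * q ^ n) ^ m.
  by rewrite expfzMl exprz_exp mulrC.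
rewrite E; case: (0 <= n).
  by case: (0 <= m); rewrite ?mul1r ?mul0r ?mulr0// mulrC.
by case: (m < 0); rewrite ?mulN1r ?mul0r ?mulr0// mulrN mulrC.
Qed.

(** In the third quadrant, [q ^ (k l)] with [k, l >= 1] is at most
    [q ^ (k + l - 1)], which compensates for the growth of [a ^ - l] and [b ^ - k] and
    leaves the factor [1 / q]. *)
Lemma dbl_term_bound q a b n :
  q != 0 -> cabs q < cabs a < 1 -> cabs q < cabs b < 1 ->
  cabs (dbl_term q a b n) <= (cabs q)^-1 *
    (Num.max (cabs b) (cabs q / cabs b) ^+ `|n.1|%N *
     Num.max (cabs a) (cabs q / cabs a) ^+ `|n.2|%N).
Proof.
move=> q0 /andP[qa a1] /andP[qb b1].
have Q0 : 0 < cabs q by rewrite cabs_gt0.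
have q1 : cabs q < 1 by exact: lt_trans qa a1.
have A0 : 0 < cabs a by exact: lt_trans qa.
have B0 : 0 < cabs b by exact: lt_trans qb.
set ra := Num.max (cabs a) _; set rb := Num.max (cabs b) _.
have ra0 : 0 <= ra by rewrite le_max cabs_ge0.
have rb0 : 0 <= rb by rewrite le_max cabs_ge0.
have iq1 : 1 <= (cabs q)^-1 by rewrite invf_ge1// ltW.
have rhs0 k l : 0 <= (cabs q)^-1 * (rb ^+ k * ra ^+ l).
  by rewrite !mulr_ge0 ?exprn_ge0 ?invr_ge0.
case: n => -[k|k] [l|l]; rewrite /dbl_term /quadrant_sign /= ?mul0r ?cabs0//.
  rewrite mul1r cabsM cabsM.
  have -> : Posz k * Posz l = (k * l)%N by [].
  rewrite -!exprnP !cabsX.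
  have h1 : cabs q ^+ (k * l) <= (cabs q)^-1.
    by apply: le_trans iq1; rewrite exprn_ile1// ltW.
  have h2 : cabs a ^+ l <= ra ^+ l by rewrite lerXn2r ?nnegrE// le_max lexx.
  have h3 : cabs b ^+ k <= rb ^+ k by rewrite lerXn2r ?nnegrE// le_max lexx.
  rewrite -mulrA; apply: ler_pM; rewrite ?exprn_ge0 ?mulr_ge0 ?exprn_ge0//.
  by rewrite mulrC; apply: ler_pM; rewrite ?exprn_ge0.
have -> : Negz k * Negz l = (k.+1 * l.+1)%N by rewrite !NegzE mulrNN -PoszM.
rewrite mulN1r cabsN !NegzE !exprz_opp_nat -exprnP.
have -> : (k.+1 * l.+1 = k.+1 + (l + k * l))%N by rewrite mulnS mulSn.
have -> : q ^+ (k.+1 + (l + k * l)) * (a ^+ l.+1)^-1 * (b ^+ k.+1)^-1 =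
  q^-1 * q ^+ (k * l) * ((q / b) ^+ k.+1 * (q / a) ^+ l.+1).
  rewrite !expr_div_n !exprD [q ^+ l.+1]exprS; field.
  by rewrite q0 !expf_neq0// -cabs_gt0.
rewrite !(cabsM, cabsX, cabsV).
rewrite -mulrA; apply: ler_pM; rewrite ?invr_ge0 ?mulr_ge0 ?exprn_ge0 ?divr_ge0//.
have h1 : cabs q ^+ (k * l) <= 1 by rewrite exprn_ile1// ltW.
rewrite -[leRHS]mul1r; apply: ler_pM; rewrite ?mulr_ge0 ?exprn_ge0 ?divr_ge0//.
by apply: ler_pM; rewrite ?exprn_ge0 ?divr_ge0// lerXn2r ?nnegrE ?divr_ge0// le_max lexx orbT.
Qed.

(** Kronecker's double series: summing over rows gives the Lambert series. *)
Lemma kronecker_double q a b :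
  q != 0 -> cabs q < cabs a < 1 -> cabs q < cabs b < 1 ->
  hsum (dbl_term q a b)
    (pochoo q q ^+ 2 * (pochoo (a * b) q * pochoo (q / (a * b)) q) /
      (pochoo a q * pochoo (q / a) q * (pochoo b q * pochoo (q / b) q))).
Proof.
move=> q0 ha hb.
have bound n := dbl_term_bound n q0 ha hb.
have Q0 : 0 < cabs q by rewrite cabs_gt0.
have A0 : 0 < cabs a by case/andP: ha => /(lt_trans Q0).
have B0 : 0 < cabs b by case/andP: hb => /(lt_trans Q0).
have a0 : a != 0 by rewrite -cabs_gt0.
have rr (x : C) : cabs q < cabs x < 1 -> 0 <= Num.max (cabs x) (cabs q / cabs x) < 1.
  move=> /andP[qx x1]; rewrite le_max cabs_ge0/= gt_max x1 ltr_pdivrMr ?mul1r//.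
  exact: lt_trans qx.
have geo (x : C) : cabs q < cabs x < 1 ->
    summ (fun n : int => Num.max (cabs x) (cabs q / cabs x) ^+ `|n|%N).
  move=> /rr hx; apply: (summ_le (summ_geo_int (K := 1) ler01 hx)) => n.
  by rewrite mul1r lexx exprn_ge0//; case/andP: hx.
have sg := summZ (c := (cabs q)^-1) (ltac:(by rewrite invr_ge0)) (summ_prod (geo b hb) (geo a ha)).
have [s hs] := hsum_ex sg bound.
suff <- : s = pochoo q q ^+ 2 * (pochoo (a * b) q * pochoo (q / (a * b)) q) /
      (pochoo a q * pochoo (q / a) q * (pochoo b q * pochoo (q / b) q)) by [].
apply: kronecker_lambert => //.
apply: (hsum_fubini hs) => n.
have aq1 : a * q ^ n != 1 by have [] := lambert_bound n q0 ha hb.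
have sgn : summ (fun m : int => (cabs q)^-1 * (Num.max (cabs b) (cabs q / cabs b) ^+ `|n|%N *
     Num.max (cabs a) (cabs q / cabs a) ^+ `|m|%N)).
  have inj : injective (fun m : int => (n, m)) by move=> u v [].
  exact: (summ_comp inj sg).
have [t ht] := hsum_ex sgn (fun m => bound (n, m)).
have aqn0 : a * q ^ n != 0 by rewrite mulf_neq0 ?expfz_neq0.
have bn0 : b ^ n != 0 by rewrite expfz_neq0// -cabs_gt0.
have hg : hsum (half_geo (0 <= n) (a * q ^ n)) ((b ^ n)^-1 * t).
  apply: eq_hsum (hsumZ (c := (b ^ n)^-1) ht) => m /=.
  by rewrite dbl_term_row// mulKf.
have tE := half_geo_sum aqn0 aq1 hg.
suff <- : t = b ^ n / (1 - a * q ^ n) by [].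
by rewrite -tE mulVKf.
Qed.

End Kronecker.

(** * The generating function for parallelograms *)

Section Parallelograms.
Variable R : realType.
Local Notation C := R[i].
Local Opaque eta theta.

Lemma f2_termE (z : 'cV[C]_2) tau n1 n2 : f2_term z tau (n1, n2) =
  (chi2 (n1%:~R + complex.Im (z 0 0) / complex.Im tau)
        (n2%:~R + complex.Im (z 1 0) / complex.Im tau))%:C *
  e2pi (3 * (n1%:~R * n2%:~R * tau + n2%:~R * z 0 0 + n1%:~R * z 1 0)).
Proof.
rewrite /f2_term /= -!e2piMz -2!mulrA; congr (_ * _).
rewrite -!e2piD !intrM; congr e2pi.
by rewrite -[3%:~R]/(3%:R : C); ring.
Qed.

Lemma chi2_strip (n1 n2 : int) (x1 x2 : R) : 0 < x1 < 1 -> 0 < x2 < 1 ->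
  (chi2 (n1%:~R + x1) (n2%:~R + x2))%:C = quadrant_sign R (n1, n2).
Proof.
move=> h1 h2.
have pos (n : int) (x : R) : 0 < x < 1 -> (0 < n%:~R + x) = (0 <= n).
  move=> /andP[x0 x1']; have [n0|n0] := leP 0 n.
    by rewrite ltr_wpDl// ler0z.
  apply/negbTE; rewrite -leNgt.
  have : n%:~R <= (-1)%:~R :> R by rewrite ler_int; move: n0; clear; lia.
  by rewrite mulrN1z; lra.
have neg (n : int) (x : R) : 0 < x < 1 -> (n%:~R + x < 0) = (n < 0).
  move=> hx; have := pos n x hx; have [n0|n0] := leP 0 n => h.
    by apply/negbTE; rewrite -leNgt ltW.
  rewrite lt_neqAle leNgt h andbT; apply/eqP => e0.
  have : n%:~R <= (-1)%:~R :> R by rewrite ler_int; move: n0; clear; lia.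
  by rewrite mulrN1z; case/andP: hx; lra.
rewrite /chi2 /quadrant_sign /=.
have [n0|n0] := leP 0 n1.
  have p1 : 0 < n1%:~R + x1 by rewrite pos.
  rewrite gtr0_sg// mul1r pmulr_rgt0// pos//.
  by case: (0 <= n2).
have p1 : n1%:~R + x1 < 0 by rewrite neg.
rewrite ltr0_sg// nmulr_rgt0// neg//.
by case: (n2 < 0); rewrite ?mulr1 ?mulr0// rmorphN1.
Qed.

Lemma f2_strip_hsum (z : 'cV[C]_2) tau :
  (forall j, 0 < complex.Im (z j 0) < complex.Im tau) ->
  hsum (f2_term z tau) (f2_mero z tau).
Proof.
move=> hz; have t0 : 0 < complex.Im tau by case/andP: (hz 0) => /lt_trans /[apply].
have t3 : 0 < complex.Im (3 * tau) by rewrite Im3M mulr_gt0.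
have ann j : cabs (e2pi (3 * tau)) < cabs (e2pi (3 * z j 0)) < 1.
  have /andP[h1 h2] := hz j.
  have pi0 := @pi_gt0 R.
  rewrite !cabs_e2pi ltr_expR expR_lt1 ltrN2 oppr_lt0 !Im3M.
  by apply/andP; split; [rewrite !ltr_pM2l// mulr_gt0|rewrite !mulr_gt0].
rewrite f2_meroE kron_prod//.
apply: eq_hsum (kronecker_double (e2pi_neq0 _) (ann 0) (ann 1)) => -[n1 n2].
rewrite f2_termE chi2_strip; last 2 first.
- by have /andP[h1 h2] := hz 0; rewrite divr_gt0// ltr_pdivrMr// mul1r.
- by have /andP[h1 h2] := hz 1; rewrite divr_gt0// ltr_pdivrMr// mul1r.
rewrite /dbl_term /= -!e2piMz -!e2piD; congr (_ * e2pi _).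
by rewrite intrM; ring.
Qed.

(** A translation of the summation index moves [z] into the strip, and multiplies
    both sides by the same factor. *)
Lemma f2_hsum (z : 'cV[C]_2) tau : 0 < complex.Im tau ->
  (forall (j : 'I_2) (n : int), complex.Im (z j 0) <> n%:~R * complex.Im tau) ->
  hsum (f2_term z tau) (f2_mero z tau).
Proof.
move=> t0 hz.
have [k1 hk1] := floor_strip t0 (hz 0); have [k2 hk2] := floor_strip t0 (hz 1).
pose k (j : 'I_2) := if j == 0 then k1 else k2.
pose w : 'cV[C]_2 := \col_j (z j 0 - (k j)%:~R * tau).
have w0 : w 0 0 = z 0 0 - k1%:~R * tau by rewrite mxE.
have w1 : w 1 0 = z 1 0 - k2%:~R * tau by rewrite mxE.
have hw j : 0 < complex.Im (w j 0) < complex.Im tau.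
  rewrite mxE Im_add Im_opp Im_intM /k.
  have [->|->] : j = 0 \/ j = 1.
    by case: j => -[|[|//]] i; [left|right]; exact/val_inj.
  - exact: hk1.
  - exact: hk2.
have hs := f2_strip_hsum hw.
have h2 := hsum_reindex (f := fun n : int * int => (n.1 + k1, n.2 + k2))
  (g := fun n : int * int => (n.1 - k1, n.2 - k2))
  (fun n => ltac:(by case: n => ? ?; rewrite /= !addrK))
  (fun n => ltac:(by case: n => ? ?; rewrite /= !subrK)) hs.
pose e := e2pi (- ((k1 * k2)%:~R * (3 * tau)) - k2%:~R * (3 * w 0 0) - k1%:~R * (3 * w 1 0)).
have -> : f2_mero z tau = e * f2_mero w tau.
  rewrite !f2_meroE.
  have -> : 3 * z 0 0 = 3 * w 0 0 + k1%:~R * (3 * tau) + (0 : int)%:~R by rewrite w0 mulr0z; ring.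
  have -> : 3 * z 1 0 = 3 * w 1 0 + k2%:~R * (3 * tau) + (0 : int)%:~R by rewrite w1 mulr0z; ring.
  by rewrite kron_quasi// Im3M mulr_gt0.
apply: eq_hsum (hsumZ (c := e) h2) => -[n1 n2] /=; rewrite !f2_termE mulrCA -e2piD.
have v0 : complex.Im tau != 0 by rewrite gt_eqF.
congr ((chi2 _ _)%:C * e2pi _).
- by rewrite w0 Im_add Im_opp Im_intM intrD; field.
- by rewrite w1 Im_add Im_opp Im_intM intrD; field.
- by rewrite w0 w1 !intrD intrM; ring.
Qed.

Lemma f2_mero_quasi (z : 'cV[C]_2) (tau : C) (l m : 'cV[int]_2) : 0 < complex.Im tau ->
  f2_mero (z + tau *: map_mx intr l + map_mx intr m) tau
  = e2pi tau ^ (- 3 * l 0 0 * l 1 0)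
    * e2pi (z 0 0) ^ (- 3 * l 1 0) * e2pi (z 1 0) ^ (- 3 * l 0 0)
    * f2_mero z tau.
Proof.
move=> t0; rewrite !f2_meroE !mxE.
have E j : 3 * (z j 0 + tau * (l j 0)%:~R + (m j 0)%:~R) =
   3 * z j 0 + (l j 0)%:~R * (3 * tau) + (3 * m j 0)%:~R.
  by rewrite intrM -[3%:~R]/(3%:R : C); ring.
rewrite !E kron_quasi; last by rewrite Im3M mulr_gt0.
congr (_ * _); rewrite -!e2piMz -!e2piD; congr e2pi.
by rewrite !intrM mulrNz -[3%:~R]/(3%:R : C); ring.
Qed.

Lemma det2 (g : 'M[int]_2) : \det g = g 0 0 * g 1 1 - g 0 1 * g 1 0.
Proof.
rewrite (expand_det_row g 0) !big_ord_recl big_ord0 /cofactor !det_mx11 !mxE /= addr0.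
have -> : lift ord0 ord0 = 1 :> 'I_2 by apply/val_inj.
have -> : lift (1 : 'I_2) ord0 = 0 :> 'I_2 by apply/val_inj.
by rewrite /bump /= !expr0 !expr1; ring.
Qed.

(** For [c] divisible by [3], the matrix [(a, 3 b; c / 3, d)] of determinant one takes
    [3 tau] to three times the image of [tau]. *)
Lemma f2_mero_modular (g : 'M[int]_2) (z : 'cV[C]_2) (tau : C) :
  Gamma0 3 g -> 0 < complex.Im tau ->
  f2_mero ((autfactor g tau)^-1 *: z) (moebius g tau)
  = autfactor g tau
    * cexp (6 * pi%:C * 'i * (g 1 0)%:~R * z 0 0 * z 1 0 / autfactor g tau)
    * f2_mero z tau.
Proof.
move=> [det /dvdzP[c' hc]] t0; rewrite !f2_meroE !mxE /moebius /autfactor.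
have det' : g 0 0 * g 1 1 - (3 * g 0 1) * c' = 1.
  by move: det; rewrite /SL2Z /= det2 hc => det1; rewrite -[RHS]det1; ring.
have t3 : 0 < complex.Im (3 * tau) by rewrite Im3M mulr_gt0.
have jE : (g 1 0)%:~R * tau + (g 1 1)%:~R = c'%:~R * (3 * tau) + (g 1 1)%:~R :> C.
  by rewrite hc intrM -[3%:~R]/(3%:R : C); ring.
rewrite jE; set j := c'%:~R * (3 * tau) + (g 1 1)%:~R.
have E (x : C) : 3 * (j^-1 * x) = (3 * x) / j by ring.
have -> : 3 * (((g 0 0)%:~R * tau + (g 0 1)%:~R) / j) =
  ((g 0 0)%:~R * (3 * tau) + (3 * g 0 1)%:~R) / j.
  by rewrite intrM -[3%:~R]/(3%:R : C); ring.
rewrite !E (kron_modular _ _ det' t3) -/j; congr (_ * _ * _).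
rewrite /e2pi; congr cexp; rewrite hc intrM -[3%:~R]/(3%:R : C).
by ring.
Qed.

Lemma bilin_f2 (u w : 'cV[C]_2) : bilin f2_index u w =
  3 / 2 * (u 0 0 * w 1 0 + u 1 0 * w 0 0).
Proof.
rewrite /bilin mxE !big_ord_recl big_ord0 !mxE !big_ord_recl !big_ord0 !mxE /=.
rewrite !(mulr0, rmorph0, addr0, add0r).
have -> : ratr (2^-1 * 3 : rat) = 3 / 2 :> C.
  by rewrite rmorphM fmorphV !rmorph_nat mulrC.
have -> : lift ord0 ord0 = 1 :> 'I_2 by apply/val_inj.
by ring.
Qed.

End Parallelograms.

(** * Holomorphy in both variables *)

Section Differentiability.
Variable R : realType.
Local Notation C := R[i].
Local Opaque eta theta.

Section Quadratic.
Variable V : normedModType C.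

Definition rnorm (h : V) : R := complex.Re `|h|.

Lemma rnormE (h : V) : `|h| = (rnorm h)%:C.
Proof. by rewrite /rnorm RRe_real// normr_real. Qed.

Lemma rnorm_ge0 (h : V) : 0 <= rnorm h.
Proof. by rewrite -lecR -rnormE normr_ge0. Qed.

Lemma near_rnorm (x : V) (d : R) : 0 < d -> \forall y \near x, rnorm (y - x) < d.
Proof.
move=> d0; have dC : 0 < d%:C :> C by rewrite (ltcR 0).
apply: filterS (nbhsx_ballx x _ dC) => y.
by rewrite -ball_normE /ball_ /= distrC rnormE ltcR.
Qed.

Lemma quadratic_differentiable (f L : V -> C) (x : V) (K M d : R) :
  linear L -> 0 < K -> 0 < d -> 0 <= M ->
  (forall h, cabs (L h) <= K * rnorm h) ->
  (forall h, rnorm h <= d -> cabs (f (h + x) - f x - L h) <= M * rnorm h ^+ 2) ->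
  differentiable f x.
Proof.
move=> linL K0 d0 M0 LK fM.
pose LM := GRing.isLinear.Build _ _ _ _ L linL.
pose LL : {linear V -> C} := HB.pack L LM.
have contL : continuous LL.
  move=> y; apply/ccvgP => e e0.
  have eK : 0 < e / K by rewrite divr_gt0.
  apply: filterS (near_rnorm y eK) => w hw.
  rewrite -linearB; apply: le_lt_trans (LK _) _.
  by rewrite mulrC -ltr_pdivlMr.
have eqo : f \o shift x = cst (f x) + LL +o_ 0 id.
  apply/eqaddoP => e.
  rewrite ltcE /= => /andP[/eqP Ie Re0].
  have -> : e = (complex.Re e)%:C by case: e Ie {Re0} => a b /= ->.
  have M1 : 0 < M + 1 by lra.
  have d1 : 0 < Num.min d (complex.Re e / (M + 1)) by rewrite lt_min d0 divr_gt0.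
  apply: filterS (near_rnorm 0 d1) => h; rewrite subr0 lt_min => /andP[h1 h2].
  rewrite rnormE cabsE -rmorphM lecR.
  have := fM h (ltW h1); rewrite /= opprD addrA => h3.
  apply: le_trans h3 _; rewrite expr2 mulrA ler_wpM2r ?rnorm_ge0//.
  move: h2; rewrite ltr_pdivlMr// => h2; have := rnorm_ge0 h; nra.
apply/diff_locallyP; rewrite (diff_unique contL eqo); split => //.
Qed.
End Quadratic.

Lemma rnorm_pair (h : 'cV[C]_2 * C) :
  cabs h.2 <= rnorm h /\ forall i, cabs (h.1 i 0) <= rnorm h.
Proof.
have hE : `|h| = Num.max `|h.1| `|h.2| by rewrite prod_normE.
have cmp : (`|h.1| >=< `|h.2|)%O by apply: real_comparable; rewrite normr_real.
split=> [|i]; rewrite -lecR -cabsE -rnormE hE comparable_le_max// ?lexx ?orbT//.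
apply/orP; left; rewrite [leRHS]/Num.norm /= mx_normE -[leLHS]nngE num_le.
exact: (le_bigmax _ (fun ij => `|h.1 ij.1 ij.2|%:nng) (i, 0)).
Qed.

(** The joint Taylor bound for weighted theta series, composed with a linear form
    in [z]. *)
Lemma wtheta_differentiable (w : int -> C) (a b : C) (p : 'cV[C]_2 * C) :
  weight w -> 0 < complex.Im p.2 ->
  differentiable (fun x : 'cV[C]_2 * C =>
    wtheta w (a * x.1 0 0 + b * x.1 1 0) (3 * x.2) : C) p.
Proof.
move=> ww t0.
pose l (h : 'cV[C]_2) := a * h 0 0 + b * h 1 0.
pose A := wtheta (dzw w) (l p.1) (3 * p.2).
pose B := wtheta (dtw w) (l p.1) (3 * p.2).
pose L (h : 'cV[C]_2 * C) := l h.1 * A + 3 * h.2 * B.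
have linL : linear L.
  move=> c u v; rewrite /L /l /= !mxE -[c *: u.2]/(c * u.2).
  by rewrite -[c *: (_ + _)]/(c * (_ + _)); ring.
pose E := cabs a + cabs b.
have E0 : 0 <= E by rewrite addr_ge0.
have lE (h : 'cV[C]_2 * C) : cabs (l h.1) <= E * rnorm h.
  have [_ h1] := rnorm_pair h; apply: le_trans (cabsD _ _) _.
  by rewrite !cabsM /E mulrDl lerD// ler_wpM2l.
have v0 : 0 < complex.Im (3 * p.2) by rewrite Im3M mulr_gt0.
set v := complex.Im (3 * p.2) in v0.
have [M [M0 hM]] := wtheta_taylor (cabs (l p.1) + E) ww v0.
apply: (@quadratic_differentiable _ _ L p (E * cabs A + 3 * cabs B + 1)
  (M * (E + 3) ^+ 2) (Num.min 1 (v / 12))) => //.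
- by rewrite ltr_wpDl// addr_ge0 ?mulr_ge0.
- by rewrite lt_min ltr01 divr_gt0.
- by rewrite mulr_ge0// sqr_ge0.
- move=> h; have [h2 _] := rnorm_pair h; have n0 := rnorm_ge0 h.
  apply: le_trans (cabsD _ _) _; rewrite !cabsM cabs_nat.
  have e1 := ler_wpM2r (cabs_ge0 A) (lE h).
  have e2 := ler_wpM2r (cabs_ge0 B) h2.
  by nra.
move=> h; rewrite le_min => /andP[n1 n2].
have [h2 _] := rnorm_pair h; have n0 := rnorm_ge0 h; have le := lE h.
have c1 := cabs_ge0 (l p.1).
have -> : a * (h + p).1 0 0 + b * (h + p).1 1 0 = l p.1 + l h.1.
  by rewrite /l !mxE; ring.
have -> : 3 * (h + p).2 = 3 * p.2 + 3 * h.2 by rewrite -[(h + p).2]/(h.2 + p.2); ring.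
have b1 : cabs (l p.1) <= cabs (l p.1) + E by lra.
have b2 : cabs (l h.1) <= cabs (l p.1) + E.
  apply: le_trans le _; have : E * rnorm h <= E by rewrite ler_piMr.
  lra.
have b3 : cabs (3 * h.2) <= v / 4 by rewrite cabsM cabs_nat; lra.
have := hM _ _ _ _ b1 b2 (lexx _) b3; rewrite -/A -/B => key.
apply: le_trans key _; rewrite -mulrA ler_wpM2l// -exprMn lerXn2r ?nnegrE ?addr_ge0//.
  by rewrite mulr_ge0// addr_ge0.
by rewrite cabsM cabs_nat; lra.
Qed.

End Differentiability.

(** * The Jacobi form *)

Section JacobiForm.
Variable R : realType.
Local Notation C := R[i].
Local Opaque eta theta.

Definition upper : set ('cV[C]_2 * C) := [set p | 0 < complex.Im p.2].

Lemma open_upper : open upper.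
Proof.
rewrite openE => p p0; apply: filterS (near_rnorm p p0) => y hy.
have [h2 _] := rnorm_pair (y - p).
have := le_lt_trans (le_trans (Im_le_cabs _) h2) hy.
have -> : (y - p).2 = y.2 - p.2 by [].
rewrite Im_add Im_opp ltr_norml => /andP[+ _].
by rewrite /upper /=; lra.
Qed.

(** The cube of eta is replaced by the derivative of theta at [0], whose series is
    holomorphic in [tau] by the same Taylor bound. The zero coefficients make that
    derivative a weighted theta series of a linear form in [z]. *)
Definition numer (p : 'cV[C]_2 * C) : C :=
  - 'i * (- (2 * pi%:C)^-1) * (wtheta (dzw (fun=> 1)) (0 * p.1 0 0 + 0 * p.1 1 0) (3 * p.2)
    * wtheta (fun=> 1) (3 * p.1 0 0 + 3 * p.1 1 0) (3 * p.2)).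

Definition denom (p : 'cV[C]_2 * C) : C :=
  wtheta (fun=> 1) (3 * p.1 0 0 + 0 * p.1 1 0) (3 * p.2)
  * wtheta (fun=> 1) (0 * p.1 0 0 + 3 * p.1 1 0) (3 * p.2).

Lemma denomE z tau : denom (z, tau) = theta (3 * z 0 0) (3 * tau) * theta (3 * z 1 0) (3 * tau).
Proof. by rewrite /denom /= !theta_wtheta !mul0r add0r addr0. Qed.

Lemma f2_mero_quotient (z : 'cV[C]_2) tau : 0 < complex.Im tau ->
  f2_mero z tau = numer (z, tau) / denom (z, tau).
Proof.
move=> t0; have t3 : 0 < complex.Im (3 * tau) by rewrite Im3M mulr_gt0.
rewrite denomE /f2_mero /numer /= -!theta_wtheta !mul0r addr0 -/(theta_deriv0 _).
rewrite theta_deriv0_eta//.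
have pi0 : 2 * pi%:C != 0 :> C.
  rewrite mulf_neq0 ?pnatr_eq0// -cabs_gt0 cabs_real normr_gt0.
  by rewrite gt_eqF// pi_gt0.
move: (theta _ _) (theta (3 * z 0 0) _) (theta (3 * z 1 0) _) (eta _) => T T1 T2 H.
transitivity (((2 * pi%:C) / (2 * pi%:C)) * (- 'i * H ^+ 3 * (T / (T1 * T2)))); last by ring.
by rewrite divff// mul1r.
Qed.

Lemma numer_differentiable p : upper p -> differentiable numer p.
Proof.
move=> up; apply: differentiableM; first exact: differentiable_cst.
apply: differentiableM; apply: wtheta_differentiable => //.
  by apply: weight_dz; exact: weight_cst.
exact: weight_cst.
Qed.

Lemma denom_differentiable p : upper p -> differentiable denom p.
Proof.
by move=> up; apply: differentiableM; apply: wtheta_differentiable => //; exact: weight_cst.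
Qed.

(** Moving both coordinates slightly upwards leaves the lines
    [Im (z j 0)] in [Z * Im tau] that carry the zeros of the denominator. *)
Lemma denom_dense (z : 'cV[C]_2) tau : 0 < complex.Im tau ->
  closure [set z' | upper (z', tau) /\ denom (z', tau) != 0] z.
Proof.
move=> t0 B /nbhs_ballP[d /= d0 hB].
have dE : d = (complex.Re d)%:C by move: d0; rewrite ltcE; case: (d) => x y /= /andP[/eqP ->].
have Rd0 : 0 < complex.Re d by move: d0; rewrite ltcE => /andP[].
set v := complex.Im tau in t0 *.
(* r j is the height of z j above the line Im = n j * v just below it *)
pose n (j : 'I_2) := Num.floor (complex.Im (z j 0) / v).
pose r (j : 'I_2) := complex.Im (z j 0) - (n j)%:~R * v.
have r_itv j : 0 <= r j < v.
  have := floor_itv (complex.Im (z j 0) / v) => /andP[].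
  rewrite ler_pdivlMr// ltr_pdivrMr// intrD mulrDl mul1r -/(n j) /r => h1 h2.
  by apply/andP; split; lra.
(* an upward shift that stays in the ball and below the next line *)
pose e := Num.min (complex.Re d) (Num.min (v - r 0) (v - r 1)) / 2.
have e0 : 0 < e.
  have /andP[_ h0] := r_itv 0; have /andP[_ h1] := r_itv 1.
  by rewrite divr_gt0// !lt_min Rd0 !subr_gt0 h0 h1.
have ed : e < complex.Re d.
  have : e * 2 <= complex.Re d by rewrite divfK// ge_min lexx.
  by move: e0; lra.
have er j : r j + e < v.
  have : e * 2 <= v - r j.
    rewrite divfK// !ge_min.
    have [->|->] : j = 0 \/ j = 1.
      by case: j => -[|[|//]] i; [left|right]; exact/val_inj.
    - by rewrite lexx orbT.
    - by rewrite lexx !orbT.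
  by move: e0; lra.
pose z' : 'cV[C]_2 := \col_j (z j 0 + e *i).
have Imz' j : complex.Im (z' j 0) = (n j)%:~R * v + (r j + e).
  by rewrite mxE Im_add /= /r; ring.
exists z'; split; last first.
  apply: hB; split=> // i j; rewrite [j]ord1 mxE -ball_normE /ball_ /= dE cabsE ltcR cabsC.
  rewrite addrC addKr; apply: le_lt_trans (cabs_le_ReIm _) _.
  by rewrite /= normr0 add0r gtr0_norm.
split; first exact: t0.
rewrite denomE; have t3 : 0 < complex.Im (3 * tau) by rewrite Im3M mulr_gt0.
have nz j : theta (3 * z' j 0) (3 * tau) != 0.
  apply: theta_neq0 => // m; rewrite !Im3M Imz' -/v => h.
  have {}h : r j + e = (m - n j)%:~R * v by rewrite intrB; lra.
  have h1 := er j; have /andP[h2 _] := r_itv j.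
  have : 0 < (m - n j)%:~R * v by move: e0; lra.
  rewrite pmulr_lgt0// ltr0z => mn.
  have : (1 : int)%:~R <= (m - n j)%:~R :> R by rewrite ler_int; move: mn; clear; lia.
  rewrite -(ler_pM2r t0) mul1r; lra.
by rewrite mulf_neq0.
Qed.

Lemma f2_mero_meromorphic : meromorphic (@f2_mero R).
Proof.
move=> z0 tau0 t0; exists upper, numer, denom; split.
- exact: open_upper.
- exact: t0.
- by move=> p up; split; [exact: numer_differentiable|exact: denom_differentiable].
- by move=> z tau up; exact: denom_dense.
- by move=> z tau up _; exact: f2_mero_quotient.
Qed.

Lemma theta_block_ub (x q : C) : cabs q <= 2^-1 -> cabs (q / x) <= 2^-1 ->
  cabs (pochoo x q * pochoo (q / x) q) <= expR (2 * cabs x + 1).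
Proof.
move=> hq hqx; have q1 : cabs q < 1 by lra.
have i2 : (1 - cabs q)^-1 <= 2.
  by rewrite -[leRHS]invrK lef_pV2 ?posrE; lra.
rewrite cabsM expRD; apply: ler_pM => //.
  apply: le_trans (pochoo_ub _ q1) _; rewrite ler_expR mulrC ler_wpM2r//.
apply: le_trans (pochoo_ub _ q1) _; rewrite ler_expR.
have := ler_pM (cabs_ge0 (q / x)) (_ : 0 <= (1 - cabs q)^-1) hqx i2.
rewrite invr_ge0 subr_ge0 => /(_ (ltW q1)); lra.
Qed.

Lemma pochoo_lb_half (x q : C) : cabs q <= 2^-1 -> cabs x <= 2^-1 ->
  expR (- 2) <= cabs (pochoo x q).
Proof.
move=> hq hx; have q1 : cabs q < 1 by lra.
have x1 : cabs x < 1 by lra.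
apply: le_trans (pochoo_lb q1 x1); rewrite ler_expR lerN2.
have i1 : (1 - cabs q)^-1 <= 2 by rewrite -[leRHS]invrK lef_pV2 ?posrE; lra.
have i2 : (1 - cabs x)^-1 <= 2 by rewrite -[leRHS]invrK lef_pV2 ?posrE; lra.
have p1 : 0 <= (1 - cabs q)^-1 by rewrite invr_ge0; lra.
have p2 : 0 <= (1 - cabs x)^-1 by rewrite invr_ge0; lra.
have h := ler_pM (cabs_ge0 x) p2 hx i2.
have := ler_pM (mulr_ge0 (cabs_ge0 x) p2) p1 h i1; lra.
Qed.

Lemma theta_block_lb (x q : C) : cabs q <= 2^-1 -> cabs (x * q) <= 2^-1 ->
  cabs (q / x) <= 2^-1 ->
  cabs (1 - x) * expR (- 4) <= cabs (pochoo x q * pochoo (q / x) q).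
Proof.
move=> hq hxq hqx; have q1 : cabs q < 1 by lra.
rewrite (pochooSl x q1) -mulrA cabsM ler_wpM2l// cabsM.
have -> : - 4 = - 2 + - 2 :> R by ring.
by rewrite expRD; apply: ler_pM; rewrite ?expR_ge0// pochoo_lb_half.
Qed.

(** For fixed [z], all factors of the product expansion tend to [1] as [q] tends to
    [0], except [1 - a] and [1 - b] in the denominator. If one of these two vanishes,
    then the quotient is a division by zero, and its value is [0]. *)
Lemma f2_mero_bounded (z : 'cV[C]_2) : exists K V : R,
  [/\ 0 <= K, 1 <= V & forall tau : C, V <= complex.Im tau -> cabs (f2_mero z tau) <= K].
Proof.
pose a := e2pi (3 * z 0 0); pose b := e2pi (3 * z 1 0).
pose A := cabs a; pose B := cabs b.
have A0 : 0 < A by rewrite cabs_gt0 e2pi_neq0.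
have B0 : 0 < B by rewrite cabs_gt0 e2pi_neq0.
(* if q is at most 1 / (2 S), then q times each of 1, A, B and the inverses
   of A, B and A B is at most 1 / 2 *)
pose S := 1 + (A + B + A * B) + (A^-1 + B^-1 + (A * B)^-1).
have AB0 : 0 < A * B by rewrite mulr_gt0.
have iA := ltW (_ : 0 < A^-1); have iB := ltW (_ : 0 < B^-1); have iAB := ltW (_ : 0 < (A * B)^-1).
rewrite !invr_gt0 in iA iB iAB; have {}iA := iA A0; have {}iB := iB B0; have {}iAB := iAB AB0.
have S1 : 1 <= S by rewrite /S; lra.
pose K := expR 1 ^+ 2 * expR (2 * (A * B) + 1) *
  (cabs (1 - a) * expR (- 4) * (cabs (1 - b) * expR (- 4)))^-1.
exists K, (2 * S); split.
- by rewrite !mulr_ge0 ?invr_ge0 ?mulr_ge0 ?expR_ge0 ?exprn_ge0 ?expR_ge0.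
- lra.
move=> tau hv; have t0 : 0 < complex.Im tau by lra.
have t3 : 0 < complex.Im (3 * tau) by rewrite Im3M mulr_gt0.
set q := e2pi (3 * tau).
have hq : cabs q * S <= 2^-1.
  have pi2 := @pi_ge2 R.
  have h1 : complex.Im tau <= 2 * pi * complex.Im (3 * tau) by rewrite Im3M; nra.
  have : cabs q <= (2 * S)^-1.
    rewrite cabs_e2pi expRN lef_pV2 ?posrE ?expR_gt0 ?mulr_gt0//; last by lra.
    apply: le_trans (expR_ge1Dx _); lra.
  rewrite -(ler_pM2r (_ : 0 < S)); last by lra.
  by rewrite invfM -mulrA mulVf ?mulr1// gt_eqF//; lra.
have small (x : R) : 0 <= x -> x <= S -> cabs q * x <= 2^-1.
  by move=> x0 xS; apply: le_trans hq; rewrite ler_wpM2l.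
have q2 : cabs q <= 2^-1 by rewrite -[cabs q]mulr1; apply: small.
have qa : cabs (a * q) <= 2^-1 by rewrite cabsM mulrC; apply: small => //; rewrite /S -/A; lra.
have qb : cabs (b * q) <= 2^-1 by rewrite cabsM mulrC; apply: small => //; rewrite /S -/B; lra.
have qa' : cabs (q / a) <= 2^-1 by rewrite cabsM cabsV; apply: small; rewrite /S -/A//; lra.
have qb' : cabs (q / b) <= 2^-1 by rewrite cabsM cabsV; apply: small; rewrite /S -/B//; lra.
have qab' : cabs (q / (a * b)) <= 2^-1.
  by rewrite cabsM cabsV [cabs (a * b)]cabsM; apply: small; rewrite /S -/A -/B//; lra.
have q1 : cabs q < 1 by lra.
rewrite f2_meroE kron_prod// -/q -/a -/b.
rewrite cabsM cabsV [cabs (_ ^+ 2 * _)]cabsM cabsX [cabs (_ * (_ * pochoo (q / b) q))]cabsM.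
have La := theta_block_lb q2 qa qa'; have Lb := theta_block_lb q2 qb qb'.
have U := theta_block_ub q2 qab'; rewrite [cabs (a * b)]cabsM -/A -/B in U.
have Q1 : cabs (pochoo q q) <= expR 1.
  apply: le_trans (pochoo_ub q q1) _; rewrite ler_expR ler_pdivrMr; lra.
apply: ler_pM.
- by rewrite mulr_ge0// exprn_ge0.
- by rewrite invr_ge0 mulr_ge0.
- apply: ler_pM => //; first by rewrite exprn_ge0.
  by rewrite lerXn2r ?nnegrE ?expR_ge0.
have [a1|a1] := eqVneq a 1.
  have -> : pochoo a q = 0 by rewrite (pochooSl a q1) a1 subrr mul0r.
  by rewrite mul0r cabs0 mul0r invr0 invr_ge0 !mulr_ge0 ?expR_ge0.
have [b1|b1] := eqVneq b 1.
  have -> : pochoo b q = 0 by rewrite (pochooSl b q1) b1 subrr mul0r.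
  by rewrite mul0r cabs0 mulr0 invr0 invr_ge0 !mulr_ge0 ?expR_ge0.
have pa : 0 < cabs (1 - a) * expR (- 4) by rewrite mulr_gt0 ?expR_gt0// cabs_gt0 subr_eq0 eq_sym.
have pb : 0 < cabs (1 - b) * expR (- 4) by rewrite mulr_gt0 ?expR_gt0// cabs_gt0 subr_eq0 eq_sym.
have Pa := lt_le_trans pa La; have Pb := lt_le_trans pb Lb.
rewrite lef_pV2 ?posrE; [|exact: mulr_gt0|exact: mulr_gt0].
by apply: ler_pM => //; exact: ltW.
Qed.

(** For fixed [z], the exponential factor is bounded as well, since its exponent is
    a constant divided by [Im tau]. *)
Lemma f2_mero_growth (z : 'cV[C]_2) : exists K V : R, forall tau : C,
  V <= complex.Im tau ->
  let y := map_mx (fun w : C => (complex.Im w)%:C) z in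
  `| f2_mero z tau * cexp (- (4 * pi%:C / (complex.Im tau)%:C) * bilin f2_index y y) |
    <= (K * expR (1 * complex.Im tau))%:C.
Proof.
have [K [V [K0 V1 hK]]] := f2_mero_bounded z.
pose c := 12 * pi * `|complex.Im (z 0 0) * complex.Im (z 1 0)| : R.
exists (K * expR c), V => tau hV; cbv zeta; set y := map_mx _ _.
rewrite cabsE lecR cabsM -[leRHS]mulrA; apply: ler_pM => //; first exact: hK.
have t1 : 1 <= complex.Im tau by lra.
set v := complex.Im tau in t1 *.
have pi0 := @pi_gt0 R.
have -> : - (4 * pi%:C / v%:C) * bilin f2_index y y =
   (- (12 * pi / v * (complex.Im (z 0 0) * complex.Im (z 1 0))))%:C.
  rewrite bilin_f2 !mxE !(rmorphN, rmorphM, fmorphV, rmorph_nat).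
  by field; rewrite -cabs_gt0 cabs_real normr_gt0 gt_eqF//; lra.
rewrite cabs_cexp /= -expRD ler_expR mul1r.
apply: le_trans (ler_norm _) _; rewrite normrN normrM -/c.
apply: (@le_trans _ _ c); last by lra.
rewrite /c ler_wpM2r// ger0_norm; last by rewrite divr_ge0 ?mulr_ge0//; lra.
rewrite ler_pdivrMr; last by lra.
by rewrite ler_peMr// mulr_ge0// ltW.
Qed.

Lemma quasi_factor (t x y : C) (a b : int) :
  e2pi t ^ (- 3 * a * b) * e2pi x ^ (- 3 * b) * e2pi y ^ (- 3 * a)
  = cexp (- (4 * pi%:C * 'i * (3 / 2 * (x * b%:~R + y * a%:~R))))
    * e2pi (- (3 / 2 * (a%:~R * b%:~R + b%:~R * a%:~R)) * t).
Proof.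
have -> (w : C) : cexp (- (4 * pi%:C * 'i * w)) = e2pi (- (2 * w)).
  by rewrite /e2pi; congr cexp; ring.
rewrite -(e2piMz _ t) -(e2piMz _ x) -(e2piMz _ y) -!e2piD; congr e2pi.
by rewrite !intrM mulrNz; field.
Qed.

Lemma f2_mero_jacobi : meromorphic_jacobi_form 1 f2_index (Gamma0 3) (@f2_mero R).
Proof.
split.
- split=> [g []//|i j]; rewrite !mxE mulrA mulfV// mul1r.
  by case: ifP.
- exact: f2_mero_meromorphic.
- exists 1 => // z; have [K [V h]] := f2_mero_growth z.
  by exists K, V => tau _ hV _; exact: h.
- move=> tau z l m t0; cbv zeta; move=> _ _; apply: (etrans (f2_mero_quasi z l m t0)).
  move: (f2_mero z tau) => F; congr (_ * F).
  by rewrite !bilin_f2 quasi_factor !mxE.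
- move=> g tau z hg t0; cbv zeta; move=> _ _; apply: (etrans (f2_mero_modular z hg t0)).
  rewrite expr1z bilin_f2; move: (f2_mero z tau) => F.
  by congr (_ * cexp _ * F); move: (autfactor g tau)^-1 => w; field.
Qed.

End JacobiForm.

Theorem proposition5p2 (R : realType) :
  [/\ forall (z : 'cV[R[i]]_2) (tau : R[i]), 0 < complex.Im tau ->
        (forall (j : 'I_2) (n : int), complex.Im (z j 0) <> n%:~R * complex.Im tau) ->
        cvg (partial_sum (f2_term z tau) @ totally)
        /\ f2 z tau =
           - 'i * eta (3 * tau) ^+ 3
           * (theta (3 * z 0 0 + 3 * z 1 0) (3 * tau)
              / (theta (3 * z 0 0) (3 * tau) * theta (3 * z 1 0) (3 * tau))),
      meromorphic_jacobi_form 1 f2_index (Gamma0 3) (@f2_mero R),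
      forall (z : 'cV[R[i]]_2) (tau : R[i]) (l m : 'cV[int]_2), 0 < complex.Im tau ->
        f2_mero (z + tau *: map_mx intr l + map_mx intr m) tau
        = e2pi tau ^ (- 3 * l 0 0 * l 1 0)
          * e2pi (z 0 0) ^ (- 3 * l 1 0) * e2pi (z 1 0) ^ (- 3 * l 0 0)
          * f2_mero z tau
    & forall (g : 'M[int]_2) (z : 'cV[R[i]]_2) (tau : R[i]),
        Gamma0 3 g -> 0 < complex.Im tau ->
        f2_mero ((autfactor g tau)^-1 *: z) (moebius g tau)
        = autfactor g tau
          * cexp (6 * pi%:C * 'i * (g 1 0)%:~R * z 0 0 * z 1 0
                  / autfactor g tau)
          * f2_mero z tau].
Proof.
split; [|exact: f2_mero_jacobi|exact: f2_mero_quasi|exact: f2_mero_modular].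
move=> z tau t0 hz; have hs := f2_hsum t0 hz.
by split; [exact: cvgP hs|exact: hsum_sum hs].
Qed.
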